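(* Let $\gamma\in\mathcal{T}_1$ and let $x,y$ be hyperbolic periodic points for $T_\gamma$ such that $W^s(x)\cap W^u(y)\neq\emptyset$. Then there exist a heteroclinic (homoclinic, if $x=y$) point $z$ of $T_\gamma$ and $\gamma_\varepsilon$, an arbitrarily small $C^k$-normal $\varepsilon$-perturbation of $\gamma$, $k\ge2$, such that: 1. $x$ and $y$ are hyperbolic periodic points for $T_{\gamma_\varepsilon}$; 2. $z$ is a heteroclinic (homoclinic, if $x=y$) point of $T_{\gamma_\varepsilon}$; 3. $T_zW^s(x)\oplus T_zW^u(y)=\mathbb{R}^2$ for $T_{\gamma_\varepsilon}$, that is, with $W^s(x)$ and $W^u(y)$ the stable and unstable manifolds for $T_{\gamma_\varepsilon}$.
   Context: Tables. Let $\mathbb{S}=\mathbb{R}/2\pi\mathbb{Z}$. $\mathcal{S}$ denotes the set of strongly convex planar billiard tables with $C^\infty$ boundary; a table is identified with a $C^\infty$ parametrization $\gamma:\mathbb{S}\to\Gamma$ of its boundary $\Gamma=\gamma(\mathbb{S})\subset\mathbb{R}^2$, which is oriented counterclockwise, has everywhere strictly positive curvature, and has perimeter normalized to $2\pi$. $\mathcal{S}$ carries the Whitney $C^\infty$ topology ($\gamma_m\to\gamma$ iff $\|\gamma_m-\gamma\|_{C^k}\to0$ for every $k\ge0$). A subset of $\mathcal{S}$ is residual if it contains a countable intersection of open dense subsets. Symplectic billiard. For $t\in\mathbb{S}$, $t^*\ne t$ is the unique parameter with $\det(\gamma'(t),\gamma'(t^* ))=0$. The phase space is $\hat{\mathcal{P}}_\gamma=\{(\gamma(t_1),\gamma(t_2)):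 t_1<t_2<t_1^*\}$ (cyclic counterclockwise order). The symplectic billiard map is $\hat T_\gamma(\gamma(t_1),\gamma(t_2))=(\gamma(t_2),\gamma(t_3))$, where $\gamma(t_3)$ is the unique point of $\Gamma$ with $(\gamma(t_2),\gamma(t_3))\in\hat{\mathcal{P}}_\gamma$ and $\det(\gamma'(t_2),\gamma(t_3)-\gamma(t_1))=0$. Coordinates. Fix an origin $O$ in the interior of the table (the same for $\gamma$ and its small perturbations), let $L(t_1,t_2)=\det(\gamma(t_1)-O,\gamma(t_2)-O)$ and let $L_1,L_2$ be its partial derivatives. Then $(t_1,s_1)$ with $s_1=-L_1(t_1,t_2)$ are coordinates on the phase space, which becomes $\mathcal{P}_\gamma=\{(t,s): -L_1(t,t^* )<s<-L_1(t,t)\}\subset\mathbb{S}\times\mathbb{R}$; in them the map is $T_\gamma:\mathcal{P}_\gamma\to\mathcal{P}_\gamma$, $(t_1,-L_1(t_1,t_2))\mapsto(t_2,L_2(t_1,t_2))$. It preserves $ds\wedge dt$. $\mathcal{T}_1\subset\mathcal{S}$ is a residual set such that for every $\gamma\in\mathcal{T}_1$ no periodic orbit of $T_\gamma$ passes, within one period, through the same boundary point more than once. A periodic point $x$ of least period $n$ is hyperbolic if $DT_\gamma^n(x)$ has no eigenvalue of modulus $1$. With $d$ the distance in $\mathcal{P}_\gamma$, the stable and unstable manifolds of a hyperbolic periodic point $x$ are $W^s(x)=\{z\in\mathcal{P}_\gamma: d(T^m_\gamma(z),T^m_\gamma(x))\to0 \text{ as } m\to+\infty\}$ and $W^u(x)=\{z\in\mathcal{P}_\gamma: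 d(T^{-m}_\gamma(z),T^{-m}_\gamma(x))\to0\text{ as } m\to+\infty\}$; these are $C^1$-immersed curves. For hyperbolic periodic points $x\neq y$, a point $z\in W^s(x)\cap W^u(y)$ is called heteroclinic; in the case $x=y$ the corresponding term is homoclinic. A $C^k$-normal $\varepsilon$-perturbation of $\gamma$ is a curve $\gamma_\varepsilon(t)=\gamma(t)+\varepsilon\mu(t)\mathbf{n}(t)$, with $\mathbf{n}(t)$ the unit normal to $\Gamma$ at $\gamma(t)$ and $\mu:\mathbb{S}\to\mathbb{R}$ a $C^\infty$ function, such that $\gamma_\varepsilon$ still has strictly positive curvature; arbitrarily small means that for every $\eta>0$ it can be chosen with $\|\gamma_\varepsilon-\gamma\|_{C^k}<\eta$. *)

(* Defs.v *)
From HB Require Import structures.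
From mathcomp Require Import all_boot all_order all_algebra.
From mathcomp Require Import all_classical all_reals all_analysis.
From mathcomp Require Import complex ring.

Set Implicit Arguments.
Unset Strict Implicit.
Unset Printing Implicit Defensive.

Import Order.TTheory GRing.Theory Num.Theory.
Import numFieldNormedType.Exports.

Local Open Scope ring_scope.
Local Open Scope classical_set_scope.

(* These shadow the formal derivatives of polynomials. *)
#[local] Set Warnings "-notation-overridden".
Local Notation "f ^` ()" := (derive1 f) : ring_scope.
Local Notation "f ^` ( n )" := (derive1n n f) : ring_scope.

(* Both the parameter circle S = R/2piZ and the phase cylinder S x R are       *)
(* handled on their universal covers: functions on S are 2pi-periodic          *)
(* functions on R, a point (t, s) of S x R is given by any of its lifts in     *)
(* 'rV[R]_2, and subsets of S x R by their full preimages, which are invariant *)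
(* under (t, s) |-> (t + 2pi, s).                                              *)

Section Plane.
Context {R : realType}.

Definition pair2 (a b : R) : 'rV[R]_2 :=
  \row_(i < 2) (if i == 0 then a else b).

Definition det2 (u v : 'rV[R]_2) : R := \det (col_mx u v : 'M[R]_2).

Definition eucl (u : 'rV[R]_2) : R := Num.sqrt (\sum_(i < 2) u 0 i ^+ 2).

Definition smooth {V : normedModType R} (f : R -> V) : Prop :=
  forall (n : nat) (t : R), derivable (f^`(n)) t 1.

(* Taken with the sup norm of 'rV[R]_2. *)
Definition Ck_norm (k : nat) (f : R -> 'rV[R]_2) : R :=
  \big[Num.max/0]_(j < k.+1) sup [set `|f^`(j) t| | t in [set: R]].

End Plane.

Section Tables.
Context {R : realType}.
Implicit Types (gamma : R -> 'rV[R]_2) (U A : set (R -> 'rV[R]_2)).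

(* Signed, so that a simple closed curve with positive curvature everywhere    *)
(* is counterclockwise.                                                        *)
Definition curvature gamma (t : R) : R :=
  det2 (gamma^`(1) t) (gamma^`(2) t) / eucl (gamma^`(1) t) ^+ 3.

Definition strongly_convex gamma : Prop :=
  [/\ smooth gamma, periodic gamma (2 * pi),
      forall t1 t2, gamma t1 = gamma t2 ->
        exists j : int, t1 = t2 + 2 * pi * j%:~R,
      forall t, gamma^`(1) t != 0 &
      forall t, 0 < curvature gamma t].

Definition perimeter gamma : R :=
  \int[lebesgue_measure]_(t in `[0, 2 * pi]) eucl (gamma^`(1) t).

(* The parametrization is not required to be by arc length. *)
Definition normalized_table : set (R -> 'rV[R]_2) :=
  [set gamma | strongly_convex gamma /\ perimeter gamma = 2 * pi].

(* The closed region bounded by the (convex) curve gamma. *)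
Definition region gamma : set 'rV[R]_2 :=
  smallest (convex_set (M := 'rV[R]_2)) (range gamma).

(* Openness and density in normalized_table for the topology defined by all    *)
(* C^k norms.                                                                  *)
Definition table_open U : Prop :=
  U `<=` normalized_table /\
  forall gamma, U gamma -> exists (k : nat) (eta : R), 0 < eta /\
    forall gamma', normalized_table gamma' ->
      Ck_norm k (gamma' \- gamma) < eta -> U gamma'.

Definition table_dense U : Prop :=
  forall gamma, normalized_table gamma -> forall (k : nat) (eta : R), 0 < eta ->
    exists2 gamma', U gamma' & Ck_norm k (gamma' \- gamma) < eta.

Definition residual A : Prop :=
  A `<=` normalized_table /\
  exists2 U : nat -> set (R -> 'rV[R]_2),
    forall n, table_open (U n) /\ table_dense (U n) &
    \bigcap_n U n `<=` A.

Definition unit_normal gamma (t : R) : 'rV[R]_2 :=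
  (eucl (gamma^`(1) t))^-1 *: pair2 (- gamma^`(1) t 0 1) (gamma^`(1) t 0 0).

Definition normal_perturbation gamma (eps : R) (mu : R -> R) :
    R -> 'rV[R]_2 :=
  fun t => gamma t + (eps * mu t) *: unit_normal gamma t.

End Tables.

Section Cylinder.
Context {R : realType}.
Implicit Types (p q z : 'rV[R]_2) (W : set 'rV[R]_2).

Definition cyl_shift (j : int) : 'rV[R]_2 := pair2 (2 * pi * j%:~R) 0.

(* p and q are lifts of the same point of S x R. *)
Definition cyl_eq p q : Prop := exists j : int, p = q + cyl_shift j.

Definition cyl_dist p q : R :=
  inf [set `|p - q - cyl_shift j| | j in [set: int]].

(* W is the image of the injective C^1 immersion R -> S x R lifted by phi. *)
Definition immersed_curve W (phi : R -> 'rV[R]_2) : Prop :=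
  [/\ forall u, derivable phi u 1,
      continuous (phi^`()),
      forall u, phi^`() u != 0,
      forall u v, cyl_eq (phi u) (phi v) -> u = v &
      W = [set p | exists u, cyl_eq p (phi u)]].

(* V = T_z W *)
Definition is_tangent_space W z (V : {vspace 'rV[R]_2}) : Prop :=
  exists (phi : R -> 'rV[R]_2) (u : R),
    [/\ immersed_curve W phi, cyl_eq z (phi u) & V = <[phi^`() u]>%VS].

End Cylinder.

Section Billiard.
Context {R : realType}.
Context (gamma : R -> 'rV[R]_2) (O : 'rV[R]_2).
Implicit Types (p q x y z : 'rV[R]_2).

(* The lift of t^* in ]t, t + 2pi[; then t1 < t2 < star t1 expresses the       *)
(* cyclic order t1 < t2 < t1^*.                                                *)
Definition star (t : R) : R :=
  get [set u | t < u < t + 2 * pi /\ det2 (gamma^`(1) t) (gamma^`(1) u) = 0].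

Definition L (t1 t2 : R) : R := det2 (gamma t1 - O) (gamma t2 - O).
Definition L1 (t1 t2 : R) : R := (fun t => L t t2)^`() t1.
Definition L2 (t1 t2 : R) : R := (fun t => L t1 t)^`() t2.

Definition phase_space : set 'rV[R]_2 :=
  [set p | - L1 (p 0 0) (star (p 0 0)) < p 0 1 < - L1 (p 0 0) (p 0 0)].

(* The t2 with p = (t1, -L1(t1, t2)). *)
Definition next_param p : R :=
  get [set t2 | p 0 0 < t2 < star (p 0 0) /\ p 0 1 = - L1 (p 0 0) t2].

(* (t1, -L1(t1, t2)) |-> (t2, L2(t1, t2)). The image is (t2, -L1(t2, t3)) for  *)
(* the t3 with det(gamma'(t2), gamma(t3) - gamma(t1)) = 0, see billiard_law.   *)
Definition billiard_map p : 'rV[R]_2 :=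
  pair2 (next_param p) (L2 (p 0 0) (next_param p)).

Definition billiard_inv : 'rV[R]_2 -> 'rV[R]_2 :=
  'pinv_(fun=> 0) phase_space billiard_map.

Definition least_period x (n : nat) : Prop :=
  [/\ phase_space x, (0 < n)%N, cyl_eq (iter n billiard_map x) x &
      forall m, (0 < m < n)%N -> ~ cyl_eq (iter m billiard_map x) x].

(* Eigenvalues are taken in R[i]; jacobian is the transposed Jacobian matrix,  *)
(* which has the same ones.                                                    *)
Definition hyperbolic_periodic x : Prop :=
  exists2 n, least_period x n &
    forall lambda : R[i],
      eigenvalue (map_mx (real_complex R) (jacobian (iter n billiard_map) x))
        lambda ->
      `|lambda| != 1.

Definition Ws x : set 'rV[R]_2 :=
  [set z | phase_space z /\
    cyl_dist (iter m billiard_map z) (iter m billiard_map x)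
      @[m --> \oo] --> (0 : R)].

Definition Wu x : set 'rV[R]_2 :=
  [set z | phase_space z /\
    cyl_dist (iter m billiard_inv z) (iter m billiard_inv x)
      @[m --> \oo] --> (0 : R)].

(* Heteroclinic points for x <> y, homoclinic points for x = y. The latter are *)
(* by convention different from x, which lies trivially in both manifolds.     *)
Definition heteroclinic x y : set 'rV[R]_2 :=
  [set z | [/\ Ws x z, Wu y z & cyl_eq x y -> ~ cyl_eq z x]].

End Billiard.

Section Genericity.
Context {R : realType}.

Definition no_repeated_boundary_point (gamma : R -> 'rV[R]_2) : Prop :=
  forall (O : 'rV[R]_2), (region gamma)° O ->
  forall (x : 'rV[R]_2) (n : nat), least_period gamma O x n ->
  forall i j, (i < n)%N -> (j < n)%N ->
    gamma (iter i (billiard_map gamma O) x 0 0) =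
      gamma (iter j (billiard_map gamma O) x 0 0) ->
    i = j.

End Genericity.

Section Law.
Context {R : realType}.

Lemma det2E (u v : 'rV[R]_2) : det2 u v = u 0 0 * v 0 1 - u 0 1 * v 0 0.
Proof.
have E (j : 'I_2) : (col_mx u v : 'M[R]_2) 0 j = u 0 j.
  by rewrite -(col_mxEu u v 0 j); congr (col_mx u v _ _); exact: val_inj.
have F (j : 'I_2) : (col_mx u v : 'M[R]_2) 1 j = v 0 j.
  by rewrite -(col_mxEd u v 0 j); congr (col_mx u v _ _); exact: val_inj.
rewrite /det2 -!E -!F; move: (col_mx u v : 'M[R]_2) => M.
rewrite (expand_det_row _ 0) !big_ord_recl big_ord0 addr0 /cofactor.
rewrite !det_mx11 !mxE /= !expr0 !mul1r /bump /= expr1.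
have -> : lift (0 : 'I_2) 0 = 1 by exact: val_inj.
have -> : lift (1 : 'I_2) 0 = 0 by exact: val_inj.
by rewrite mulN1r mulrN.
Qed.

Lemma derive_det2l (f : R -> 'rV[R]_2) (v : 'rV[R]_2) (t : R) :
  derivable f t 1 -> (fun u => det2 (f u) v)^`() t = det2 (f^`() t) v.
Proof.
move=> df.
have df' (j : 'I_2) : derivable (fun u => f u 0 j) t 1.
  by move/derivable_mxP : df.
have E (j : 'I_2) : f^`() t 0 j = (fun u => f u 0 j)^`() t.
  by rewrite !derive1E derive_mx// mxE.
rewrite (_ : (fun u => _) = (fun u => f u 0 0) \* cst (v 0 1)
    - (fun u => f u 0 1) \* cst (v 0 0)); last first.
  by apply/funext => u; rewrite det2E.
rewrite det2E !E !derive1E deriveB//; last 2 first.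
  exact: derivableM.
  exact: derivableM.
by rewrite !deriveM// !derive_cst !scaler0 !add0r /GRing.scale /= ![_ * v _ _]mulrC.
Qed.

Lemma det2C (u v : 'rV[R]_2) : det2 u v = - det2 v u.
Proof. by rewrite !det2E; ring. Qed.

Lemma det2B (u v w : 'rV[R]_2) : det2 u (v - w) = det2 u v - det2 u w.
Proof. by rewrite !det2E !mxE; ring. Qed.

Lemma derivable_subO (gamma : R -> 'rV[R]_2) (O : 'rV[R]_2) (t : R) :
  smooth gamma -> derivable (fun u => gamma u - O) t 1.
Proof.
move=> sm; have dg : derivable gamma t 1 := sm 0%N t.
exact: (derivableB dg (derivable_cst O t 1)).
Qed.

Lemma L1E (gamma : R -> 'rV[R]_2) (O : 'rV[R]_2) (t1 t2 : R) :
  smooth gamma -> L1 gamma O t1 t2 = det2 (gamma^`() t1) (gamma t2 - O).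
Proof.
move=> sm; have dg : derivable gamma t1 1 := sm 0%N t1.
rewrite /L1 /L derive_det2l; last exact: derivable_subO.
congr det2; rewrite !derive1E.
by rewrite (deriveB dg (derivable_cst O t1 1)) derive_cst subr0.
Qed.

Lemma L2E (gamma : R -> 'rV[R]_2) (O : 'rV[R]_2) (t1 t2 : R) :
  smooth gamma -> L2 gamma O t1 t2 = - det2 (gamma^`() t2) (gamma t1 - O).
Proof.
move=> sm; rewrite -(L1E O) //.
have LC : L gamma O t1 = fun t => det2 (gamma t - O) (O - gamma t1).
  by apply/funext => t; rewrite /L det2C !det2E !mxE; ring.
rewrite /L2 LC derive_det2l; last exact: derivable_subO.
rewrite /L1 /L derive_det2l; last exact: derivable_subO.
by rewrite !det2E !mxE; ring.
Qed.

Lemma billiard_law (gamma : R -> 'rV[R]_2) (O : 'rV[R]_2) (t1 t2 t3 : R) :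
  smooth gamma ->
  L2 gamma O t1 t2 = - L1 gamma O t2 t3 <->
  det2 (gamma^`() t2) (gamma t3 - gamma t1) = 0.
Proof.
move=> sm; rewrite L1E // L2E //.
have -> : gamma t3 - gamma t1 = (gamma t3 - O) - (gamma t1 - O).
  by rewrite opprB addrA subrK.
rewrite [in X in _ <-> X]det2B.
by split => [/oppr_inj ->|/eqP]; [rewrite subrr | rewrite subr_eq0 => /eqP ->].
Qed.

End Law.

(* Main.v *)
Require Import Defs.
From HB Require Import structures.
From mathcomp Require Import all_boot all_order all_algebra.
From mathcomp Require Import all_classical all_reals all_analysis.
From mathcomp Require Import complex ring lra zify.
Set Implicit Arguments.
Unset Strict Implicit.
Unset Printing Implicit Defensive.
Import Order.TTheory GRing.Theory Num.Theory.
Import numFieldNormedType.Exports.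
Local Open Scope ring_scope.
Local Open Scope classical_set_scope.

(** Every heteroclinic point [z] of the given table will do.  The stable and unstable
    sets of a saddle are immersed curves whose tangent vectors are contracted by the
    linearized dynamics, in the future for the stable curve and in the past for the
    unstable one ([stable_manifold], [stable_tangent_decays]).  The linearized dynamics
    preserves area, so at each point the vectors contracted in a given direction of
    time form at most a line ([decays_det]).  Hence the two curves cross transversally
    at [z] as soon as no nonzero vector at [z] is contracted in both directions of time
    ([transverse_tangent_spaces]).  If there is no such vector, the table is left as it
    is.

    Suppose that [w0] is one.  The successive displacements of the bounces under [w0]
    form a Jacobi field, a solution of a three-term recurrence whose diagonal
    coefficients contain the second derivative of the curve at the bounces
    ([jacobi_equation]).  The orbit of [z] approaches the one of [x] along the stable
    curve, so some bounce of [z] is at a point of the boundary not visited by the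
    orbits of [x] and [y], with a nonzero displacement under [w0] ([generic_time]).
    The table is bent at that point by a small normal bump that vanishes there with
    its first derivative and is supported away from all the other bounces of [x], [y]
    and [z] ([bump_field_away], [bump_field_center]).  The orbits of the three points
    do not change, nor do the multipliers of [x] and [y] ([touch_orbit],
    [osculate_saddle]).  The only change in the Jacobi equation of [z] is in the
    diagonal coefficients at the finitely many passages through the chosen point, all
    with the same sign.

    If the bent table still had a doubly contracted vector, its Jacobi field could be
    scaled to agree with the old one in the past, where nothing has changed, and it
    would be parallel to it in the future, where again nothing has changed.  But the
    Wronskian of the two fields grows from 0 to [e] times a sum over these passages
    which, for small [e], is close to a weighted sum of squares of displacements, and
    so positive ([wronskian_neq0], [bending_breaks_tangency]).

    Two foundations are laid first.  A strongly convex curve is described by the angle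
    of its tangent, which turns once ([turning_number_one], [strongly_convexP]); this
    makes the billiard map explicit and shows that small perturbations are strongly
    convex ([convex_curve_stable]).  The invariant curves are constructed by Poincare's
    method, as solutions of [f (phi u) = phi (lam * u)] ([stable_curve_local]), and a
    cone argument shows that they contain every asymptotic orbit
    ([unstable_cone_expansion]). *)

(** * Calculus of functions of one real variable *)

Section OneVariable.
Context {R : realType}.
Implicit Types (f g h df : R -> R) (a b c t u v x T : R).

Lemma is_derive_cont f t d : is_derive t 1 f d -> {for t, continuous f}.
Proof. by move=> [/derivable1_diffP/differentiable_continuous]. Qed.

Lemma derivable_is f t : derivable f t 1 -> is_derive t 1 f (derive1 f t).
Proof. by move=> df; rewrite derive1E; exact: derivableP. Qed.

Lemma isD_eq f t d d' : is_derive t 1 f d -> d = d' -> is_derive t 1 f d'.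
Proof. by move=> h <-. Qed.

Lemma isD_add f g t d e : is_derive t 1 f d -> is_derive t 1 g e ->
  is_derive t 1 (fun u => f u + g u) (d + e).
Proof. by move=> hf hg; exact: is_deriveD. Qed.

Lemma isD_sub f g t d e : is_derive t 1 f d -> is_derive t 1 g e ->
  is_derive t 1 (fun u => f u - g u) (d - e).
Proof. by move=> hf hg; exact: is_deriveB. Qed.

Lemma isD_mul f g t d e : is_derive t 1 f d -> is_derive t 1 g e ->
  is_derive t 1 (fun u => f u * g u) (d * g t + f t * e).
Proof.
move=> hf hg; apply: isD_eq (is_deriveM hf hg) _.
by rewrite /GRing.scale /= addrC [g t * _]mulrC.
Qed.

Lemma isD_comp f g t d e : is_derive (g t) 1 f d -> is_derive t 1 g e ->
  is_derive t 1 (fun u => f (g u)) (d * e).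
Proof. by move=> hf hg; exact: is_derive1_comp. Qed.

Lemma isD_cst c t : is_derive t 1 (fun=> c) 0.
Proof. exact: is_derive_cst. Qed.

Lemma isD_id t : is_derive t 1 (fun u : R => u) 1.
Proof. exact: is_derive_id. Qed.

Lemma isD_shift c t : is_derive t 1 (fun u : R => u + c) 1.
Proof. by apply: isD_eq (isD_add (isD_id t) (isD_cst c t)) _; rewrite addr0. Qed.

Lemma isD_comp_shift f c t d : is_derive (t + c) 1 f d ->
  is_derive t 1 (fun u => f (u + c)) d.
Proof.
by move=> df; apply: isD_eq (isD_comp (g := fun u => u + c) df (isD_shift c t)) _;
  rewrite mulr1.
Qed.

Lemma IVT_le f a b v : continuous f -> a <= b -> f a <= v <= f b ->
  exists2 c, a <= c <= b & f c = v.
Proof.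
move=> cf ab /andP[fav vfb].
have [||c] := @IVT R f a b v ab; first exact: continuous_subspaceT.
  have fab : f a <= f b by exact: le_trans fav vfb.
  by rewrite min_l // max_r // fav.
by rewrite in_itv /= => cab <-; exists c.
Qed.

Lemma IVT_ge f a b v : continuous f -> a <= b -> f b <= v <= f a ->
  exists2 c, a <= c <= b & f c = v.
Proof.
move=> cf ab /andP[fav vfb].
have [||c cab /oppr_inj fc] := @IVT_le (fun x => - f x) a b (- v) _ ab.
- by move=> x; apply: continuousN; exact: cf.
- by rewrite !lerN2 vfb.
by exists c.
Qed.

Lemma mean_value f df a b : a < b -> (forall x, is_derive x 1 f (df x)) ->
  exists2 c, a < c < b & f b - f a = df c * (b - a).
Proof.
move=> ab dfE; have [|c] := @MVT R f df a b ab (fun x _ => dfE x).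
  by apply: continuous_subspaceT => x; apply: is_derive_cont (dfE x).
by rewrite in_itv /= => cab E; exists c.
Qed.

Lemma increasing_on f df a b : (forall x, is_derive x 1 f (df x)) ->
  (forall x, a < x < b -> 0 < df x) ->
  forall x y, a <= x -> x < y -> y <= b -> f x < f y.
Proof.
move=> dfE dfp x y ax xy yb; have [c /andP[xc cy] E] := mean_value xy dfE.
rewrite -subr_gt0 E mulr_gt0 ?subr_gt0 //; apply: dfp.
by rewrite (le_lt_trans ax xc) (lt_le_trans cy yb).
Qed.

Lemma decreasing_on f df a b : (forall x, is_derive x 1 f (df x)) ->
  (forall x, a < x < b -> df x < 0) ->
  forall x y, a <= x -> x < y -> y <= b -> f y < f x.
Proof.
move=> dfE dfp x y ax xy yb; have [c /andP[xc cy] E] := mean_value xy dfE.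
rewrite -subr_lt0 E nmulr_rlt0 ?subr_gt0 //; apply: dfp.
by rewrite (le_lt_trans ax xc) (lt_le_trans cy yb).
Qed.

Lemma increasing_of_derive f df : (forall x, is_derive x 1 f (df x)) ->
  (forall x, 0 < df x) -> {homo f : x y / x < y}.
Proof.
by move=> dfE dfp x y xy; apply: (increasing_on dfE (a := x) (b := y)).
Qed.

Lemma derive_zero_const f : (forall x, is_derive x 1 f 0) -> forall x y, f x = f y.
Proof.
move=> df; have key x y : x < y -> f x = f y.
  by move=> xy; have [c _] := mean_value xy df; rewrite mul0r => /subr0_eq.
by move=> x y; case: (ltgtP x y) => [/key|/key|->].
Qed.

Lemma period_representative (T a : R) (T0 : 0 < T) t :
  exists j : int, a <= t + T * j%:~R < a + T.
Proof.
exists (- Num.floor ((t - a) / T)); rewrite rmorphN /=.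
have : (Num.floor ((t - a) / T))%:~R <= (t - a) / T by exact: Num.Theory.floor_le_tmp.
have : (t - a) / T < (Num.floor ((t - a) / T) + 1)%:~R.
  exact: Num.Theory.floorD1_gt.
rewrite intrD lter_pdivlMr // lter_pdivrMr // => h1 h2.
by apply/andP; split; lra.
Qed.

Lemma periodicz {V : zmodType} (f : R -> V) T : periodic f T ->
  forall (j : int) t, f (t + T * j%:~R) = f t.
Proof.
move=> pf; have nat_case (n : nat) t : f (t + T * n%:R) = f t.
  elim: n => [|n IH]; first by rewrite mulr0 addr0.
  by rewrite -natr1 mulrDr mulr1 addrA pf.
case=> n t; first exact: nat_case.
by rewrite -(nat_case n.+1) NegzE rmorphN /= mulrN subrK.
Qed.

(** The period lets the extreme value theorem on one period bound the whole
    function. *)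
Lemma periodic_bounded f T : 0 < T -> periodic f T -> continuous f ->
  exists2 M : R, 0 < M & forall t, `|f t| <= M.
Proof.
move=> T0 pf cf.
have [c _ cM] : exists2 c : R, c \in `[0, T]%R & forall t, t \in `[0, T]%R -> `|f t| <= `|f c|.
  apply: (@EVT_max R (fun t => `|f t|)); first exact: ltW.
  apply: continuous_subspaceT => x.
  by apply: continuous_comp; [exact: cf | exact: norm_continuous].
exists (`|f c| + 1); first by rewrite ltr_wpDl.
move=> t; have [j /andP[h1]] := period_representative 0 T0 t; rewrite add0r => h2.
rewrite -(periodicz pf j); apply: le_trans (_ : `|f c| <= _); last by rewrite lerDl.
by apply: cM; rewrite in_itv /= h1 ltW.
Qed.

Lemma periodic_lower f T : 0 < T -> periodic f T -> continuous f ->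
  (forall t, 0 < f t) -> exists2 m : R, 0 < m & forall t, m <= f t.
Proof.
move=> T0 pf cf f0.
have [c _ cM] : exists2 c : R, c \in `[0, T]%R & forall t, t \in `[0, T]%R -> f c <= f t.
  by apply: (@EVT_min R f); [exact: ltW | exact: continuous_subspaceT].
exists (f c) => // t; have [j /andP[h1]] := period_representative 0 T0 t; rewrite add0r => h2.
by rewrite -(periodicz pf j t); apply: cM; rewrite in_itv /= h1 ltW.
Qed.

Lemma derive1_periodic {V : normedModType R} (f : R -> V) T :
  periodic f T -> periodic (derive1 f) T.
Proof.
move=> pf t; rewrite /derive1 pf.
by under eq_fun do rewrite addrA pf.
Qed.

End OneVariable.

(** ** Smooth functions *)

Section Smooth.
Context {R : realType}.
Implicit Types (f g h : R -> R) (n : nat) (t : R).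

(** Smoothness is proved through finite orders of differentiability, for which
    the rules of calculus allow inductions on the order. *)
Fixpoint Cn n f : Prop :=
  if n is m.+1 then (forall t, derivable f t 1) /\ Cn m (derive1 f) else True.

Lemma CnW n f : Cn n.+1 f -> Cn n f.
Proof. by elim: n f => //= n IH f [df /IH]. Qed.

Lemma smoothE f : smooth f <-> forall n, Cn n f.
Proof.
split=> [sf n|cf n t].
  suff: forall m f, (forall k t, (k < m)%N -> derivable (derive1n k f) t 1) -> Cn m f.
    by apply=> k t _; exact: sf.
  elim=> // m IH g dg; split; first by move=> t; exact: (dg 0%N).
  by apply: IH => k t km; rewrite -derive1Sn; exact: dg.
elim: n f cf t => [|n IH] f cf t; first by case: (cf 1%N).
by rewrite derive1Sn; apply: IH => k; case: (cf k.+1).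
Qed.

Lemma eq_Cn n f g : f = g -> Cn n f -> Cn n g. Proof. by move=> ->. Qed.

Lemma derive1_is f df : (forall t, is_derive t 1 f (df t)) -> derive1 f = df.
Proof. by move=> dfE; apply/funext => t; rewrite derive1E (@derive_val _ _ _ _ _ _ _ (dfE t)). Qed.

Lemma Cn_is n f df : (forall t, is_derive t 1 f (df t)) -> Cn n df -> Cn n.+1 f.
Proof.
by move=> dfE cdf; split; [move=> t; exact: (@ex_derive _ _ _ _ _ _ _ (dfE t)) | rewrite (derive1_is dfE)].
Qed.

Lemma Cn_derive n f t : Cn n.+1 f -> is_derive t 1 f (derive1 f t).
Proof. by case=> df _; exact: derivable_is. Qed.

Lemma Cn_cst n (c : R) : Cn n (fun=> c).
Proof.
elim: n c => // n IH c; apply: (@Cn_is n _ (fun=> 0)); exact: IH.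
Qed.

Lemma Cn_id n : Cn n (fun t : R => t).
Proof.
case: n => // n; apply: (@Cn_is n _ (fun=> 1)); exact: Cn_cst.
Qed.

Lemma CnD n f g : Cn n f -> Cn n g -> Cn n (fun t => f t + g t).
Proof.
elim: n f g => // n IH f g cf cg.
have dE t := isD_add (Cn_derive t cf) (Cn_derive t cg).
apply: (Cn_is dE); by apply: IH; [case: cf | case: cg].
Qed.

Lemma CnM n f g : Cn n f -> Cn n g -> Cn n (fun t => f t * g t).
Proof.
elim: n f g => // n IH f g cf cg.
have dE t := isD_mul (Cn_derive t cf) (Cn_derive t cg).
have [_ cf'] := cf; have [_ cg'] := cg.
by apply: (Cn_is dE); apply: CnD; apply: IH => //; exact: CnW.
Qed.

Lemma CnN n f : Cn n f -> Cn n (fun t => - f t).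
Proof.
move=> cf; apply: (@eq_Cn _ (fun t => (-1) * f t)); last exact: CnM (Cn_cst _ _) cf.
by apply/funext => t; rewrite mulN1r.
Qed.

Lemma CnB n f g : Cn n f -> Cn n g -> Cn n (fun t => f t - g t).
Proof. by move=> cf cg; apply: CnD => //; exact: CnN. Qed.

Lemma CnV n f : (forall t, f t != 0) -> Cn n f -> Cn n (fun t => (f t)^-1).
Proof.
move=> f0; elim: n => // n IH cf; have cV := IH (CnW cf); have [_ cf'] := cf.
have dE t : is_derive t 1 (fun u => (f u)^-1)
    (- derive1 f t * ((f t)^-1 * (f t)^-1)).
  apply: isD_eq (is_deriveV (f0 t) (Cn_derive t cf)) _.
  by rewrite /GRing.scale /= -exprVn expr2; ring.
by apply: (Cn_is dE); apply: CnM; [exact: CnN | exact: CnM].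
Qed.

Lemma Cn_sqrt n f : (forall t, 0 < f t) -> Cn n f -> Cn n (fun t => Num.sqrt (f t)).
Proof.
move=> f0; elim: n => // n IH cf; have cS := IH (CnW cf); have [_ cf'] := cf.
have dE t := isD_comp (is_derive1_sqrt (f0 t)) (Cn_derive t cf).
apply: (Cn_is dE); apply: CnM => //; apply: CnV; last by apply: CnM => //; exact: Cn_cst.
by move=> t; rewrite mulf_neq0 // gt_eqF // sqrtr_gt0.
Qed.

Lemma Cn_comp n h f : (forall m, Cn m h) -> Cn n f -> Cn n (fun t => h (f t)).
Proof.
elim: n h => // n IH h ch cf; have [_ cf'] := cf.
have dE t := isD_comp (Cn_derive (f t) (ch 1%N)) (Cn_derive t cf).
by apply: (Cn_is dE); apply: CnM => //; apply: IH; [move=> m; case: (ch m.+1) | exact: CnW].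
Qed.

Lemma Cn_sin_cos n : Cn n (@sin R) /\ Cn n (@cos R).
Proof.
elim: n => // n [IHs IHc]; split.
  exact: (Cn_is (@is_derive_sin R)).
by apply: (Cn_is (@is_derive_cos R)); exact: CnN.
Qed.

End Smooth.

(** A quadratic remainder is the form in which derivatives are produced here:
    by explicit estimates and not by limits. *)
Lemma is_derive_quadratic {R : realType} {V : normedModType R} (f : R -> V) (t : R)
    (d : V) (r C : R) : 0 < r ->
  (forall h, `|h| < r -> `|f (t + h) - f t - h *: d| <= C * h ^+ 2) ->
  is_derive t 1 f d.
Proof.
move=> r0 fq; suff cd : h^-1 *: ((f \o shift t) (h *: 1) - f t) @[h --> 0^'] --> d.
  by split; [apply/cvg_ex; exists d | exact: cvg_lim].
have C0 : 0 < `|C| + 1 by rewrite ltr_wpDl.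
apply/cvgrPdist_le => e e0; near=> h.
have h0 : h != 0 by near: h; exact: nbhs_dnbhs_neq.
have hr : `|h| < r by near: h; apply: dnbhs0_lt.
have he : `|h| <= e / (`|C| + 1).
  by near: h; apply: dnbhs0_le; rewrite divr_gt0.
rewrite /= -normrN opprB -[X in _ - X](scalerK h0) -scalerBr normrZ.
rewrite /GRing.scale /= mulr1 [h + t]addrC normfV.
rewrite ler_pdivrMl ?normr_gt0 //; apply: le_trans (fq h hr) _.
rewrite -real_normK ?num_real // expr2 [`|h| * e]mulrC mulrA ler_wpM2r //.
apply: le_trans (_ : (`|C| + 1) * `|h| <= _); last by rewrite mulrC -ler_pdivlMr.
by rewrite ler_wpM2r // (le_trans (ler_norm C)) // lerDl.
Unshelve. all: by end_near. Qed.

(** ** A flat function and a bump *)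

Section Flat.
Context {R : realType}.
Implicit Types (p : {poly R}) (c d t x y : R).

(** The derivatives of exp (- 1 / y) all have this form, which makes the family
    stable under differentiation, at 0 included. *)
Definition flat p y : R := if 0 < y then p.[y^-1] * expR (- y^-1) else 0.

Lemma poly_le_expR p : exists C, forall x, 0 <= x -> `|p.[x]| <= C * expR x.
Proof.
exists (\sum_(i < size p) `|p`_i| * i`!%:R) => x x0.
rewrite horner_coef mulr_suml (le_trans (ler_norm_sum _ _ _)) //.
apply: ler_sum => i _; rewrite normrM normrX (ger0_norm x0) -mulrA ler_wpM2l //.
case: (nat_of_ord i) => [|k]; first by rewrite expr0 fact0 mul1r -expR0 ler_expR.
rewrite -ler_pdivrMl ?ltr0n ?fact_gt0 // mulrC.
by rewrite (le_trans _ (expR_ge1Dxn k x0)) // lerDr.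
Qed.

Lemma flat_le p : exists C, forall y, `|flat p y| <= C * y ^+ 2.
Proof.
have [C pC] := poly_le_expR (p * 'X^2); exists C => y; rewrite /flat.
have C0 : 0 <= C by have := pC 0 (lexx 0); rewrite expR0 mulr1; apply: le_trans.
case: ifP => [y0|_]; last by rewrite normr0 mulr_ge0 // sqr_ge0.
have yV : 0 <= y^-1 by rewrite invr_ge0 ltW.
have := pC _ yV; rewrite hornerM hornerXn normrM (ger0_norm (exprn_ge0 2 yV)).
rewrite -ler_pdivlMr ?exprn_gt0 ?invr_gt0 // exprVn invrK => h.
rewrite normrM [`|expR _|]ger0_norm ?expR_ge0 // expRN ler_pdivrMr ?expR_gt0 //.
by rewrite (le_trans h) // mulrAC.
Qed.

Lemma is_derive_flat p y : is_derive y 1 (flat p) (flat ('X^2 * (p - p^`())%R) y).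
Proof.
have [y0|y0|->] := ltgtP y 0.
- apply: near_eq_is_derive (_ : is_derive y 1 (cst 0) _); last first.
    by rewrite /flat ltNge ltW //=; exact: is_derive_cst.
  by near=> z; rewrite /flat ltNge ltW //=; near: z; exact: lt_nbhsl.
- have y1 : y != 0 by rewrite gt_eqF.
  apply: (@near_eq_is_derive _ _ _ (fun z : R => p.[z^-1] * expR (- z^-1)) _ y 1).
    by near=> z; rewrite /flat ifT //; near: z; exact: lt_nbhsr.
  rewrite /flat y0.
  have dV : is_derive y 1 (fun z : R => z^-1) (- y ^- 2).
    by apply: is_derive_eq (is_deriveV y1 (is_derive_id y 1)) _; rewrite /GRing.scale /= mulr1.
  have dp := isD_comp (is_derive_poly p y^-1) dV.
  have de : is_derive y 1 (fun z : R => expR (- z^-1)) (expR (- y^-1) * (- - y ^- 2)).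
    exact: (isD_comp (g := fun z => - z^-1) (is_derive_expR (- y^-1)) (is_deriveN dV)).
  apply: isD_eq (isD_mul dp de) _.
  by rewrite hornerM hornerXn hornerD hornerN exprVn; ring.
- rewrite [X in is_derive _ _ _ X](_ : _ = 0); last by rewrite /flat ltxx.
  have [C fC] := flat_le p; apply: (@is_derive_quadratic _ _ _ _ _ 1 C) => // h _.
  by rewrite {2}/flat ltxx subr0 scaler0 subr0 add0r.
Unshelve. all: by end_near. Qed.

Lemma Cn_flat n p : Cn n (flat p).
Proof.
elim: n p => // n IH p; apply: (Cn_is (is_derive_flat p)); exact: IH.
Qed.

Lemma flat1_gt0 y : (0 < flat 1 y) = (0 < y).
Proof.
by rewrite /flat; case: ifP => [_|]; rewrite ?hornerE ?expR_gt0 // ltxx.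
Qed.

Lemma flat1_le0 y : y <= 0 -> flat 1 y = 0.
Proof. by move=> y0; rewrite /flat ltNge y0. Qed.

(** Composition with the cosine makes the bump periodic; the factor
    [1 - cos (t - c)] gives it a nondegenerate zero at its centre, so that adding
    it to a curve bends the curve there and moves neither the point nor the
    tangent. *)
Definition bump (c d t : R) : R :=
  flat 1 (cos (t - c) - cos d) * (1 - cos (t - c)).

Lemma smooth_bump c d : smooth (bump c d).
Proof.
apply/smoothE => n; have cc : Cn n (fun t : R => cos (t - c)).
  apply: Cn_comp; first by move=> m; case: (@Cn_sin_cos R m).
  by apply: CnB; [exact: Cn_id | exact: Cn_cst].
apply: CnM; last by apply: CnB => //; exact: Cn_cst.
by apply: Cn_comp; [move=> m; exact: Cn_flat | apply: CnB => //; exact: Cn_cst].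
Qed.

Lemma periodic_bump c d : periodic (bump c d) (2 * pi).
Proof.
by move=> t; rewrite /bump [t + _ - c]addrAC mulr_natl cosD2pi.
Qed.

Lemma bump_eq0 c d t : cos (t - c) <= cos d -> bump c d t = 0.
Proof. by move=> h; rewrite /bump flat1_le0 ?mul0r // subr_le0. Qed.

Lemma is_derive_cosB c t : is_derive t 1 (fun u : R => cos (u - c)) (- sin (t - c)).
Proof.
exact: isD_comp_shift (is_derive_cos (t - c)).
Qed.

Lemma bump_center c d : 0 < d < pi ->
  [/\ bump c d c = 0, derive1 (bump c d) c = 0 & 0 < derive1 (derive1 (bump c d)) c].
Proof.
move=> /andP[d0 dpi]; pose f t := flat 1 (cos (t - c) - cos d).
pose g t : R := 1 - cos (t - c).
have cf n : Cn n f.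
  apply: Cn_comp; first by move=> m; exact: Cn_flat.
  apply: CnB; last exact: Cn_cst.
  apply: Cn_comp; first by move=> m; case: (@Cn_sin_cos R m).
  by apply: CnB; [exact: Cn_id | exact: Cn_cst].
have dg t : is_derive t 1 g (sin (t - c)).
  apply: isD_eq (isD_sub (isD_cst 1 t) (is_derive_cosB c t)) _.
  by rewrite sub0r opprK.
have dg' : is_derive c 1 (fun t : R => sin (t - c)) 1.
  by apply: isD_eq (isD_comp_shift (is_derive_sin (c - c))) _; rewrite subrr cos0.
have d1 : derive1 (bump c d) = fun t => derive1 f t * g t + f t * sin (t - c).
  by apply: derive1_is => t; exact: (isD_mul (Cn_derive t (cf 1%N)) (dg t)).
have gc : g c = 0 by rewrite /g subrr cos0 subrr.
split; first by rewrite /bump -/(g c) gc mulr0.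
  by rewrite d1 /= gc subrr sin0 !mulr0 addr0.
have cf' : Cn 1 (derive1 f) by case: (cf 2%N).
have d2 := isD_add (isD_mul (Cn_derive c cf') (dg c))
  (isD_mul (Cn_derive c (cf 1%N)) dg').
rewrite d1 derive1E (@derive_val _ _ _ _ _ _ _ d2) gc subrr sin0 !mulr0 !addr0 !add0r mulr1.
by rewrite /f subrr cos0 flat1_gt0 subr_gt0 -cos0 ltr_cos // !in_itv /= ?lexx ?pi_ge0 ?ltW.
Qed.

End Flat.

(** * Turning number of a simple locally convex curve *)

Section Crossing.
Context {R : realType}.
Implicit Types (f g e y : R -> R) (a b c t u v x z : R).

Lemma pi0 : 0 < pi :> R. Proof. exact: pi_gt0. Qed.

Lemma antiderivative_right f a : continuous f ->
  exists F : R -> R, forall x, a < x -> is_derive x 1 F (f x).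
Proof.
move=> cf; exists (fun x => \int[lebesgue_measure]_(t in `[a, x]) f t) => x ax.
have xu : x < x + 1 by rewrite ltrDl.
have [|d1 d2] := @continuous_FTC1_closed R f a x (x + 1) xu _ ax (cf x).
  apply: continuous_compact_integrable; first exact: segment_compact.
  exact: continuous_subspaceT.
by split; [exact: d1 | rewrite -derive1E; exact: d2].
Qed.

Lemma antiderivative f : continuous f -> exists F : R -> R, forall x, is_derive x 1 F (f x).
Proof.
move=> cf; have Fn (n : nat) : exists F : R -> R,
    F 0 = 0 /\ forall x, - n.+1%:R < x -> is_derive x 1 F (f x).
  have [F dF] := antiderivative_right (- n.+1%:R) cf.
  exists (fun x => F x - F 0); split=> [|x /dF dx]; first by rewrite subrr.
  by apply: isD_eq (isD_sub dx (isD_cst (F 0) x)) _; rewrite subr0.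
have [F FP] := choice Fn.
have agree n m x : - n.+1%:R < x -> - m.+1%:R < x -> F n x = F m x.
  move=> nx mx; have [F0 dF] := FP n; have [G0 dG] := FP m.
  pose D t := F n t - F m t.
  have dD t : Num.min 0 x <= t -> is_derive t 1 D 0.
    move=> xt; have big k : - k.+1%:R < x -> - k.+1%:R < t.
      by move=> kx; apply: lt_le_trans xt; rewrite lt_min kx oppr_lt0 ltr0n.
    by apply: isD_eq (isD_sub (dF t (big _ nx)) (dG t (big _ mx))) _; rewrite subrr.
  have flat_seg a b : Num.min 0 x <= a -> a < b -> D a = D b.
    move=> xa ab; have [||c _] := @MVT R D (fun=> 0) a b ab.
    - by move=> c; rewrite in_itv /= => /andP[ac _]; apply: dD; rewrite (le_trans xa) ?ltW.
    - apply: derivable_within_continuous => c; rewrite in_itv /= => /andP[ac _].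
      by have [] := dD c (le_trans xa ac).
    by rewrite mul0r => /subr0_eq.
  suff : D x = D 0 by rewrite /D F0 G0 subrr => /subr0_eq.
  case: (ltgtP x 0) => [x0|x0|->] //; first by rewrite (flat_seg x 0) // ge_min lexx orbT.
  by rewrite -(flat_seg 0 x) // ge_min lexx.
pose N x := Num.truncn `|x|; have NP x : - (N x).+1%:R < x.
  by rewrite ltrNl (le_lt_trans (ler_norm _)) // normrN /N truncnS_gt.
exists (fun x => F (N x) x) => x; have [_ dF] := FP (N x).
apply: near_eq_is_derive (dF x (NP x)); near=> t; apply: agree; last exact: NP.
by near: t; apply: lt_nbhsr; exact: NP.
Unshelve. all: by end_near. Qed.

Lemma cont_gt f z c : {for z, continuous f} -> c < f z ->
  exists2 r : R, 0 < r & forall t, `|t - z| < r -> c < f t.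
Proof.
move=> cf cfz; have /nbhs_ballP[r /= r0 hr] := cf _ (lt_nbhsr cfz).
by exists r => // t tz; apply: hr; rewrite /ball /= distrC.
Qed.

Lemma cont_lt f z c : {for z, continuous f} -> f z < c ->
  exists2 r : R, 0 < r & forall t, `|t - z| < r -> f t < c.
Proof.
move=> cf cfz; have /nbhs_ballP[r /= r0 hr] := cf _ (lt_nbhsl cfz).
by exists r => // t tz; apply: hr; rewrite /ball /= distrC.
Qed.

Lemma derive_lt0_local f z d : is_derive z 1 f d -> d < 0 ->
  exists2 r : R, 0 < r & forall t, `|t - z| < r ->
    (z < t -> f t < f z) /\ (t < z -> f z < f t).
Proof.
move=> /is_derive1_caratheodory[h [hE ch hz]] d0.
have [|r r0 hr] := cont_lt (c := 0) ch; first by rewrite hz.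
exists r => // t tz; have ht := hr t tz.
split=> zt; first by rewrite -subr_lt0 hE nmulr_rlt0 // subr_gt0.
by rewrite -subr_gt0 hE nmulr_rgt0 // subr_lt0.
Qed.

(** At the last zero before [b] the derivative is nonnegative, since [f] is positive
    just after it. *)
Lemma upcrossing f e a b : (forall t, is_derive t 1 f (e t)) -> a < b ->
  f a < 0 -> 0 < f b -> exists2 z : R, f z = 0 & 0 <= e z.
Proof.
move=> fe ab fa fb; have cf : continuous f by move=> t; exact: is_derive_cont (fe t).
pose S := [set t | a <= t <= b /\ f t <= 0]; pose z := sup S.
have Sa : S a by split; rewrite ?lexx ?ltW.
have hS : has_sup S by split; [exists a | exists b => t [/andP[]]].
have az : a <= z by exact: sup_ubound hS.2 _ Sa.
have zb : z <= b by apply: ge_sup; [exists a | move=> t [/andP[]]].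
have after t : z < t -> t <= b -> 0 < f t.
  move=> zt tb; rewrite ltNge; apply/negP => ft.
  have : t <= z by apply: (sup_ubound hS.2); split=> //; rewrite tb (le_trans az) // ltW.
  by rewrite leNgt zt.
have step r : 0 < r -> z < b -> exists t, [/\ z < t, t <= b & `|t - z| < r].
  move=> r0 zb'; exists (Num.min b (z + r / 2)).
  have zt : z < Num.min b (z + r / 2) by rewrite lt_min zb' ltrDl divr_gt0.
  split=> //; first by rewrite ge_min lexx.
  rewrite gtr0_norm ?subr_gt0 // ltrBlDl.
  have h : Num.min b (z + r / 2) <= z + r / 2 by rewrite ge_min lexx orbT.
  by lra.
have fz : f z = 0.
  apply/eqP; rewrite eq_le; apply/andP; split; rewrite leNgt; apply/negP => fz.
    have [r r0 hr] := cont_gt (cf z) fz.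
    have [t St tz] := sup_adherent r0 hS.
    have tz' : t <= z by exact: (sup_ubound hS.2).
    case: St => _; rewrite leNgt => /negP; apply; apply: hr.
    by rewrite distrC ger0_norm ?subr_ge0 // ltrBlDl -ltrBlDr.
  have zb' : z < b by rewrite lt_neqAle zb andbT; apply: contraTneq fz => ->; rewrite -leNgt ltW.
  have [r r0 hr] := cont_lt (cf z) fz.
  have [t [zt tb tr]] := step r r0 zb'.
  by have := after t zt tb; rewrite ltNge ltW // hr.
exists z => //; rewrite leNgt; apply/negP => ez.
have zb' : z < b by rewrite lt_neqAle zb andbT; apply: contraTneq fb => <-; rewrite fz ltxx.
have [r r0 hr] := derive_lt0_local (fe z) ez.
have [t [zt tb tr]] := step r r0 zb'.
by have [/(_ zt) + _] := hr t tr; rewrite fz ltNge ltW // after.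
Qed.

Lemma inverse_continuous f g : {homo f : x y / x < y} -> (forall v, f (g v) = v) ->
  continuous g.
Proof.
move=> fm fK v; apply/cvgrPdist_lt => r r0.
have mono := leW_mono (le_mono fm).
have lo : f (g v - r) < v by rewrite -[ltRHS]fK mono ltrBlDr ltrDl.
have hi : v < f (g v + r) by rewrite -[ltLHS]fK mono ltrDl.
near=> w; rewrite ltr_distl; apply/andP; split.
  by rewrite ltrBlDr -mono fK; near: w; exact: lt_nbhsl.
by rewrite -ltrBlDr -mono fK; near: w; exact: lt_nbhsr.
Unshelve. all: by end_near. Qed.

(** Outside the interval the function is continued by lines of slope 1, so that
    the inverse is continuous on the whole line. *)
Lemma segment_inverse y a b : a < b -> continuous y ->
  (forall s t, a <= s -> s < t -> t <= b -> y s < y t) ->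
  exists2 g : R -> R, continuous g & forall v, y a <= v <= y b -> a <= g v <= b /\ y (g v) = v.
Proof.
move=> ab cy my.
pose f t := if t < a then y a + (t - a) else if t <= b then y t else y b + (t - b).
have fm : {homo f : s t / s < t}.
  move=> s t st; rewrite /f; case: (ltP s a) => sa; case: (ltP t a) => ta.
  - by rewrite ltrD2l ltrD2r.
  - case: (leP t b) => tb.
      apply: lt_le_trans (_ : y a <= _); first by rewrite gtrDl subr_lt0.
      by move: ta; rewrite le_eqVlt => /predU1P[->//|ta]; rewrite ltW // my.
    by have := my a b (lexx a) ab (lexx b); lra.
  - by move: (le_lt_trans sa st); rewrite ltNge ltW.
  - case: (leP s b) => sb; case: (leP t b) => tb.
    + exact: my.
    + apply: le_lt_trans (_ : y b < _); last by rewrite ltrDl subr_gt0.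
      by move: sb; rewrite le_eqVlt => /predU1P[->//|sb]; rewrite ltW // my.
    + by lra.
    + by lra.
have fs v : exists t, f t = v.
  case: (ltP v (y a)) => va; first by exists (a + (v - y a)); rewrite /f ifT; lra.
  case: (leP v (y b)) => vb.
    have [|t /andP[t1 t2] <-] := IVT_le cy (ltW ab) (v := v); first by rewrite va vb.
    by exists t; rewrite /f ltNge t1 /= t2.
  exists (b + (v - y b)); rewrite /f ifF; last by apply/negbTE; rewrite -leNgt; lra.
  by rewrite ifF; [lra | apply/negbTE; rewrite -ltNge; lra].
have [g gP] := choice fs; exists g; first exact: (inverse_continuous fm gP).
move=> v /andP[va vb]; have mono := le_mono fm.
have fa : f a = y a by rewrite /f ltxx ltW.
have fb : f b = y b by rewrite /f lexx ltNge ltW.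
have h : a <= g v <= b by rewrite -[a <= _]mono -[_ <= b]mono fa fb gP va.
split=> //; move: h => /andP[h1 h2].
by rewrite -[RHS]gP /f ltNge h1 /= h2.
Qed.

End Crossing.

Section Turning.
Context {R : realType}.
Implicit Types (a b c t u v : R).

Lemma sin_lt0_pi a : pi < a < 2 * pi -> sin a < 0.
Proof.
move=> h; have -> : a = (a - pi) + pi by lra.
by rewrite sinDpi oppr_lt0; apply: sin_gt0_pi; lra.
Qed.

Lemma cos_lt0_left a : pi / 2 < a < pi + pi / 2 -> cos a < 0.
Proof.
move=> h; have -> : a = (a - pi / 2) + pi / 2 by lra.
by rewrite cosDpihalf oppr_lt0; apply: sin_gt0_pi; lra.
Qed.

Lemma sinD2pi' a : sin (a + 2 * pi) = sin a.
Proof. by rewrite mulr_natl sinD2pi. Qed.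

Lemma cosD2pi' a : cos (a + 2 * pi) = cos a.
Proof. by rewrite mulr_natl cosD2pi. Qed.

Lemma cos_1_sin_0 a : cos a = 1 -> sin a = 0 -> exists j : int, a = 2 * pi * j%:~R.
Proof.
move=> c1 s0; have P0 : 0 < 2 * pi :> R by rewrite mulr_gt0 ?pi_gt0.
have [j /andP[h1 h2]] := period_representative 0 P0 a; rewrite add0r in h2.
set r := a + _ in h1 h2; suff r0 : r = 0.
  by exists (- j); move: r0; rewrite /r rmorphN /= => r0; lra.
have cr : cos r = 1 by rewrite (periodicz cosD2pi').
have sr : sin r = 0 by rewrite (periodicz sinD2pi').
have [rp|rp|rp] := ltgtP r pi; last by move: cr; rewrite rp cospi; lra.
  move: h1; rewrite le_eqVlt => /predU1P[->//|r0].
  by have := @sin_gt0_pi _ r; rewrite r0 rp sr ltxx => /(_ isT).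
by have := @sin_lt0_pi r; rewrite rp h2 sr ltxx => /(_ isT).
Qed.

Lemma angle_of_unit u v : u ^+ 2 + v ^+ 2 = 1 -> exists a, u = cos a /\ v = sin a.
Proof.
move=> uv; have uI : -1 <= u <= 1.
  by rewrite -ler_norml -(@expr_le1 _ 2) // real_normK ?num_real // -uv lerDl sqr_ge0.
have ca : cos (acos u) = u by apply: acosK; rewrite in_itv.
have sa : sin (acos u) ^+ 2 = v ^+ 2 by rewrite sin2cos2 ca -uv addrC addKr.
move/eqP: sa; rewrite eqf_sqr => /orP[/eqP sa|/eqP sa]; [exists (acos u)|exists (- acos u)].
  by rewrite ca sa.
by rewrite cosN ca sinN sa opprK.
Qed.

(** Here the curve is parametrized by the angle of its tangent and has turned by
    exactly [2 * pi] when it is back on its first tangent line, ahead of its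
    starting point.  At equal heights the ascending branch is to the right of the
    descending one near the top and not at the bottom, so the branches meet. *)
Lemma full_turn_meets (x y r : R -> R) :
    (forall a, is_derive a 1 x (r a * cos a)) ->
    (forall a, is_derive a 1 y (r a * sin a)) ->
    (forall a, 0 < r a) -> y 0 = y (2 * pi) -> x 0 <= x (2 * pi) ->
  exists a b, [/\ 0 <= a, a < b, b <= 2 * pi, x a = x b & y a = y b].
Proof.
move=> dx dy r0 y02 x02; have p0 := @pi0 R.
have cx : continuous x by move=> t; exact: is_derive_cont (dx t).
have cy : continuous y by move=> t; exact: is_derive_cont (dy t).
have yup s t : 0 <= s -> s < t -> t <= pi -> y s < y t.
  by apply: (increasing_on dy) => a h; rewrite mulr_gt0 // sin_gt0_pi.
have ydn s t : pi <= s -> s < t -> t <= 2 * pi -> y t < y s.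
  by apply: (decreasing_on dy) => a h; rewrite pmulr_rlt0 // sin_lt0_pi.
have xdn s t : pi / 2 <= s -> s < t -> t <= pi + pi / 2 -> x t < x s.
  by apply: (decreasing_on dx) => a h; rewrite pmulr_rlt0 // cos_lt0_left.
have [|||g cg gP] := @segment_inverse R (fun t => - y t) pi (2 * pi).
- lra.
- by move=> t; apply: continuousN; exact: cy.
- by move=> s t h1 h2 h3; rewrite ltrN2 ydn.
(* [b a] is the point of the descending branch at the height of [a] *)
pose b a := g (- y a).
have bP a : 0 <= a <= pi -> pi <= b a <= 2 * pi /\ y (b a) = y a.
  move=> /andP[a0 ap]; have [|h /oppr_inj h'] := gP (- y a); last by split.
  rewrite !lerN2; apply/andP; split.
    by move: ap; rewrite le_eqVlt => /predU1P[->//|ap]; rewrite ltW // yup.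
  by rewrite -y02; move: a0; rewrite le_eqVlt => /predU1P[->//|a0]; rewrite ltW // yup.
pose W a := x a - x (b a).
have cW : continuous W.
  move=> t; apply: continuousB; first exact: cx.
  apply: (@continuous_comp _ _ _ b x); last exact: cx.
  apply: (@continuous_comp _ _ _ (fun t => - y t) g); last exact: cg.
  by apply: continuousN; exact: cy.
have b0 : b 0 = 2 * pi.
  have [|/andP[h1 h2] h3] := bP 0; first lra.
  apply/eqP; rewrite eq_le h2 /= leNgt; apply/negP => h4.
  by have := ydn _ _ h1 h4 (lexx _); rewrite h3 y02 ltxx.
have W0 : W 0 <= 0 by rewrite /W b0; lra.
have h1 : y (pi / 2) < y pi by apply: yup; lra.
have h2 : y (pi + pi / 2) < y pi by apply: ydn; lra.
(* a height near the top, where both branches move to the left *)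
have [m [m1 m2 m3]] : exists m, [/\ y (pi / 2) < m, y (pi + pi / 2) < m & m < y pi].
  pose M := Num.max (y (pi / 2)) (y (pi + pi / 2)).
  have M1 : y (pi / 2) <= M by rewrite le_max lexx.
  have M2 : y (pi + pi / 2) <= M by rewrite le_max lexx orbT.
  have M3 : M < y pi by rewrite gt_max h1 h2.
  by exists ((M + y pi) / 2); split; lra.
have [||a1 /andP[a1l a1u] ya1] := @IVT_le R y (pi / 2) pi m cy; [lra | lra |].
have a1pi : a1 < pi by rewrite lt_neqAle a1u andbT; apply: contraTneq m3 => e; rewrite -ya1 e ltxx.
have [|/andP[b1 b2] yb] := bP a1; first lra.
have bpi : pi < b a1 by rewrite lt_neqAle b1 andbT; apply: contraTneq m3 => e; rewrite -ya1 -yb -e ltxx.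
have b3 : b a1 < pi + pi / 2.
  rewrite ltNge; apply/negP; rewrite le_eqVlt => /predU1P[e|h].
    by move: m2; rewrite e yb ya1 ltxx.
  have := ydn (pi + pi / 2) (b a1); rewrite yb ya1 => /(_ _ h b2) h'.
  by have : m < y (pi + pi / 2); [apply: h'; lra | lra].
have W1 : 0 < W a1 by rewrite /W subr_gt0; apply: xdn => //; lra.
have [||a /andP[al au] Wa] := @IVT_le R W 0 a1 0 cW; [lra | lra |].
have [|/andP[c1 c2] yb'] := bP a; first lra.
exists a, (b a); split => //; first lra.
by move/subr0_eq: Wa.
Qed.

(** The support function [h] of the curve satisfies [h' = g], and the vector from
    the point of angle [a] to the one of angle [a + 2 * pi] is the combination of
    the normal and the tangent with coefficients the increments of [h] and [g].
    Over the [k] turns the increments of [h] cancel, so they vanish somewhere with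
    a nonnegative derivative; there [full_turn_meets] applies. *)
Lemma turning_number_one (x y r : R -> R) (k : nat) :
    (forall a, is_derive a 1 x (r a * cos a)) ->
    (forall a, is_derive a 1 y (r a * sin a)) ->
    (forall a, 0 < r a) -> (0 < k)%N ->
    periodic x (2 * pi * k%:R) -> periodic y (2 * pi * k%:R) ->
    (forall a b, x a = x b -> y a = y b -> exists j : int, a = b + 2 * pi * k%:R * j%:~R) ->
  k = 1%N.
Proof.
move=> dx dy r0 k0 px py inj; have p0 := @pi0 R.
apply/eqP; rewrite eqn_leq k0 andbT leqNgt; apply/negP => k2.
have k2R : 2 <= k%:R :> R by rewrite ler_nat.
pose h a := x a * sin a - y a * cos a; pose g a := x a * cos a + y a * sin a.
have dh a : is_derive a 1 h (g a).
  apply: isD_eq (isD_sub (isD_mul (dx a) (is_derive_sin a)) (isD_mul (dy a) (is_derive_cos a))) _.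
  by rewrite /g; ring.
pose d a := h (a + 2 * pi) - h a; pose e a := g (a + 2 * pi) - g a.
have de a : is_derive a 1 d (e a) by apply: isD_sub => //; exact: isD_comp_shift (dh _).
have cd : continuous d by move=> a; exact: is_derive_cont (de a).
set P := 2 * pi * k%:R in px py inj.
have P0 : 0 < P by rewrite /P !mulr_gt0 ?ltr0n.
have pc : periodic (@cos R) P by move=> a; rewrite /P -[k%:R]/((Posz k)%:~R) (periodicz cosD2pi').
have ps : periodic (@sin R) P by move=> a; rewrite /P -[k%:R]/((Posz k)%:~R) (periodicz sinD2pi').
have ph : periodic h P by move=> a; rewrite /h px py pc ps.
have pd : periodic d P by move=> a; rewrite /d [a + P + _]addrAC !ph.
have tele (m : nat) a : \sum_(i < m) d (a + 2 * pi * i%:R) = h (a + 2 * pi * m%:R) - h a.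
  elim: m => [|m IH]; first by rewrite big_ord0 mulr0 addr0 subrr.
  have -> : a + 2 * pi * m.+1%:R = a + 2 * pi * m%:R + 2 * pi by rewrite -natr1; ring.
  by rewrite big_ord_recr /= IH /d; ring.
have sum0 a : \sum_(i < k) d (a + 2 * pi * i%:R) = 0 by rewrite tele -/P ph subrr.
have notpos : ~ forall a, 0 < d a.
  move=> dp; have := sum0 0; apply/eqP; rewrite gt_eqF //.
  rewrite (bigD1 (Ordinal k0)) //= ltr_wpDr // sumr_ge0 // => i _; exact: ltW.
have notneg : ~ forall a, d a < 0.
  move=> dp; have := sum0 0; apply/eqP; rewrite lt_eqF //.
  rewrite (bigD1 (Ordinal k0)) //= ltr_wnDr // sumr_le0 // => i _; exact: ltW.
have zero : exists z, d z = 0.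
  apply: contrapT => nz; have nz' a : d a != 0 by apply/eqP => da; apply: nz; exists a.
  have [[a da]|np] := pselect (exists a, 0 < d a); last first.
    by apply: notneg => a; rewrite lt_neqAle nz' leNgt; apply/negP => da; apply: np; exists a.
  apply: notpos => b; rewrite lt_neqAle eq_sym nz' leNgt; apply/negP => db.
  apply: nz; have [ab|ab] := leP a b.
    by have [|c _ dc] := IVT_ge cd ab (v := 0); [rewrite !ltW | exists c].
  by have [|c _ dc] := IVT_le cd (ltW ab) (v := 0); [rewrite !ltW | exists c].
have [z dz ez] : exists2 z, d z = 0 & 0 <= e z.
  have [z dz] := zero; have [|ez] := leP 0 (e z); first by exists z.
  have [q q0 hq] := derive_lt0_local (de z) ez.
  (* [d] is negative just after [z] and positive just before [z + P] *)
  pose s := Num.min (q / 2) (P / 4).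
  have s0 : 0 < s by rewrite lt_min !divr_gt0.
  have sq : s < q by rewrite (le_lt_trans (_ : _ <= q / 2)) ?ge_min ?lexx // ltr_pdivrMr // ltr_pMr // ltr1n.
  have sP : s <= P / 4 by rewrite ge_min lexx orbT.
  have [|/(_ _) h1 _] := hq (z + s); first by rewrite addrAC subrr add0r gtr0_norm.
  have [|_ /(_ _) h2] := hq (z - s); first by rewrite addrAC subrr add0r normrN gtr0_norm.
  have [|||z' ? ?] := @upcrossing R d e (z + s) (z - s + P) de; last by exists z'.
  - lra.
  - by rewrite -dz; apply: h1; lra.
  - by rewrite pd -dz; apply: h2; lra.
(* the curve in the frame of its tangent of angle [z] *)
pose X b := x (b + z) * cos z + y (b + z) * sin z.
pose Y b := y (b + z) * cos z - x (b + z) * sin z.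
pose r' b := r (b + z).
have dX b : is_derive b 1 X (r' b * cos b).
  apply: isD_eq (isD_add (isD_mul (isD_comp_shift (dx (b + z))) (isD_cst _ b))
    (isD_mul (isD_comp_shift (dy (b + z))) (isD_cst _ b))) _.
  rewrite !mulr0 !addr0 -!mulrA -mulrDr /r'; congr (_ * _).
  by rewrite -[in RHS](addrK z b) cosB.
have dY b : is_derive b 1 Y (r' b * sin b).
  apply: isD_eq (isD_sub (isD_mul (isD_comp_shift (dy (b + z))) (isD_cst _ b))
    (isD_mul (isD_comp_shift (dx (b + z))) (isD_cst _ b))) _.
  rewrite !mulr0 !addr0 -!mulrA -mulrBr /r'; congr (_ * _).
  by rewrite -[in RHS](addrK z b) sinB.
have [|||a [b [a0 ab b2 Xab Yab]]] := full_turn_meets dX dY.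
- by move=> b; exact: r0.
- move: dz; rewrite /d /h /Y add0r [2 * pi + z]addrC sinD2pi' cosD2pi'; lra.
- move: ez; rewrite /e /g /X add0r [2 * pi + z]addrC sinD2pi' cosD2pi'; lra.
have uz : cos z ^+ 2 + sin z ^+ 2 = 1 by exact: cos2Dsin2.
have xE b' : x (b' + z) = X b' * cos z - Y b' * sin z.
  by rewrite /X /Y -[LHS]mulr1 -uz; ring.
have yE b' : y (b' + z) = X b' * sin z + Y b' * cos z.
  by rewrite /X /Y -[LHS]mulr1 -uz; ring.
have [||j] := inj (b + z) (a + z); [by rewrite !xE Xab Yab | by rewrite !yE Xab Yab |].
move=> /eqP; rewrite addrAC (inj_eq (addIr z)) => /eqP bE.
have j0 : (0 < j)%R.
  rewrite -(ltr0z R) -(pmulr_rgt0 _ P0); lra.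
have j1 : 1 <= j%:~R :> R by rewrite -[1]/(1%:~R) ler_int.
have : P <= P * j%:~R by rewrite ler_peMr // ltW.
have : 2 * pi * 2 <= P by rewrite /P ler_wpM2l // mulr_ge0 ?ltW.
lra.
Qed.

End Turning.

(** * Strongly convex curves and their tangent angle *)

Section Coordinates.
Context {R : realType}.
Implicit Types (f gamma : R -> 'rV[R]_2) (t u : R) (i : 'I_2).

Lemma ord2P (P : 'I_2 -> Prop) : P 0 -> P 1 -> forall i, P i.
Proof.
move=> P0 P1 [[|[|//]] hi]; first by have <- : 0 = Ordinal hi :> 'I_2 by exact: val_inj.
by have <- : 1 = Ordinal hi :> 'I_2 by exact: val_inj.
Qed.

Lemma vec2P (u v : 'rV[R]_2) : u 0 0 = v 0 0 -> u 0 1 = v 0 1 -> u = v.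
Proof. by move=> h0 h1; apply/matrixP => j i; rewrite (ord1 j); move: i; apply: ord2P. Qed.

Lemma pair2_0 (a b : R) : (pair2 a b) 0 0 = a. Proof. by rewrite mxE. Qed.
Lemma pair2_1 (a b : R) : (pair2 a b) 0 1 = b. Proof. by rewrite mxE. Qed.

Lemma coord_derivable f t i : derivable f t 1 -> derivable (fun s => f s 0 i) t 1.
Proof. by move/derivable_mxP => /(_ 0 i). Qed.

Lemma derivable_coord f t : (forall i, derivable (fun s => f s 0 i) t 1) -> derivable f t 1.
Proof. by move=> df; apply/derivable_mxP => j i; rewrite (ord1 j); exact: df. Qed.

Lemma derive1_coord f t i : derivable f t 1 ->
  derive1 (fun s => f s 0 i) t = derive1 f t 0 i.
Proof. by move=> df; rewrite !derive1E derive_mx // mxE. Qed.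

Lemma derive1n_coord f n i : (forall m t, (m < n)%N -> derivable (derive1n m f) t 1) ->
  derive1n n (fun s => f s 0 i) = fun t => derive1n n f t 0 i.
Proof.
elim: n => // n IH df; rewrite !derive1nS IH => [|m t mn]; last first.
  by apply: df; exact: leqW.
by apply/funext => t; rewrite derive1_coord //; exact: df.
Qed.

Lemma smooth_coord f i : smooth f -> smooth (fun s => f s 0 i).
Proof.
by move=> sf n t; rewrite derive1n_coord => [|m u _]; [apply: coord_derivable|]; exact: sf.
Qed.

Lemma coord_smooth f : (forall i, smooth (fun s => f s 0 i)) -> smooth f.
Proof.
move=> sf n; elim/ltn_ind: n => n IH t; apply: derivable_coord => i.
by rewrite -derive1n_coord => [|m u mn]; [exact: sf | exact: IH].
Qed.

Lemma smooth_derive1 {V : normedModType R} (f : R -> V) : smooth f -> smooth (derive1 f).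
Proof. by move=> sf n t; rewrite -derive1Sn; exact: sf. Qed.

Lemma derive1_coordE f i : smooth f ->
  derive1 (fun s => f s 0 i) = fun t => derive1 f t 0 i.
Proof. by move=> sf; apply/funext => t; rewrite derive1_coord //; exact: (sf 0%N). Qed.

Lemma smooth_is (f : R -> R) t : smooth f -> is_derive t 1 f (derive1 f t).
Proof. by move=> sf; apply: derivable_is; exact: (sf 0%N). Qed.

Lemma smooth_cont (f : R -> R) : smooth f -> continuous f.
Proof. by move=> sf t; exact: is_derive_cont (smooth_is t sf). Qed.

Lemma coord_is f t i : smooth f -> is_derive t 1 (fun s => f s 0 i) (derive1 f t 0 i).
Proof. by move=> sf; have := smooth_is t (@smooth_coord f i sf); rewrite derive1_coordE. Qed.

Lemma eucl_sqr (u : 'rV[R]_2) : eucl u ^+ 2 = u 0 0 ^+ 2 + u 0 1 ^+ 2.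
Proof.
rewrite /eucl sqr_sqrtr; last by apply: sumr_ge0 => i _; rewrite sqr_ge0.
by rewrite !big_ord_recl big_ord0 addr0; congr (_ + u _ _ ^+ _); exact: val_inj.
Qed.

Lemma eucl_gt0 (u : 'rV[R]_2) : (0 < eucl u) = (u != 0).
Proof.
rewrite lt_neqAle sqrtr_ge0 andbT eq_sym -(@sqrf_eq0 R) eucl_sqr.
rewrite paddr_eq0 ?sqr_ge0 // !sqrf_eq0; congr (~~ _).
apply/andP/eqP => [[/eqP h0 /eqP h1]|->]; last by rewrite !mxE.
by apply: vec2P; rewrite mxE.
Qed.

End Coordinates.

Section Angle.
Context {R : realType}.
Implicit Types (gamma : R -> 'rV[R]_2) (th : R -> R) (t u : R).

Definition speed gamma t : R := eucl (derive1 gamma t).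

Definition bending gamma t : R := det2 (derive1 gamma t) (derive1 (derive1 gamma) t).

(** [th] is a lift of the angle of the tangent, and [k] is the turning number. *)
Record tangent_angle gamma th (k : nat) : Prop := TangentAngle {
  angle_derive : forall t, is_derive t 1 th (bending gamma t / speed gamma t ^+ 2);
  angle_dir : forall t,
    derive1 gamma t = speed gamma t *: pair2 (cos (th t)) (sin (th t));
  angle_turn : forall t, th (t + 2 * pi) = th t + 2 * pi * k%:R }.

Lemma smooth_bending gamma : smooth gamma -> smooth (bending gamma).
Proof.
move=> sg; have s1 := smooth_derive1 sg; have s2 := smooth_derive1 s1.
apply/smoothE => n.
apply: (@eq_Cn _ _ (fun t => derive1 gamma t 0 0 * derive1 (derive1 gamma) t 0 1 -
    derive1 gamma t 0 1 * derive1 (derive1 gamma) t 0 0)).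
  by apply/funext => t; rewrite /bending det2E.
by apply: CnB; apply: CnM; move: n; apply/smoothE; exact: smooth_coord.
Qed.

Lemma smooth_speed gamma : smooth gamma -> (forall t, 0 < speed gamma t) ->
  smooth (speed gamma).
Proof.
move=> sg v0; have s1 := smooth_derive1 sg; apply/smoothE => n.
have E t : speed gamma t ^+ 2 = derive1 gamma t 0 0 * derive1 gamma t 0 0 +
    derive1 gamma t 0 1 * derive1 gamma t 0 1 by rewrite eucl_sqr !expr2.
apply: (@eq_Cn _ _ (fun t => Num.sqrt (speed gamma t ^+ 2))).
  by apply/funext => t; rewrite sqrtr_sqr gtr0_norm.
apply: Cn_sqrt => [t|]; first by rewrite exprn_gt0.
apply: (eq_Cn (esym (funext E))).
by apply: CnD; apply: CnM; move: n; apply/smoothE; exact: smooth_coord.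
Qed.

Lemma bending_periodic gamma T : periodic gamma T ->
  periodic (bending gamma) T /\ periodic (speed gamma) T.
Proof.
have per (f : R -> 'rV[R]_2) : periodic f T -> periodic (derive1 f) T.
  by move=> pf t; rewrite /derive1 pf; under eq_fun do rewrite addrA pf.
move=> pg; have p1 := per _ pg; have p2 := per _ p1.
by split=> t; rewrite /bending /speed p1 ?p2.
Qed.

(** The angle is an integral of the curvature.  The coefficients of the unit
    tangent in the frame rotated by that angle have derivative 0, so a correct
    initial value makes the frame follow the tangent. *)
Lemma tangent_angle_exists gamma : smooth gamma -> periodic gamma (2 * pi) ->
  (forall t, 0 < speed gamma t) -> (forall t, 0 < bending gamma t) ->
  exists th k, (0 < k)%N /\ tangent_angle gamma th k.
Proof.
move=> sg pg v0 b0; have sb := smooth_bending sg; have sv := smooth_speed sg v0.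
have s1 := smooth_derive1 sg; have s2 := smooth_derive1 s1.
have [pb pv] := bending_periodic pg.
pose q t := bending gamma t / speed gamma t ^+ 2.
have q0 t : 0 < q t by rewrite divr_gt0 // exprn_gt0.
have cq : continuous q.
  apply: smooth_cont; apply/smoothE => n; apply: CnM; first by move: n; apply/smoothE.
  apply: CnV => [t|]; first by rewrite gt_eqF // exprn_gt0.
  by apply: CnM; move: n; apply/smoothE.
have [A dA] := antiderivative cq.
pose x1 : R -> R := fun t => derive1 gamma t 0 0; pose y1 : R -> R := fun t => derive1 gamma t 0 1.
pose x2 : R -> R := fun t => derive1 (derive1 gamma) t 0 0.
pose y2 : R -> R := fun t => derive1 (derive1 gamma) t 0 1.
have dx t : is_derive t 1 x1 (x2 t) by exact: coord_is.
have dy t : is_derive t 1 y1 (y2 t) by exact: coord_is.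
have vE t : speed gamma t ^+ 2 = x1 t ^+ 2 + y1 t ^+ 2 by rewrite eucl_sqr.
have bE t : bending gamma t = x1 t * y2 t - y1 t * x2 t by rewrite /bending det2E.
have vn t : speed gamma t != 0 by rewrite gt_eqF.
have dv t : is_derive t 1 (fun s => (speed gamma s)^-1)
    (- (x1 t * x2 t + y1 t * y2 t) / speed gamma t ^+ 3).
  have dv := smooth_is t sv.
  have e1 : derive1 (speed gamma) t * speed gamma t = x1 t * x2 t + y1 t * y2 t.
    have d1 := isD_mul dv dv.
    have d2 := isD_add (isD_mul (dx t) (dx t)) (isD_mul (dy t) (dy t)).
    have e : (fun s => speed gamma s * speed gamma s) = (fun s => x1 s * x1 s + y1 s * y1 s).
      by apply/funext => s; rewrite -!expr2 vE.
    rewrite e in d1; have := @derive_val _ _ _ _ _ _ _ d1.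
    by rewrite (@derive_val _ _ _ _ _ _ _ d2); lra.
  apply: isD_eq (is_deriveV (vn t) dv) _.
  by rewrite /GRing.scale /= -e1; field; rewrite vn.
have [a0 [ca sa]] : exists a0, x1 0 / speed gamma 0 = cos a0 /\ y1 0 / speed gamma 0 = sin a0.
  by apply: angle_of_unit; rewrite !expr_div_n -mulrDl -vE divff // expf_neq0.
pose th t := A t + (a0 - A 0).
have dth t : is_derive t 1 th (q t).
  by apply: isD_eq (isD_add (dA t) (isD_cst _ t)) _; rewrite addr0.
have th0 : th 0 = a0 by rewrite /th addrC subrK.
have dc t : is_derive t 1 (fun s => cos (th s)) (- sin (th t) * q t).
  exact: isD_comp (is_derive_cos (th t)) (dth t).
have ds t : is_derive t 1 (fun s => sin (th s)) (cos (th t) * q t).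
  exact: isD_comp (is_derive_sin (th t)) (dth t).
(* coefficients of the unit tangent in the rotated frame *)
pose P t := (x1 t * cos (th t) + y1 t * sin (th t)) * (speed gamma t)^-1.
pose Q t := (y1 t * cos (th t) - x1 t * sin (th t)) * (speed gamma t)^-1.
have key t : (x1 t ^+ 2 + y1 t ^+ 2) * (speed gamma t)^-1 ^+ 2 = 1.
  by rewrite -vE exprVn divff // expf_neq0.
have dP t : is_derive t 1 P 0.
  apply: isD_eq (isD_mul (isD_add (isD_mul (dx t) (dc t)) (isD_mul (dy t) (ds t))) (dv t)) _.
  rewrite /q bE -exprVn; move: (key t).
  have -> : (speed gamma t ^+ 3)^-1 = (speed gamma t)^-1 ^+ 3 by rewrite exprVn.
  set w := (speed gamma t)^-1 => k1.
  transitivity (w * (x2 t * cos (th t) + y2 t * sin (th t)) *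
    (1 - (x1 t ^+ 2 + y1 t ^+ 2) * w ^+ 2)); first by ring.
  by rewrite k1 subrr mulr0.
have dQ t : is_derive t 1 Q 0.
  apply: isD_eq (isD_mul (isD_sub (isD_mul (dy t) (dc t)) (isD_mul (dx t) (ds t))) (dv t)) _.
  rewrite /q bE -exprVn; move: (key t).
  have -> : (speed gamma t ^+ 3)^-1 = (speed gamma t)^-1 ^+ 3 by rewrite exprVn.
  set w := (speed gamma t)^-1 => k1.
  transitivity (w * (y2 t * cos (th t) - x2 t * sin (th t)) *
    (1 - (x1 t ^+ 2 + y1 t ^+ 2) * w ^+ 2)); first by ring.
  by rewrite k1 subrr mulr0.
have P1 t : P t = 1.
  rewrite (derive_zero_const dP t 0) /P th0 -ca -sa; move: (key 0).
  by set w := (speed gamma 0)^-1 => <-; ring.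
have Q0 t : Q t = 0.
  rewrite (derive_zero_const dQ t 0) /Q th0 -ca -sa.
  by set w := (speed gamma 0)^-1; ring.
have dir t : derive1 gamma t = speed gamma t *: pair2 (cos (th t)) (sin (th t)).
  have p1 : x1 t * cos (th t) + y1 t * sin (th t) = speed gamma t.
    by have := P1 t; rewrite /P => /(congr1 ( *%R^~ (speed gamma t))); rewrite divfK // mul1r.
  have q1 : y1 t * cos (th t) - x1 t * sin (th t) = 0.
    by have := Q0 t; rewrite /Q => /eqP; rewrite mulf_eq0 invr_eq0 (negbTE (vn t)) orbF => /eqP.
  have u := cos2Dsin2 (th t).
  apply: vec2P; rewrite mxE ?pair2_0 ?pair2_1 -p1 -[LHS]mulr1 -u -/(x1 t) -/(y1 t).
    by rewrite -[RHS]subr0 -(mul0r (sin (th t))) -q1; ring.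
  by rewrite -[RHS]addr0 -(mul0r (cos (th t))) -q1; ring.
have turn t : th (t + 2 * pi) - th t = th (2 * pi) - th 0.
  have d0 (s : R) : is_derive s 1 (fun s => th (s + 2 * pi) - th s) 0.
    apply: isD_eq (isD_sub (isD_comp_shift (dth (s + 2 * pi))) (dth s)) _.
    by rewrite /q pb pv subrr.
  by rewrite (derive_zero_const d0 t 0) add0r.
have th_incr : {homo th : s t / s < t} by exact: increasing_of_derive dth q0.
have [j jE] : exists j : int, th (2 * pi) - th 0 = 2 * pi * j%:~R.
  have e := dir (0 + 2 * pi); have pg' : derive1 gamma (0 + 2 * pi) = derive1 gamma 0.
    by rewrite /derive1 pg; under eq_fun do rewrite addrA pg.
  rewrite pg' pv dir in e; have /(scalerI (vn 0)) e' := e.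
  have ec : cos (th 0) = cos (th (0 + 2 * pi)) by have := congr1 (fun v : 'rV_2 => v 0 0) e'; rewrite !pair2_0.
  have es : sin (th 0) = sin (th (0 + 2 * pi)) by have := congr1 (fun v : 'rV_2 => v 0 1) e'; rewrite !pair2_1.
  rewrite add0r in ec es; apply: cos_1_sin_0.
    by rewrite cosB -ec -es -!expr2 cos2Dsin2.
  by rewrite sinB -ec -es mulrC subrr.
have j0 : 0 < j.
  have P0 : 0 < 2 * pi :> R by rewrite mulr_gt0 ?pi_gt0.
  by rewrite -(ltr0z R) -(pmulr_rgt0 _ P0) -jE subr_gt0 th_incr.
case: j jE j0 => // k jE k0; exists th, k; split => //; split=> // t.
by have := turn t; rewrite jE => e; rewrite -[LHS](subrK (th t)) e addrC.
Qed.

End Angle.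

Section ConvexCurve.
Context {R : realType}.
Implicit Types (gamma : R -> 'rV[R]_2) (th : R -> R) (a b t u v : R).

(** The analytic form of strong convexity on which the dynamics is built. *)
Record convex_curve gamma th : Prop := ConvexCurve {
  cc_smooth : smooth gamma;
  cc_periodic : periodic gamma (2 * pi);
  cc_speed : forall t, 0 < speed gamma t;
  cc_bending : forall t, 0 < bending gamma t;
  cc_angle : tangent_angle gamma th 1 }.

Section AngleTheory.
Context (gamma : R -> 'rV[R]_2) (th : R -> R) (k : nat).
Context (v0 : forall t, 0 < speed gamma t) (b0 : forall t, 0 < bending gamma t).
Context (ang : tangent_angle gamma th k) (k0 : (0 < k)%N).

Let rate t := bending gamma t / speed gamma t ^+ 2.

Let rate0 t : 0 < rate t. Proof. by rewrite divr_gt0 // exprn_gt0. Qed.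

Lemma angle_incr : {homo th : s t / s < t}.
Proof. exact: increasing_of_derive (angle_derive ang) rate0. Qed.

Lemma angle_lt : {mono th : s t / s < t}. Proof. exact: leW_mono (le_mono angle_incr). Qed.

Lemma angle_le : {mono th : s t / s <= t}. Proof. exact: le_mono angle_incr. Qed.

Lemma angle_inj : injective th. Proof. exact: inc_inj angle_le. Qed.

Lemma angle_cont : continuous th.
Proof. by move=> t; exact: is_derive_cont (angle_derive ang t). Qed.

Lemma angle_turnz t (j : int) : th (t + 2 * pi * j%:~R) = th t + 2 * pi * k%:R * j%:~R.
Proof.
pose f s := th s - k%:R * s.
have pf : periodic f (2 * pi) by move=> s; rewrite /f (angle_turn ang); ring.
by have := periodicz pf j t; rewrite /f => e; rewrite -[LHS](subrK (k%:R * (t + 2 * pi * j%:~R))) e; ring.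
Qed.

Lemma angle_surj v : exists t, th t = v.
Proof.
have P0 : 0 < 2 * pi :> R by rewrite mulr_gt0 ?pi_gt0.
have T0 : 0 < 2 * pi * k%:R :> R by rewrite mulr_gt0 ?ltr0n.
have [j /andP[h1 h2]] := period_representative (th 0) T0 v.
have [|t _ tE] := IVT_le angle_cont (ltW P0) (v := v + 2 * pi * k%:R * j%:~R).
  by have := angle_turn ang 0; rewrite add0r => ->; rewrite h1 ltW.
exists (t + 2 * pi * (- j)%:~R); rewrite angle_turnz tE rmorphN /=; ring.
Qed.

Lemma angle_inverse : exists2 tau : R -> R, continuous tau &
  (forall v, th (tau v) = v) /\ forall v, is_derive v 1 tau (rate (tau v))^-1.
Proof.
have [tau tauP] := choice angle_surj.
exists tau; first exact: inverse_continuous angle_incr tauP.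
split=> // v; rewrite -[in X in is_derive X](tauP v).
apply: (@is_derive_inverse R th).
- by near=> t; apply: angle_inj; rewrite tauP.
- by near=> t; exact: angle_cont.
- exact: (angle_derive ang).
- by rewrite gt_eqF.
Unshelve. all: by end_near. Qed.

End AngleTheory.

(** A simple closed curve turns once, by [turning_number_one] for the parametrization
    of the curve by its tangent angle. *)
Lemma strongly_convexP gamma : strongly_convex gamma -> exists th, convex_curve gamma th.
Proof.
case=> sg pg ig g0 c0.
have v0 t : 0 < speed gamma t by rewrite /speed eucl_gt0; exact: g0.
have b0 t : 0 < bending gamma t.
  by have := c0 t; rewrite /curvature pmulr_lgt0 // invr_gt0 exprn_gt0 //; exact: v0.
have [th [k [k0 ang]]] := tangent_angle_exists sg pg v0 b0.
suff k1 : k = 1%N by exists th; split=> //; rewrite -k1.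
have [tau ctau [tauK dtau]] := angle_inverse v0 b0 ang k0.
pose q t := bending gamma t / speed gamma t ^+ 2.
have q0 t : 0 < q t by rewrite divr_gt0 // exprn_gt0.
have tau_turn (j : int) a : tau (a + 2 * pi * k%:R * j%:~R) = tau a + 2 * pi * j%:~R.
  by apply: (angle_inj v0 b0 ang); rewrite (angle_turnz ang) !tauK.
have per i : periodic (fun a => gamma (tau a) 0 i) (2 * pi * k%:R).
  by move=> a; have := tau_turn 1 a; rewrite !mulr1 => ->; rewrite pg.
have dcoord i a : is_derive a 1 (fun a => gamma (tau a) 0 i)
    (speed gamma (tau a) * (pair2 (cos a) (sin a) 0 i) * (q (tau a))^-1).
  apply: isD_eq (isD_comp (coord_is (tau a) i sg) (dtau a)) _.
  by rewrite (angle_dir ang) tauK mxE.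
apply: (@turning_number_one R (fun a => gamma (tau a) 0 0) (fun a => gamma (tau a) 0 1)
  (fun a => speed gamma (tau a) / q (tau a))) => //.
- by move=> a; apply: isD_eq (dcoord 0 a) _; rewrite pair2_0 mulrAC.
- by move=> a; apply: isD_eq (dcoord 1 a) _; rewrite pair2_1 mulrAC.
- by move=> a; rewrite divr_gt0.
move=> a b ea eb; have [j jE] := ig _ _ (vec2P ea eb); exists j.
by rewrite -[LHS]tauK jE (angle_turnz ang) tauK.
Qed.

End ConvexCurve.

(** * The billiard map of a strongly convex curve *)

Section Dynamics.
Context {R : realType}.

Definition dd (gamma : R -> 'rV[R]_2) (a b : R) : R :=
  det2 (derive1 gamma a) (derive1 gamma b).

(** [adj gamma a b] says that (gamma a, gamma b) is a point of the phase space,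
    in a form that only depends on [gamma] and its tangents at [a] and [b]. *)
Definition adj (gamma : R -> 'rV[R]_2) (a b : R) : Prop :=
  a < b < a + 2 * pi /\ 0 < dd gamma a b.

(** The second coordinate of the phase space.  The two intersections of the curve
    with the line on which [ss gamma O a] is constant belong to the next and
    to the previous bounce, so the map and its inverse are given by one formula. *)
Definition ss (gamma : R -> 'rV[R]_2) (O : 'rV[R]_2) (a b : R) : R :=
  - det2 (derive1 gamma a) (gamma b - O).

Definition bounce (gamma : R -> 'rV[R]_2) (O : 'rV[R]_2) (a b : R) : 'rV[R]_2 :=
  pair2 a (ss gamma O a b).

Context (gamma : R -> 'rV[R]_2) (th : R -> R) (cc : convex_curve gamma th).
Context (O : 'rV[R]_2).
Implicit Types (a b c t u v : R) (p q : 'rV[R]_2).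

Notation star := (star gamma).
Notation E := (ss gamma O).
Notation v0 := (cc_speed cc).
Notation b0 := (cc_bending cc).
Notation ang := (cc_angle cc).
Notation sg := (cc_smooth cc).
Let th_lt := angle_lt v0 b0 ang.

Lemma det2Zl (k : R) (u v : 'rV[R]_2) : det2 (k *: u) v = k * det2 u v.
Proof. by rewrite !det2E !mxE; ring. Qed.

Lemma det2Zr (k : R) (u v : 'rV[R]_2) : det2 u (k *: v) = k * det2 u v.
Proof. by rewrite !det2E !mxE; ring. Qed.

Lemma ddE a b : dd gamma a b = speed gamma a * speed gamma b * sin (th b - th a).
Proof.
rewrite /dd (angle_dir ang a) (angle_dir ang b) det2Zl det2Zr det2E !pair2_0 !pair2_1 sinB.
by rewrite mulrA mulrC [sin (th b) * _]mulrC [cos (th b) * _]mulrC mulrC.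
Qed.

Lemma dd_gt0 a b : (0 < dd gamma a b) = (0 < sin (th b - th a)).
Proof. by rewrite ddE pmulr_rgt0 // mulr_gt0 // v0. Qed.

Lemma dd_lt0 a b : (dd gamma a b < 0) = (sin (th b - th a) < 0).
Proof. by rewrite ddE pmulr_rlt0 // mulr_gt0 // v0. Qed.

Lemma th_turn t : th (t + 2 * pi) = th t + 2 * pi.
Proof. by rewrite (angle_turn ang) mulr1. Qed.

Lemma th_turnz t (j : int) : th (t + 2 * pi * j%:~R) = th t + 2 * pi * j%:~R.
Proof. by rewrite (angle_turnz ang) mulr1. Qed.

Lemma sin_pos_turn (x : R) : 0 < x < 2 * pi -> 0 < sin x -> x < pi.
Proof.
move=> /andP[x0 x2] sx; rewrite ltNge le_eqVlt; apply/negP => /predU1P[e|xp].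
  by move: sx; rewrite -e sinpi ltxx.
by have := @sin_lt0_pi R x; rewrite xp x2 => /(_ isT); rewrite ltNge ltW.
Qed.

(** In terms of the tangent angle the cyclic order [t1 < t2 < t1^*] is an interval of
    length [pi], since [t^*] is where the tangent has turned by [pi]. *)
Lemma adjE a b : adj gamma a b <-> th a < th b < th a + pi.
Proof.
rewrite /adj dd_gt0; split=> [[/andP[ab ba] s0]|/andP[h1 h2]].
  have h1 : th a < th b by rewrite th_lt.
  have h2 : th b < th a + 2 * pi by rewrite -th_turn th_lt.
  rewrite h1 /=; have : th b - th a < pi by apply: sin_pos_turn => //; lra.
  by lra.
have ab : a < b by rewrite -th_lt.
have p0 := @pi0 R; have ba : b < a + 2 * pi by rewrite -th_lt th_turn; lra.
by rewrite ab ba; split=> //; apply: sin_gt0_pi; lra.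
Qed.

Lemma star_unique t u : t < u < t + 2 * pi -> dd gamma t u = 0 -> th u = th t + pi.
Proof.
move=> /andP[tu ut]; rewrite ddE => /eqP.
rewrite mulf_eq0 gt_eqF /=; last by rewrite mulr_gt0 ?v0.
move=> /eqP s0; have h1 : th t < th u by rewrite th_lt.
have h2 : th u < th t + 2 * pi by rewrite -th_turn th_lt.
have [h|h|h] := ltgtP (th u - th t) pi; last by rewrite -h addrC subrK.
  by have := @sin_gt0_pi R (th u - th t); rewrite s0 ltxx subr_gt0 h1 h => /(_ isT).
have h3 : pi < th u - th t < 2 * pi by rewrite h /=; lra.
by have := sin_lt0_pi h3; rewrite s0 ltxx.
Qed.

Lemma starP t : [/\ t < star t, star t < t + 2 * pi & th (star t) = th t + pi].
Proof.
have p0 := @pi0 R; have [u uE] := angle_surj ang (ltn0Sn 0) (th t + pi).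
have tu : t < u by rewrite -th_lt uE; lra.
have ut : u < t + 2 * pi by rewrite -th_lt th_turn uE; lra.
have inS : [set u | t < u < t + 2 * pi /\ dd gamma t u = 0] u.
  by rewrite /= tu ut; split=> //; rewrite ddE uE addrAC subrr add0r sinpi mulr0.
have [/andP[h1 h2] h3] := getI inS; split=> //.
by apply: star_unique => //; exact/andP.
Qed.

Lemma th_star t : th (star t) = th t + pi. Proof. by case: (starP t). Qed.

Lemma adj_star a b : adj gamma a b <-> a < b < star a.
Proof. by rewrite adjE -th_star !th_lt. Qed.

Lemma adj_star_prev a b : adj gamma a b <-> star b - 2 * pi < a < b.
Proof.
have e : th (star b - 2 * pi) = th b - pi.
  by have := th_turnz (star b) (-1); rewrite rmorphN /= mulrN mulr1 th_star => ->; ring.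
by rewrite adjE -[_ < a]th_lt -[a < b]th_lt e; split=> /andP[h1 h2]; apply/andP; split; lra.
Qed.

Lemma star_cont : continuous star.
Proof.
have [tau ctau [tauK _]] := angle_inverse v0 b0 ang (ltn0Sn 0).
have -> : star = fun t => tau (th t + pi).
  by apply/funext => t; apply: (angle_inj v0 b0 ang); rewrite tauK th_star.
move=> t; apply: (@continuous_comp _ _ _ (fun t => th t + pi) tau); last exact: ctau.
by apply: continuousD; [exact: (angle_cont ang) | exact: cst_continuous].
Qed.

Lemma L1ss a b : - L1 gamma O a b = E a b. Proof. by rewrite L1E //; exact: sg. Qed.

Lemma L2ss a b : L2 gamma O a b = E b a. Proof. by rewrite L2E //; exact: sg. Qed.

Lemma ssE a b : E a b = derive1 gamma a 0 1 * (gamma b 0 0 - O 0 0) -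
  derive1 gamma a 0 0 * (gamma b 0 1 - O 0 1).
Proof. by rewrite /ss det2E !mxE; ring. Qed.

Lemma ss_derive2 a t : is_derive t 1 (E a) (- dd gamma a t).
Proof.
have -> : E a = fun b => derive1 gamma a 0 1 * (gamma b 0 0 - O 0 0) -
  derive1 gamma a 0 0 * (gamma b 0 1 - O 0 1) by apply/funext => b; exact: ssE.
have d i : is_derive t 1 (fun b => gamma b 0 i - O 0 i) (derive1 gamma t 0 i).
  by apply: isD_eq (isD_sub (coord_is t i sg) (isD_cst _ t)) _; rewrite subr0.
apply: isD_eq (isD_sub (isD_mul (isD_cst _ t) (d 0)) (isD_mul (isD_cst _ t) (d 1))) _.
by rewrite /dd det2E !mul0r !add0r opprB.
Qed.

Lemma ss_cont a : continuous (E a).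
Proof. by move=> t; exact: is_derive_cont (ss_derive2 a t). Qed.

Lemma ss_decr a u v : a <= u -> u < v -> v <= star a -> E a v < E a u.
Proof.
apply: (decreasing_on (ss_derive2 a)) => x /andP[ax xs].
rewrite oppr_lt0 dd_gt0; apply: sin_gt0_pi.
by move: ax xs; rewrite -th_lt -[x < _]th_lt th_star => ax xs; lra.
Qed.

Lemma ss_incr a u v : star a - 2 * pi <= u -> u < v -> v <= a -> E a u < E a v.
Proof.
apply: (increasing_on (ss_derive2 a)) => x /andP[ax xs].
rewrite oppr_gt0 dd_lt0 -sinD2pi'; have p0 := @pi0 R.
have : th (star a) < th (x + 2 * pi) by rewrite th_lt; lra.
move: xs; rewrite -th_lt th_star th_turn => xs ax'.
by apply: sin_lt0_pi; lra.
Qed.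

Lemma ss_periodic a : periodic (E a) (2 * pi).
Proof. by move=> b; rewrite /ss (cc_periodic cc). Qed.

Lemma adj_inj a b c : adj gamma a b -> adj gamma a c -> E a b = E a c -> b = c.
Proof.
move=> /adj_star/andP[ab bs] /adj_star/andP[ac cs] e; apply/eqP.
have [h|h|//] := ltgtP b c.
  by have := ss_decr (ltW ab) h (ltW cs); rewrite e ltxx.
by have := ss_decr (ltW ac) h (ltW bs); rewrite e ltxx.
Qed.

Lemma adj_prev_inj a b c : adj gamma b a -> adj gamma c a -> E a b = E a c -> b = c.
Proof.
move=> /adj_star_prev/andP[ab bs] /adj_star_prev/andP[ac cs] e; apply/eqP.
have [h|h|//] := ltgtP b c.
  by have := ss_incr (ltW ab) h (ltW cs); rewrite e ltxx.
by have := ss_incr (ltW ac) h (ltW bs); rewrite e ltxx.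
Qed.

Notation P := (phase_space gamma O).

Lemma phaseE p : P p <-> E (p 0 0) (star (p 0 0)) < p 0 1 < E (p 0 0) (p 0 0).
Proof. by rewrite /phase_space /= !L1ss. Qed.

Lemma phase_next p : P p -> exists2 b, adj gamma (p 0 0) b & p = bounce gamma O (p 0 0) b.
Proof.
move=> /phaseE/andP[h1 h2]; have [as_ _ _] := starP (p 0 0).
have [|b /andP[b1 b2] bE] := IVT_ge (@ss_cont (p 0 0)) (ltW as_) (v := p 0 1).
  by rewrite !ltW.
exists b; last by apply: vec2P; rewrite ?pair2_0 ?pair2_1.
apply/adj_star; rewrite !lt_neqAle b1 b2 !andbT.
apply/andP; split; first by apply: contraTneq h2 => e; rewrite -bE -e ltxx.
by apply: contraTneq h1 => e; rewrite -bE e ltxx.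
Qed.

Lemma phase_prev p : P p -> exists2 a, adj gamma a (p 0 0) & p = bounce gamma O (p 0 0) a.
Proof.
move=> /phaseE/andP[h1 h2]; have [_ as_ _] := starP (p 0 0).
have as' : star (p 0 0) - 2 * pi <= p 0 0 by lra.
have e : E (p 0 0) (star (p 0 0) - 2 * pi) = E (p 0 0) (star (p 0 0)).
  by rewrite -ss_periodic subrK.
have [|b /andP[b1 b2] bE] := IVT_le (@ss_cont (p 0 0)) as' (v := p 0 1).
  by rewrite e !ltW.
exists b; last by apply: vec2P; rewrite ?pair2_0 ?pair2_1.
apply/adj_star_prev; rewrite !lt_neqAle b1 b2 !andbT.
apply/andP; split; last by apply: contraTneq h2 => e'; rewrite -bE e' ltxx.
by apply: contraTneq h1 => e'; rewrite -e -bE e' ltxx.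
Qed.

Lemma adj_phase a b : adj gamma a b -> P (bounce gamma O a b).
Proof.
move=> /adj_star/andP[h1 h2]; apply/phaseE; rewrite pair2_0 pair2_1.
by rewrite !ss_decr // ltW.
Qed.

Lemma adj_phase_prev a b : adj gamma a b -> P (bounce gamma O b a).
Proof.
move=> /adj_star_prev/andP[h1 h2]; apply/phaseE; rewrite pair2_0 pair2_1.
have e : E b (star b) = E b (star b - 2 * pi) by rewrite -[RHS]ss_periodic subrK.
by rewrite e !ss_incr // ltW.
Qed.

Lemma next_paramE a b : adj gamma a b -> next_param gamma O (bounce gamma O a b) = b.
Proof.
move=> ab; rewrite /next_param pair2_0 pair2_1; apply: get_unique.
  by split; [exact/adj_star | rewrite L1ss].
move=> c [/adj_star ac]; rewrite L1ss => e; exact: adj_inj ac ab (esym e).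
Qed.

Lemma billiard_mapE a b : adj gamma a b ->
  billiard_map gamma O (bounce gamma O a b) = bounce gamma O b a.
Proof. by move=> ab; rewrite /billiard_map next_paramE // pair2_0 L2ss. Qed.

Lemma billiard_map_phase p : P p -> P (billiard_map gamma O p).
Proof. by move=> /phase_next[b ab ->]; rewrite (billiard_mapE ab); exact: adj_phase_prev. Qed.

Lemma billiard_invE a b : adj gamma a b ->
  billiard_inv gamma O (bounce gamma O b a) = bounce gamma O a b.
Proof.
move=> ab; have inj : {in P &, injective (billiard_map gamma O)}.
  move=> p q /set_mem/phase_next[c pc ->] /set_mem/phase_next[d qd ->].
  rewrite (billiard_mapE pc) (billiard_mapE qd).
  move: (p 0 0) (q 0 0) pc qd => x y pc qd e.
  have cd : c = d by have := congr1 (fun v : 'rV_2 => v 0 0) e; rewrite !pair2_0.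
  subst d; have e' : E c x = E c y.
    by have := congr1 (fun v : 'rV_2 => v 0 1) e; rewrite !pair2_1.
  by rewrite (adj_prev_inj pc qd e').
rewrite -(billiard_mapE ab) /billiard_inv; apply: (pinvKV _ inj).
by apply: mem_set; exact: adj_phase.
Qed.

Lemma billiard_inv_phase p : P p -> P (billiard_inv gamma O p).
Proof. by move=> /phase_prev[b ab ->]; rewrite (billiard_invE ab); exact: adj_phase. Qed.

Lemma billiard_mapK p : P p -> billiard_inv gamma O (billiard_map gamma O p) = p.
Proof. by move=> /phase_next[b ab ->]; rewrite (billiard_mapE ab) (billiard_invE ab). Qed.

Lemma billiard_invK p : P p -> billiard_map gamma O (billiard_inv gamma O p) = p.
Proof. by move=> /phase_prev[b ab ->]; rewrite (billiard_invE ab) (billiard_mapE ab). Qed.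

End Dynamics.

(** * Maps with a Lipschitz derivative *)

Section C11.
Context {R : realType}.
Implicit Types U V W : normedModType R.

(** [D] is a derivative of [f] near [p0], with a uniform quadratic remainder and
    a Lipschitz dependence on the point.  This class is stable under composition
    by explicit estimates, and it is what the construction of invariant curves
    consumes. *)
Definition C11 U W (f : U -> W) (D : U -> U -> W) (p0 : U) : Prop :=
  (forall p k u v, D p (k *: u + v) = k *: D p u + D p v) /\
  exists r C : R, [/\ 0 < r, 0 <= C,
    forall p q, `|p - p0| < r -> `|q - p0| < r ->
      `|f q - f p - D p (q - p)| <= C * `|q - p| ^+ 2,
    forall p q w, `|p - p0| < r -> `|q - p0| < r ->
      `|D q w - D p w| <= C * `|q - p| * `|w| &
    forall p w, `|p - p0| < r -> `|D p w| <= C * `|w|].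

Lemma C11_lin U W (f : U -> W) D p0 : C11 f D p0 ->
  (forall p u v, D p (u - v) = D p u - D p v) /\
  (forall p k u, D p (k *: u) = k *: D p u).
Proof.
case=> lin _; have D0 p : D p 0 = 0.
  by have := lin p (-1) 0 0; rewrite scaler0 addr0 scaleN1r addNr.
split=> [p u v|p k u]; last by rewrite -[k *: u]addr0 lin D0 addr0.
by rewrite addrC -[- v]scaleN1r lin scaleN1r addrC.
Qed.

Lemma C11_eq U W (f : U -> W) D D' p0 : C11 f D p0 -> (forall p w, D p w = D' p w) -> C11 f D' p0.
Proof. by move=> cf e; have <- : D = D' by apply/funext => p; apply/funext. Qed.

Lemma C11_lip U W (f : U -> W) D p0 : C11 f D p0 -> exists r K : R, [/\ 0 < r, 0 <= K &
  forall p q, `|p - p0| < r -> `|q - p0| < r -> `|f q - f p| <= K * `|q - p|].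
Proof.
case=> _ [r [C [r0 C0 H1 H2 H3]]]; exists r, (C * (2 * r) + C); split=> //.
  by rewrite addr_ge0 // mulr_ge0 // mulr_ge0 // ltW.
move=> p q pr qr; have pq : `|q - p| <= 2 * r.
  rewrite -[q - p](subrKA p0) (le_trans (ler_normD _ _)) // [`|p0 - p|]distrC.
  by have := ltW pr; have := ltW qr; lra.
rewrite -[f q - f p](subrK (D p (q - p))) (le_trans (ler_normD _ _)) //.
have e : C * `|q - p| ^+ 2 <= C * (2 * r) * `|q - p|.
  by rewrite expr2 -[C * (2 * r) * _]mulrA ler_wpM2l // ler_wpM2r.
by rewrite mulrDl lerD ?H3 //; exact: le_trans (H1 _ _ pr qr) e.
Qed.

Lemma C11_cont U W (f : U -> W) D p0 : C11 f D p0 -> {for p0, continuous f}.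
Proof.
move=> /C11_lip[r [K [r0 K0 H]]]; apply/cvgrPdist_lt => e e0.
near=> q; rewrite distrC.
have qr : `|q - p0| < r by near: q; exact: cvgr_distC_lt.
apply: le_lt_trans (H p0 q _ qr) _; first by rewrite subrr normr0.
apply: le_lt_trans (_ : (K + 1) * `|q - p0| < e).
  by rewrite ler_wpM2r // lerDl.
rewrite -ltr_pdivlMl ?ltr_wpDl // mulrC.
by near: q; apply: cvgr_distC_lt; rewrite ?divr_gt0 ?ltr_wpDl //.
Unshelve. all: by end_near. Qed.

Lemma C11_comp U V W (f : U -> V) (g : V -> W) Df Dg p0 :
  C11 f Df p0 -> C11 g Dg (f p0) -> C11 (fun p => g (f p)) (fun p w => Dg (f p) (Df p w)) p0.
Proof.
move=> cf cg; have [addg _] := C11_lin cg; have [linf _] := cf; have [ling _] := cg.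
split=> [p k u v|]; first by rewrite linf ling.
have [r [C [r0 C0 H1 H2 H3]]] := cf.2; have [s [B [s0 B0 G1 G2 G3]]] := cg.2.
have [r' [K [r'0 K0 HL]]] := C11_lip cf.
pose m := Num.min r (Num.min r' (s / (K + 1))).
have m0 : 0 < m by rewrite !lt_min r0 r'0 divr_gt0 // ltr_wpDl.
have inr p : `|p - p0| < m -> `|p - p0| < r /\ `|p - p0| < r'.
  by rewrite !lt_min => /and3P[].
have ins p : `|p - p0| < m -> `|f p - f p0| < s.
  move=> pm; have [_ pr'] := inr p pm.
  apply: le_lt_trans (HL p0 p _ pr') _; first by rewrite subrr normr0.
  apply: le_lt_trans (_ : (K + 1) * `|p - p0| < s); first by rewrite ler_wpM2r // lerDl.
  by rewrite -ltr_pdivlMl ?ltr_wpDl // mulrC; move: pm; rewrite !lt_min => /and3P[].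
exists m, (B * K ^+ 2 + B * C + B * K * C); split=> //.
- by rewrite !addr_ge0 // !mulr_ge0 // exprn_ge0.
- move=> p q pm qm; have [pr pr'] := inr p pm; have [qr qr'] := inr q qm.
  have e1 := G1 _ _ (ins p pm) (ins q qm); have e2 := HL p q pr' qr'.
  have e3 := G3 _ (f q - f p - Df p (q - p)) (ins p pm); have e4 := H1 p q pr qr.
  have -> : g (f q) - g (f p) - Dg (f p) (Df p (q - p)) =
      (g (f q) - g (f p) - Dg (f p) (f q - f p)) + Dg (f p) (f q - f p - Df p (q - p)).
    by rewrite [Dg _ (f q - f p - _)]addg addrA subrK.
  apply: le_trans (ler_normD _ _) _.
  have n1 : B * `|f q - f p| ^+ 2 <= B * K ^+ 2 * `|q - p| ^+ 2.
    by rewrite -mulrA -exprMn ler_wpM2l // ler_pXn2r ?nnegrE ?mulr_ge0.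
  have n2 : B * `|f q - f p - Df p (q - p)| <= B * C * `|q - p| ^+ 2.
    by rewrite -mulrA ler_wpM2l.
  have n3 : 0 <= B * K * C * `|q - p| ^+ 2 by rewrite !mulr_ge0 ?exprn_ge0.
  by lra.
- move=> p q w pm qm; have [pr pr'] := inr p pm; have [qr qr'] := inr q qm.
  rewrite -[X in `|X|](subrKA (Dg (f p) (Df q w))) -addg.
  apply: le_trans (ler_normD _ _) _.
  have e1 := G2 _ _ (Df q w) (ins p pm) (ins q qm); have e2 := HL p q pr' qr'.
  have e3 := G3 _ (Df q w - Df p w) (ins p pm); have e4 := H2 p q w pr qr.
  have e5 := H3 q w qr.
  have n1 : B * `|f q - f p| * `|Df q w| <= B * (K * `|q - p|) * (C * `|w|).
    by rewrite ler_pM // ?mulr_ge0 // ler_wpM2l.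
  have n2 : B * `|Df q w - Df p w| <= B * (C * `|q - p| * `|w|) by rewrite ler_wpM2l.
  have n3 : 0 <= B * K ^+ 2 * `|q - p| * `|w| by rewrite !mulr_ge0 ?exprn_ge0.
  by lra.
- move=> p w pm; have [pr pr'] := inr p pm.
  have e1 := G3 _ (Df p w) (ins p pm); have e2 := H3 p w pr.
  have n1 : B * `|Df p w| <= B * (C * `|w|) by rewrite ler_wpM2l.
  have n2 : 0 <= B * K ^+ 2 * `|w| by rewrite !mulr_ge0 ?exprn_ge0.
  have n3 : 0 <= B * K * C * `|w| by rewrite !mulr_ge0 ?exprn_ge0.
  by lra.
Qed.

Lemma C11_local U W (f g : U -> W) D p0 : C11 f D p0 -> (\forall p \near p0, f p = g p) ->
  C11 g D p0.
Proof.
move=> [lin [r [C [r0 C0 H1 H2 H3]]]] /nbhs_ballP[e /= e0 fg]; split=> //.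
have in_e p : `|p - p0| < Num.min r e -> `|p - p0| < r /\ f p = g p.
  by rewrite lt_min => /andP[-> pe]; split=> //; apply: fg; rewrite -ball_normE /= distrC.
exists (Num.min r e), C; split=> //; first by rewrite lt_min r0 e0.
- by move=> p q /in_e[pr <-] /in_e[qr <-]; exact: H1.
- by move=> p q w /in_e[pr _] /in_e[qr _]; exact: H2.
- by move=> p w /in_e[pr _]; exact: H3.
Qed.

Lemma C11_cst U W (c : W) (p0 : U) : C11 (fun _ : U => c) (fun _ _ => 0) p0.
Proof.
split=> [*|]; first by rewrite scaler0 addr0.
exists 1, 0; split=> // *; rewrite ?subrr ?subr0 ?normr0 ?mul0r //.
Qed.

Lemma C11_add U W (f g : U -> W) Df Dg p0 : C11 f Df p0 -> C11 g Dg p0 ->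
  C11 (fun p => f p + g p) (fun p w => Df p w + Dg p w) p0.
Proof.
move=> [lf [r [C [r0 C0 H1 H2 H3]]]] [lg [s [B [s0 B0 G1 G2 G3]]]].
split=> [p k u v|]; first by rewrite lf lg scalerDr addrACA.
exists (Num.min r s), (C + B); split; rewrite ?lt_min ?r0 ?addr_ge0 //.
- move=> p q; rewrite !lt_min => /andP[p1 p2] /andP[q1 q2].
  have -> : f q + g q - (f p + g p) - (Df p (q - p) + Dg p (q - p)) =
      (f q - f p - Df p (q - p)) + (g q - g p - Dg p (q - p)).
    by rewrite [RHS]addrACA -[- Df _ _ - _]opprD; congr (_ - _); rewrite opprD addrACA.
  by rewrite mulrDl (le_trans (ler_normD _ _)) // lerD ?H1 ?G1.
- move=> p q w; rewrite !lt_min => /andP[p1 p2] /andP[q1 q2].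
  by rewrite [- (Df _ _ + _)]opprD addrACA !mulrDl (le_trans (ler_normD _ _)) // lerD ?H2 ?G2.
- move=> p w; rewrite !lt_min => /andP[p1 p2].
  by rewrite mulrDl (le_trans (ler_normD _ _)) // lerD ?H3 ?G3.
Qed.

Lemma C11_mul U (f g : U -> R) Df Dg p0 : C11 f Df p0 -> C11 g Dg p0 ->
  C11 (fun p => f p * g p) (fun p w => Df p w * g p + f p * Dg p w) p0.
Proof.
move=> cf cg; have [r' [K [r'0 K0 HL]]] := C11_lip cf.
have [s' [L [s'0 L0 GL]]] := C11_lip cg.
have [lf [r [C [r0 C0 H1 H2 H3]]]] := cf; have [lg [s [B [s0 B0 G1 G2 G3]]]] := cg.
split=> [p k u v|]; first by rewrite lf lg /GRing.scale /=; ring.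
pose m := Num.min (Num.min r r') (Num.min s s').
have m0 : 0 < m by rewrite !lt_min r0 r'0 s0 s'0.
have inm p : `|p - p0| < m -> [/\ `|p - p0| < r, `|p - p0| < r', `|p - p0| < s & `|p - p0| < s'].
  by rewrite !lt_min => /andP[/andP[? ?] /andP[? ?]].
pose F := `|f p0| + K * m; pose G := `|g p0| + L * m.
have F0 : 0 <= F by rewrite addr_ge0 // mulr_ge0 // ltW.
have G0 : 0 <= G by rewrite addr_ge0 // mulr_ge0 // ltW.
have fF p : `|p - p0| < m -> `|f p| <= F.
  move=> pm; have [_ p2 _ _] := inm p pm; rewrite -[f p](subrK (f p0)) addrC.
  rewrite (le_trans (ler_normD _ _)) // lerD2l (le_trans (HL p0 p _ p2)) ?subrr ?normr0 //.
  by rewrite ler_wpM2l // ltW.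
have gG p : `|p - p0| < m -> `|g p| <= G.
  move=> pm; have [_ _ _ p2] := inm p pm; rewrite -[g p](subrK (g p0)) addrC.
  rewrite (le_trans (ler_normD _ _)) // lerD2l (le_trans (GL p0 p _ p2)) ?subrr ?normr0 //.
  by rewrite ler_wpM2l // ltW.
exists m, (C * G + F * B + K * L + C * L + K * B); split=> //.
- by rewrite !addr_ge0 // mulr_ge0.
- move=> p q pm qm; have [p1 p2 p3 p4] := inm p pm; have [q1 q2 q3 q4] := inm q qm.
  have -> : f q * g q - f p * g p - (Df p (q - p) * g p + f p * Dg p (q - p)) =
    (f q - f p - Df p (q - p)) * g p + f p * (g q - g p - Dg p (q - p)) +
    (f q - f p) * (g q - g p) by ring.
  apply: le_trans (ler_normD _ _) _; apply: le_trans (lerD (ler_normD _ _) (lexx _)) _.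
  rewrite !normrM.
  have n1 : `|f q - f p - Df p (q - p)| * `|g p| <= C * `|q - p| ^+ 2 * G.
    by rewrite ler_pM ?H1 ?gG.
  have n2 : `|f p| * `|g q - g p - Dg p (q - p)| <= F * (B * `|q - p| ^+ 2).
    by rewrite ler_pM ?G1 ?fF.
  have n3 : `|f q - f p| * `|g q - g p| <= (K * `|q - p|) * (L * `|q - p|).
    by rewrite ler_pM ?HL ?GL.
  have n4 : 0 <= (C * L + K * B) * `|q - p| ^+ 2.
    by rewrite mulr_ge0 ?exprn_ge0 // addr_ge0 // mulr_ge0.
  by rewrite expr2 in n1 n2 n4 *; clear -n1 n2 n3 n4; lra.
- move=> p q w pm qm; have [p1 p2 p3 p4] := inm p pm; have [q1 q2 q3 q4] := inm q qm.
  have -> : Df q w * g q + f q * Dg q w - (Df p w * g p + f p * Dg p w) =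
    (Df q w - Df p w) * g p + f p * (Dg q w - Dg p w) +
    (Df q w * (g q - g p) + (f q - f p) * Dg q w) by ring.
  apply: le_trans (ler_normD _ _) _; apply: le_trans (lerD (ler_normD _ _) (ler_normD _ _)) _.
  rewrite !normrM.
  have n1 : `|Df q w - Df p w| * `|g p| <= C * `|q - p| * `|w| * G by rewrite ler_pM ?H2 ?gG.
  have n2 : `|f p| * `|Dg q w - Dg p w| <= F * (B * `|q - p| * `|w|) by rewrite ler_pM ?G2 ?fF.
  have n3 : `|Df q w| * `|g q - g p| <= (C * `|w|) * (L * `|q - p|) by rewrite ler_pM ?H3 ?GL.
  have n4 : `|f q - f p| * `|Dg q w| <= (K * `|q - p|) * (B * `|w|) by rewrite ler_pM ?HL ?G3.
  have n5 : 0 <= K * L * `|q - p| * `|w| by rewrite !mulr_ge0.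
  by clear -n1 n2 n3 n4 n5; lra.
- move=> p w pm; have [p1 p2 p3 p4] := inm p pm.
  apply: le_trans (ler_normD _ _) _; rewrite !normrM.
  have n1 : `|Df p w| * `|g p| <= C * `|w| * G by rewrite ler_pM ?H3 ?gG.
  have n2 : `|f p| * `|Dg p w| <= F * (B * `|w|) by rewrite ler_pM ?G3 ?fF.
  have n5 : 0 <= (K * L + C * L + K * B) * `|w| by rewrite mulr_ge0 // !addr_ge0 // mulr_ge0.
  by clear -n1 n2 n5; lra.
Qed.

(** Bounds on a neighbourhood of the second derivative give the estimates. *)
Lemma C11_smooth (h : R -> R) t0 : smooth h -> C11 h (fun t w => derive1 h t * w) t0.
Proof.
move=> sh; have s1 := smooth_derive1 sh; have s2 := smooth_derive1 s1.
split=> [p k u v|]; first by rewrite /GRing.scale /=; ring.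
have [r r0 h2] : exists2 r : R, 0 < r & forall t, `|t - t0| < r ->
    `|derive1 (derive1 h) t| < `|derive1 (derive1 h) t0| + 1.
  apply: (@cont_lt R (fun t => `|derive1 (derive1 h) t|)); last by rewrite ltrDl.
  by apply: continuous_comp; [exact: smooth_cont | exact: norm_continuous].
pose C := `|derive1 (derive1 h) t0| + 1; have C0 : 0 <= C by rewrite addr_ge0.
have seg c p q : `|p - t0| < r -> `|q - t0| < r -> p < c -> c < q -> `|c - t0| < r.
  by rewrite !ltr_distl => /andP[a1 a2] /andP[b1 b2] pc cq; apply/andP; split; lra.
have lip p q : `|p - t0| < r -> `|q - t0| < r ->
    `|derive1 h q - derive1 h p| <= C * `|q - p|.
  wlog pq : p q / p < q => [H pr qr|pr qr].
    have [pq|qp|->] := ltgtP p q; first exact: H.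
      by rewrite distrC [`|q - p|]distrC; exact: H.
    by rewrite !subrr normr0 mulr0.
  have [c /andP[pc cq] ->] := mean_value pq (fun t => smooth_is t s1).
  by rewrite normrM ler_wpM2r // ltW // h2 // (seg c p q).
exists r, (C + (`|derive1 h t0| + C * r)); split=> //.
- by rewrite !addr_ge0 // mulr_ge0 // ltW.
- move=> p q pr qr; apply: le_trans (_ : C * `|q - p| ^+ 2 <= _); last first.
    by rewrite ler_wpM2r ?exprn_ge0 // lerDl addr_ge0 // mulr_ge0 // ltW.
  have key c : `|c - t0| < r -> `|c - p| <= `|q - p| ->
      `|derive1 h c * (q - p) - derive1 h p * (q - p)| <= C * `|q - p| ^+ 2.
    move=> cr cp; rewrite -mulrBl normrM expr2 mulrA ler_wpM2r //.
    by rewrite (le_trans (lip _ _ pr cr)) // ler_wpM2l.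
  have [pq|qp|->] := ltgtP p q; last by rewrite !subrr mulr0 subrr normr0 expr0n mulr0.
    have [c /andP[pc cq] ->] := mean_value pq (fun t => smooth_is t sh).
    apply: key; first exact: (seg c p q).
    by rewrite !gtr0_norm ?subr_gt0 // lerD2r ltW.
  have [c /andP[pc cq] e] := mean_value qp (fun t => smooth_is t sh).
  have -> : h q - h p = derive1 h c * (q - p) by rewrite -[LHS]opprB e -mulrN opprB.
  apply: key; first exact: (seg c q p).
  by rewrite ![`|_ - p|]distrC !gtr0_norm ?subr_gt0 // lerD2l lerN2 ltW.
- move=> p q w pr qr; rewrite -mulrBl normrM ler_wpM2r //.
  apply: le_trans (lip _ _ pr qr) _.
  by rewrite ler_wpM2r // lerDl addr_ge0 // mulr_ge0 // ltW.
- move=> p w pr; rewrite normrM ler_wpM2r //.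
  apply: le_trans (_ : `|derive1 h t0| + C * r <= _); last by rewrite lerDr.
  rewrite -[derive1 h p](subrK (derive1 h t0)) addrC (le_trans (ler_normD _ _)) // lerD2l.
  by rewrite (le_trans (lip t0 p _ pr)) ?subrr ?normr0 // ler_wpM2l // ltW.
Qed.

End C11.

Section Plane.
Context {R : realType}.
Notation V := ('rV[R]_2 : normedModType R).
Implicit Types (p q u v w : 'rV[R]_2).

Lemma eq_leR (x y : R) : x = y -> x <= y. Proof. by move=> ->. Qed.

Lemma rv_norm_le v (c : R) : 0 <= c -> `|v 0 0| <= c -> `|v 0 1| <= c -> `|v| <= c.
Proof.
move=> c0 h0 h1; rewrite /Num.Def.normr /= mx_normrE; apply: bigmax_le => // -[i j] _ /=.
by rewrite (ord1 i); move: j; apply: ord2P.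
Qed.

Lemma coord_norm_le v i : `|v 0 i| <= `|v|.
Proof. by rewrite [leRHS]/Num.Def.normr /= mx_normrE (le_bigmax _ _ (0 : 'I_1, i)). Qed.

Lemma C11_coord i (p0 : 'rV[R]_2) : @C11 R V R (fun p => p 0 i) (fun _ w => w 0 i) p0.
Proof.
split=> [p k u w|]; first by rewrite !mxE.
exists 1, 1; split=> //.
- by move=> p q _ _; rewrite !mxE subrr normr0 mul1r exprn_ge0.
- by move=> p q w _ _; rewrite subrr normr0 mul1r mulr_ge0.
- by move=> p w _; rewrite mul1r coord_norm_le.
Qed.

Lemma C11_pair (U : normedModType R) (f g : U -> R) Df Dg (p0 : U) :
  C11 f Df p0 -> C11 g Dg p0 ->
  @C11 R U V (fun p : U => pair2 (f p) (g p)) (fun (p w : U) => pair2 (Df p w) (Dg p w)) p0.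
Proof.
move=> [lf [r [C [r0 C0 H1 H2 H3]]]] [lg [s [B [s0 B0 G1 G2 G3]]]].
split=> [p k u w|]; first by apply: vec2P; rewrite !mxE /= ?lf ?lg.
have hC (x y : R) : 0 <= x -> y <= C * x -> y <= (C + B) * x.
  by move=> x0 h; rewrite mulrDl (le_trans h) // lerDl mulr_ge0.
have hB (x y : R) : 0 <= x -> y <= B * x -> y <= (C + B) * x.
  by move=> x0 h; rewrite mulrDl (le_trans h) // lerDr mulr_ge0.
exists (Num.min r s), (C + B); split; rewrite ?lt_min ?r0 ?addr_ge0 //.
- move=> p q; rewrite !lt_min => /andP[p1 p2] /andP[q1 q2].
  apply: rv_norm_le; first by rewrite mulr_ge0 ?addr_ge0 ?exprn_ge0.
    by rewrite !mxE /= hC ?exprn_ge0 ?H1.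
  by rewrite !mxE /= hB ?exprn_ge0 ?G1.
- move=> p q w; rewrite !lt_min => /andP[p1 p2] /andP[q1 q2]; rewrite -mulrA.
  apply: rv_norm_le; first by rewrite !mulr_ge0 ?addr_ge0.
    by rewrite !mxE /= hC ?mulr_ge0 // mulrA H2.
  by rewrite !mxE /= hB ?mulr_ge0 // mulrA G2.
- move=> p w; rewrite !lt_min => /andP[p1 p2].
  apply: rv_norm_le; first by rewrite !mulr_ge0 ?addr_ge0.
    by rewrite !mxE /= hC ?H3.
  by rewrite !mxE /= hB ?G3.
Qed.

(** The implicit function theorem for a root [n] that is already known to exist
    and to be continuous. *)
Lemma C11_implicit (e : 'rV[R]_2 -> R) (a b : 'rV[R]_2 -> R) (n : 'rV[R]_2 -> R)
    (p0 : 'rV[R]_2) :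
  @C11 R V R e (fun x w => a x * w 0 0 + b x * w 0 1) (pair2 (p0 0 0) (n p0)) ->
  b (pair2 (p0 0 0) (n p0)) != 0 ->
  (forall d : R, 0 < d -> exists2 r : R, 0 < r &
    forall p, `|p - p0| < r -> `|n p - n p0| < d) ->
  (exists2 r : R, 0 < r & forall p : 'rV[R]_2, `|p - p0| < r ->
    e (pair2 (p 0 0) (n p)) = p 0 1) ->
  @C11 R V R n (fun p w => (w 0 1 - a (pair2 (p 0 0) (n p)) * w 0 0) /
    b (pair2 (p 0 0) (n p))) p0.
Proof.
pose x p : 'rV[R]_2 := pair2 (p 0 0) (n p); rewrite -/(x p0).
move=> ce b0 cn [r1 r10 root]; split=> [p k u w|]; first by rewrite !mxE -/(x p) /GRing.scale /=; ring.
have [_ [r [C [r0 C0 H1 H2 H3]]]] := ce.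
have xr (d : R) : 0 < d -> exists2 s : R, 0 < s & forall p, `|p - p0| < s -> `|x p - x p0| < d.
  move=> d0; have [s s0 hs] := cn d d0; exists (Num.min s d); first by rewrite lt_min s0.
  move=> p; rewrite lt_min => /andP[ps pd].
  apply: le_lt_trans (_ : Num.max `|p - p0| `|n p - n p0| < d).
    apply: rv_norm_le; first by rewrite le_max normr_ge0.
      by rewrite !mxE /= le_max; have := coord_norm_le (p - p0) 0; rewrite !mxE => ->.
    by rewrite !mxE /= le_max lexx orbT.
  by rewrite gt_max pd hs.
pose beta : R := `|b (x p0)| / 2; have beta0 : 0 < beta by rewrite divr_gt0 ?normr_gt0.
have e0E : (pair2 1 0 : 'rV[R]_2) 0 0 = 1 /\ (pair2 1 0 : 'rV[R]_2) 0 1 = 0 by rewrite !mxE.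
have e1E : (pair2 0 1 : 'rV[R]_2) 0 0 = 0 /\ (pair2 0 1 : 'rV[R]_2) 0 1 = 1 by rewrite !mxE.
have n0 : `|pair2 1 0 : 'rV[R]_2| <= 1 by apply: rv_norm_le; rewrite ?e0E.1 ?e0E.2 ?normr0 ?normr1.
have n1 : `|pair2 0 1 : 'rV[R]_2| <= 1 by apply: rv_norm_le; rewrite ?e1E.1 ?e1E.2 ?normr0 ?normr1.
have lipab u v : `|u - x p0| < r -> `|v - x p0| < r ->
    `|a v - a u| <= C * `|v - u| /\ `|b v - b u| <= C * `|v - u|.
  move=> ur vr; have h0 := H2 u v (pair2 1 0) ur vr; have h1 := H2 u v (pair2 0 1) ur vr.
  rewrite e0E.1 e0E.2 !mulr0 !mulr1 !addr0 in h0; rewrite e1E.1 e1E.2 !mulr0 !mulr1 !add0r in h1.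
  have cv : 0 <= C * `|v - u| by rewrite mulr_ge0.
  by split; [apply: le_trans h0 _ | apply: le_trans h1 _]; rewrite ler_piMr.
have bda u : `|u - x p0| < r -> `|a u| <= C.
  move=> ur; have h0 := H3 u (pair2 1 0) ur; rewrite e0E.1 e0E.2 mulr0 mulr1 addr0 in h0.
  by apply: le_trans h0 _; rewrite ler_piMr.
pose d := Num.min r (Num.min (beta / (C + 1)) (beta / (4 * (C + 1)))).
have C1 : 0 < C + 1 by rewrite ltr_wpDl.
have C4 : 0 < 4 * (C + 1) by rewrite mulr_gt0.
have d0 : 0 < d by rewrite !lt_min r0 (divr_gt0 beta0 C1) (divr_gt0 beta0 C4).
have bdb u : `|u - x p0| < d -> beta <= `|b u|.
  rewrite !lt_min => /and3P[ur u1 _]; have xx : `|x p0 - x p0| < r by rewrite subrr normr0.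
  have [_ h] := lipab (x p0) u xx ur.
  have h' : `|b u - b (x p0)| <= beta.
    apply: le_trans h _.
    apply: le_trans (_ : (C + 1) * `|u - x p0| <= _); first by rewrite ler_wpM2r // lerDl.
    by rewrite mulrC -ler_pdivlMr // ltW.
  have : `|b (x p0)| <= `|b u| + `|b u - b (x p0)|.
    by rewrite [`|b u - _|]distrC -[in leLHS](subrK (b u) (b (x p0))) addrC ler_normD.
  have : beta + beta = `|b (x p0)| by rewrite /beta -splitr.
  by lra.
have [s /= s0 near_s] : exists2 s : R, 0 < s & forall p, `|p - p0| < s ->
    `|x p - x p0| < d /\ e (x p) = p 0 1.
  have [s s0 hs] := xr d d0; exists (Num.min s r1); first by rewrite lt_min s0.
  by move=> p; rewrite lt_min => /andP[ps pr]; split; [exact: hs | exact: root].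
have in_r p : `|p - p0| < s -> `|x p - x p0| < r.
  by move=> /near_s[]; rewrite !lt_min => /and3P[].
pose K := 2 * ((1 + C) / beta + 1); have K0 : 0 <= K.
  by rewrite mulr_ge0 // addr_ge0 // divr_ge0 ?addr_ge0 // ltW.
have xle p q : `|x q - x p| <= `|q - p| + `|n q - n p|.
  apply: rv_norm_le; first by rewrite addr_ge0.
    rewrite !mxE /=; apply: le_trans (_ : `|q - p| <= _); last by rewrite lerDl.
    by have := coord_norm_le (q - p) 0; rewrite !mxE.
  by rewrite !mxE /= lerDr.
have main p q : `|p - p0| < s -> `|q - p0| < s ->
    `|b (x p) * (n q - n p) - ((q - p) 0 1 - a (x p) * (q - p) 0 0)| <= C * `|x q - x p| ^+ 2.
  move=> ps qs; have := H1 (x p) (x q) (in_r p ps) (in_r q qs).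
  rewrite (near_s p ps).2 (near_s q qs).2 !mxE /=.
  rewrite (_ : _ - _ - _ = - (b (x p) * (n q - n p) - (q 0 1 - p 0 1 - a (x p) * (q 0 0 - p 0 0)))).
    by rewrite normrN.
  by ring.
have lipn p q : `|p - p0| < s -> `|q - p0| < s -> `|n q - n p| <= K * `|q - p|.
  move=> ps qs; have m1 := main p q ps qs; have m2 := xle p q.
  have [pd _] := near_s p ps; have [qd _] := near_s q qs.
  have b1 := bdb _ pd; have a1 := bda _ (in_r p ps).
  have xd : `|x q - x p| <= beta / (2 * (C + 1)).
    rewrite -[_ - x p](subrKA (x p0)) (le_trans (ler_normD _ _)) // [`|x p0 - _|]distrC.
    have h1 : `|x q - x p0| <= beta / (4 * (C + 1)) by move: qd; rewrite !lt_min => /and3P[_ _ /ltW].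
    have h2 : `|x p - x p0| <= beta / (4 * (C + 1)) by move: pd; rewrite !lt_min => /and3P[_ _ /ltW].
    have -> : beta / (2 * (C + 1)) = beta / (4 * (C + 1)) + beta / (4 * (C + 1)).
      by field; rewrite gt_eqF.
    by clear -h1 h2; lra.
  have q0 : `|(q - p) 0 0| <= `|q - p| by exact: coord_norm_le.
  have q1 : `|(q - p) 0 1| <= `|q - p| by exact: coord_norm_le.
  have t1 : `|b (x p) * (n q - n p)| <= C * `|x q - x p| ^+ 2 + (1 + C) * `|q - p|.
    rewrite -[b (x p) * _](subrK ((q - p) 0 1 - a (x p) * (q - p) 0 0)).
    rewrite (le_trans (ler_normD _ _)) // lerD // (le_trans (ler_normB _ _)) // mulrDl mul1r lerD //.
    by rewrite normrM ler_pM.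
  have t2 : C * `|x q - x p| ^+ 2 <= beta / 2 * `|x q - x p|.
    rewrite expr2 mulrA ler_wpM2r // (le_trans (_ : _ <= (C + 1) * `|x q - x p|)) //.
      by rewrite ler_wpM2r // lerDl.
    rewrite -ler_pdivlMl // (le_trans xd) // le_eqVlt; apply/orP; left; apply/eqP.
    by field; rewrite gt_eqF.
  have t3 : beta * `|n q - n p| <= `|b (x p) * (n q - n p)| by rewrite normrM ler_wpM2r.
  have t4 : beta * `|n q - n p| <= beta / 2 * (`|q - p| + `|n q - n p|) + (1 + C) * `|q - p|.
    apply: le_trans t3 (le_trans t1 _); rewrite lerD2r (le_trans t2) //.
    by rewrite ler_wpM2l // divr_ge0 // ltW.
  have t5 : beta * `|n q - n p| <= beta * (K * `|q - p|).
    have -> : beta * (K * `|q - p|) = 2 * (1 + C) * `|q - p| + 2 * beta * `|q - p|.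
      by rewrite /K; field; rewrite gt_eqF.
    have h : 0 <= beta * `|q - p| by rewrite mulr_ge0 // ltW.
    by clear -t4 h; lra.
  by rewrite -(ler_pM2l beta0).
have lipx p q : `|p - p0| < s -> `|q - p0| < s -> `|x q - x p| <= (1 + K) * `|q - p|.
  by move=> ps qs; rewrite (le_trans (xle p q)) // mulrDl mul1r lerD2l lipn.
have bn p : `|p - p0| < s -> b (x p) != 0.
  move=> /near_s[/bdb h _]; rewrite -normr_gt0; exact: lt_le_trans h.
pose B := C * (1 + K) ^+ 2 / beta + (1 + C) / beta +
  (C * (1 + K) / beta + (1 + C) * (C * (1 + K)) / beta ^+ 2).
have B1 : 0 <= C * (1 + K) ^+ 2 / beta.
  by rewrite divr_ge0 ?mulr_ge0 ?exprn_ge0 ?addr_ge0 // ltW.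
have B2 : 0 <= (1 + C) / beta by rewrite divr_ge0 ?addr_ge0 // ltW.
have B3 : 0 <= C * (1 + K) / beta + (1 + C) * (C * (1 + K)) / beta ^+ 2.
  by rewrite addr_ge0 // divr_ge0 ?mulr_ge0 ?exprn_ge0 ?addr_ge0 // ltW.
have inv p : `|p - p0| < s -> `|(b (x p))^-1| <= beta^-1.
  by move=> ps; rewrite normfV lef_pV2 ?posrE ?normr_gt0 ?bn // bdb //; case: (near_s p ps).
have numb p w : `|p - p0| < s -> `|w 0 1 - a (x p) * w 0 0| <= (1 + C) * `|w|.
  move=> ps; rewrite (le_trans (ler_normB _ _)) // mulrDl mul1r lerD ?coord_norm_le //.
  by rewrite normrM ler_pM ?coord_norm_le // bda // in_r.
have B0 : 0 <= B := addr_ge0 (addr_ge0 B1 B2) B3.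
exists s, B; split=> //.
- move=> p q ps qs; rewrite -/(x p).
  have -> : n q - n p - ((q - p) 0 1 - a (x p) * (q - p) 0 0) / b (x p) =
      (b (x p) * (n q - n p) - ((q - p) 0 1 - a (x p) * (q - p) 0 0)) / b (x p).
    by field; exact: bn.
  rewrite normrM; apply: le_trans (_ : C * (1 + K) ^+ 2 / beta * `|q - p| ^+ 2 <= _); last first.
    by rewrite ler_wpM2r ?exprn_ge0 // /B -addrA lerDl (addr_ge0 B2 B3).
  apply: le_trans (_ : (C * ((1 + K) * `|q - p|) ^+ 2) * beta^-1 <= _); last first.
    by rewrite exprMn; apply: eq_leR; ring.
  apply: ler_pM => //; last exact: inv.
  apply: le_trans (main p q ps qs) _; rewrite ler_wpM2l // ler_pXn2r ?nnegrE ?mulr_ge0 ?addr_ge0 //.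
  exact: lipx.
- move=> p q w ps qs; rewrite -/(x p) -/(x q).
  have -> : (w 0 1 - a (x q) * w 0 0) / b (x q) - (w 0 1 - a (x p) * w 0 0) / b (x p) =
      - ((a (x q) - a (x p)) * w 0 0 * (b (x q))^-1) -
      (w 0 1 - a (x p) * w 0 0) * (b (x q) - b (x p)) * ((b (x q))^-1 * (b (x p))^-1).
    by field; rewrite !bn.
  have [la lb] := lipab _ _ (in_r p ps) (in_r q qs).
  have lx : C * `|x q - x p| <= C * ((1 + K) * `|q - p|) by rewrite ler_wpM2l // lipx.
  apply: le_trans (ler_normB _ _) _; rewrite normrN.
  apply: le_trans (_ : (C * (1 + K) / beta + (1 + C) * (C * (1 + K)) / beta ^+ 2) *
      `|q - p| * `|w| <= _); last by rewrite ler_wpM2r // ler_wpM2r // lerDr (addr_ge0 B1 B2).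
  rewrite [X in _ <= X * _]mulrDl [leRHS]mulrDl; apply: lerD.
    apply: le_trans (_ : (C * ((1 + K) * `|q - p|)) * `|w| * beta^-1 <= _); last by apply: eq_leR; ring.
    rewrite !normrM; apply: ler_pM => //; last exact: inv.
    by apply: ler_pM => //; [exact: le_trans la lx | exact: coord_norm_le].
  apply: le_trans (_ : ((1 + C) * `|w|) * (C * ((1 + K) * `|q - p|)) * (beta^-1 * beta^-1) <= _); last first.
    by apply: eq_leR; rewrite -exprVn; ring.
  rewrite !normrM; apply: ler_pM => //; last by apply: ler_pM => //; exact: inv.
  by apply: ler_pM => //; [exact: numb | exact: le_trans lb lx].
- move=> p w ps; rewrite -/(x p) normrM.
  apply: le_trans (_ : (1 + C) / beta * `|w| <= _).
    apply: le_trans (_ : ((1 + C) * `|w|) * beta^-1 <= _); last by apply: eq_leR; ring.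
    by apply: ler_pM => //; [exact: numb | exact: inv].
  by rewrite ler_wpM2r // /B [_ + _ / beta]addrC -addrA lerDl (addr_ge0 B1 B3).
Qed.

End Plane.

(** * Differentiability of the billiard map and of its inverse *)

Section CylinderSystem.
Context {R : realType}.
Notation V := ('rV[R]_2 : normedModType R).
Implicit Types (p q v w : 'rV[R]_2) (P : set 'rV[R]_2) (f g : 'rV[R]_2 -> 'rV[R]_2).

(** [Df] is the derivative of [f] in the sense of [C11]; the last two fields say that
    [f] descends to the cylinder. *)
Record flow P f (Df : 'rV[R]_2 -> 'rV[R]_2 -> 'rV[R]_2) : Prop := Flow {
  flow_in : forall p, P p -> P (f p);
  flow_C11 : forall p, P p -> @C11 R V V f Df p;
  flow_area : forall p v w, P p -> det2 (Df p v) (Df p w) = det2 v w;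
  flow_shift : forall p (j : int), P p -> f (p + cyl_shift j) = f p + cyl_shift j;
  flow_Dshift : forall p (j : int) v, P p -> Df (p + cyl_shift j) v = Df p v }.

(** Time reversal exchanges [f] and [g], so everything proved for stable manifolds of
    systems also holds for unstable ones. *)
Record system P f g Df Dg : Prop := System {
  sys_fwd : flow P f Df;
  sys_bwd : flow P g Dg;
  sys_open : forall p, P p -> exists2 r : R, 0 < r & forall q, `|q - p| < r -> P q;
  sys_shift : forall p (j : int), P p -> P (p + cyl_shift j);
  sys_fK : forall p, P p -> g (f p) = p;
  sys_gK : forall p, P p -> f (g p) = p;
  sys_DfK : forall p v, P p -> Dg (f p) (Df p v) = v;
  sys_DgK : forall p v, P p -> Df (g p) (Dg p v) = v }.

Lemma system_inv P f g Df Dg : system P f g Df Dg -> system P g f Dg Df.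
Proof. by case. Qed.

Lemma cyl_shiftD (i j : int) : cyl_shift i + cyl_shift j = cyl_shift (i + j) :> 'rV[R]_2.
Proof.
apply: vec2P; rewrite /cyl_shift !mxE /=.
  by rewrite -mulrDr -rmorphD.
by rewrite addr0.
Qed.

Lemma cyl_shift0 : cyl_shift 0 = 0 :> 'rV[R]_2.
Proof. by apply: vec2P; rewrite /cyl_shift !mxE /= ?mulr0. Qed.

Lemma cyl_shiftN (j : int) : cyl_shift (- j) = - cyl_shift j :> 'rV[R]_2.
Proof. by apply/eqP; rewrite -subr_eq0 opprK cyl_shiftD addNr cyl_shift0. Qed.

End CylinderSystem.

Section BilliardSystem.
Context {R : realType}.
Context (gamma : R -> 'rV[R]_2) (th : R -> R) (cc : convex_curve gamma th).
Context (O : 'rV[R]_2).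
Implicit Types (a b c t u : R) (p q v w : 'rV[R]_2).

Notation V := ('rV[R]_2 : normedModType R).
Notation star := (star gamma).
Notation E := (ss gamma O).
Notation P := (phase_space gamma O).
Notation sg := (cc_smooth cc).

Definition dss a b : R := - det2 (derive1 (derive1 gamma) a) (gamma b - O).

Lemma ss_C11 (x : 'rV[R]_2) : @C11 R V R (fun x => E (x 0 0) (x 0 1))
  (fun x w => dss (x 0 0) (x 0 1) * w 0 0 + (- dd gamma (x 0 0) (x 0 1)) * w 0 1) x.
Proof.
have s1 := smooth_derive1 sg.
have c1 i : C11 (fun x : V => derive1 gamma (x 0 0) 0 i)
    (fun (x : V) (w : V) => derive1 (derive1 gamma) (x 0 0) 0 i * w 0 0) x.
  have := C11_comp (C11_coord 0 x) (C11_smooth (x 0 0) (@smooth_coord _ _ i s1)).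
  by rewrite derive1_coordE.
have c2 i : C11 (fun x : V => gamma (x 0 1) 0 i - O 0 i)
    (fun (x : V) (w : V) => derive1 gamma (x 0 1) 0 i * w 0 1 + 0) x.
  have := C11_comp (C11_coord 1 x) (C11_smooth (x 0 1) (@smooth_coord _ _ i sg)).
  rewrite derive1_coordE; last exact: sg.
  by move=> h; apply: (C11_add h); exact: (@C11_cst R V R).
have := C11_add (C11_mul (c1 1) (c2 0)) (C11_mul (@C11_cst R V R (-1) x) (C11_mul (c1 0) (c2 1))).
rewrite (_ : (fun p : V => _ + -1 * _) = (fun x : V => E (x 0 0) (x 0 1))); last first.
  by apply/funext => y; rewrite ssE mulN1r.
move/C11_eq; apply => y w; rewrite /dss /dd !det2E !mxE.
move: (derive1 gamma) (derive1 (derive1 gamma)) => g1 g2.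
move: (y 0 0) (y 0 1) (w 0 0) (w 0 1) => y0 y1 w0 w1.
move: (g1 y0 0 0) (g1 y0 0 1) (g2 y0 0 0) (g2 y0 0 1) (g1 y1 0 0) (g1 y1 0 1) => A1 A2 A3 A4 A5 A6.
by move: (gamma y1 0 0) (gamma y1 0 1) (O 0 0) (O 0 1) => A7 A8 A9 A10; ring.
Qed.

Lemma C11_gt0 (f : 'rV[R]_2 -> R) D p0 : @C11 R V R f D p0 -> 0 < f p0 ->
  exists2 r : R, 0 < r & forall p, `|p - p0| < r -> 0 < f p.
Proof.
move=> /C11_lip[r [K [r0 K0 H]]] f0.
exists (Num.min r (f p0 / (K + 1))).
  by rewrite lt_min r0 divr_gt0 // ltr_wpDl.
move=> p; rewrite lt_min => /andP[pr pf].
have h : `|f p - f p0| < f p0.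
  apply: le_lt_trans (H p0 p _ pr) _; first by rewrite subrr normr0.
  apply: le_lt_trans (_ : (K + 1) * `|p - p0| < _); first by rewrite ler_wpM2r // lerDl.
  by rewrite -ltr_pdivlMl ?ltr_wpDl // mulrC.
by move: h; rewrite ltr_distl => /andP[h _]; move: h; rewrite subrr.
Qed.

Lemma ss_at_C11 c (x : 'rV[R]_2) : exists D, @C11 R V R (fun p => E (p 0 0) c - p 0 1) D x.
Proof.
have h1 := C11_comp (C11_pair (C11_coord 0 x) (@C11_cst R V R c x)) (ss_C11 (pair2 (x 0 0) c)).
have h2 := C11_add h1 (C11_mul (@C11_cst R V R (-1) x) (C11_coord 1 x)).
eexists; apply: C11_local h2 _; near=> p.
by rewrite pair2_0 pair2_1 mulN1r.
Unshelve. all: by end_near. Qed.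

(** The strictly monotone function [E (p0 0 0)] changes sign at the root; the sign
    change persists for [p] near [p0], and uniqueness between the moving bounds
    identifies the root that it produces with [n p]. *)
Lemma root_near (n : 'rV[R]_2 -> R) (lo hi : R -> R) p0 :
    continuous lo -> continuous hi ->
    lo (p0 0 0) < n p0 < hi (p0 0 0) -> E (p0 0 0) (n p0) = p0 0 1 ->
    dd gamma (p0 0 0) (n p0) != 0 ->
    (forall p u, lo (p 0 0) < u < hi (p 0 0) -> E (p 0 0) u = p 0 1 -> n p = u) ->
  forall d : R, 0 < d -> exists2 r : R, 0 < r & forall p, `|p - p0| < r ->
    [/\ `|n p - n p0| < d, E (p 0 0) (n p) = p 0 1 & lo (p 0 0) < n p < hi (p 0 0)].
Proof.
move=> clo chi /andP[lon nhi] rn dn uni d d0.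
set t0 := p0 0 0 in lon nhi rn dn; set u0 := n p0 in lon nhi rn dn.
have [s s0 hs] : exists2 s : R, 0 < s & forall u, `|u - u0| < s ->
    (u0 < u -> (E t0 u - p0 0 1) * - dd gamma t0 u0 > 0) /\
    (u < u0 -> (E t0 u - p0 0 1) * - dd gamma t0 u0 < 0).
  have [dp|dp|e] := ltgtP (- dd gamma t0 u0) 0; last first.
  - by move/eqP: e; rewrite oppr_eq0 (negbTE dn).
  - have dE : is_derive u0 1 (fun u => - E t0 u) (- - dd gamma t0 u0).
      by have h := ss_derive2 cc O t0 u0; exact: is_deriveN.
    have [|s s0 hs] := derive_lt0_local dE; first by rewrite oppr_lt0.
    exists s => // u /hs[h1 h2]; split=> [/h1|/h2]; rewrite ltrN2 rn => h.
      by rewrite mulr_gt0 // subr_gt0.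
    by rewrite pmulr_llt0 // subr_lt0.
  - have [s s0 hs] := derive_lt0_local (ss_derive2 cc O t0 u0) dp.
    exists s => // u /hs[h1 h2]; split=> [/h1|/h2]; rewrite rn => h.
      by rewrite nmulr_lgt0 // subr_lt0.
    by rewrite nmulr_llt0 // subr_gt0.
pose m := Num.min (Num.min s d) (Num.min (u0 - lo t0) (hi t0 - u0)) / 2.
have m0 : 0 < m by rewrite divr_gt0 // !lt_min s0 d0 !subr_gt0 lon.
have [ms md ml mh] : [/\ m < s, m < d, m < u0 - lo t0 & m < hi t0 - u0].
  have : m < Num.min (Num.min s d) (Num.min (u0 - lo t0) (hi t0 - u0)).
    by rewrite /m ltr_pdivrMr // ltr_pMr ?ltr1n // -(ltr_pM2r (x := 2^-1)) // mul0r -/m.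
  by rewrite !lt_min => /andP[/andP[-> ->] /andP[-> ->]].
have loE : lo t0 < u0 - m by lra.
have hiE : u0 + m < hi t0 by lra.
have [r1 r10 h1] := cont_lt (clo t0) loE.
have [r2 r20 h2] := cont_gt (chi t0) hiE.
pose k := - dd gamma t0 u0.
have sgn c : 0 < (E t0 c - p0 0 1) * k -> exists2 r : R, 0 < r & forall p, `|p - p0| < r ->
    0 < (E (p 0 0) c - p 0 1) * k.
  move=> h; have [D cD] := ss_at_C11 c p0.
  have := C11_mul cD (@C11_cst R V R k p0); move/C11_gt0 => /(_ h)[r r0 hr].
  by exists r.
have sgn' c : (E t0 c - p0 0 1) * k < 0 -> exists2 r : R, 0 < r & forall p, `|p - p0| < r ->
    (E (p 0 0) c - p 0 1) * k < 0.
  move=> h; have [D cD] := ss_at_C11 c p0.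
  have := C11_mul cD (@C11_cst R V R (- k) p0); move/C11_gt0.
  rewrite mulrN oppr_gt0 => /(_ h)[r r0 hr]; exists r => // p /hr.
  by rewrite mulrN oppr_gt0.
have [r3 r30 h3] : exists2 r : R, 0 < r & forall p, `|p - p0| < r ->
    0 < (E (p 0 0) (u0 + m) - p 0 1) * k.
  apply: sgn; have [|+ _] := hs (u0 + m); first by rewrite addrAC subrr add0r gtr0_norm.
  by apply; lra.
have [r4 r40 h4] : exists2 r : R, 0 < r & forall p, `|p - p0| < r ->
    (E (p 0 0) (u0 - m) - p 0 1) * k < 0.
  apply: sgn'; have [|_ +] := hs (u0 - m); first by rewrite addrAC subrr add0r normrN gtr0_norm.
  by apply; lra.
exists (Num.min (Num.min r1 r2) (Num.min r3 r4)); first by rewrite !lt_min r10 r20 r30.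
move=> p; rewrite !lt_min => /andP[/andP[p1 p2] /andP[p3 p4]].
have tp : `|p 0 0 - t0| <= `|p - p0| by have := coord_norm_le (p - p0) 0; rewrite !mxE.
have l1 := h1 _ (le_lt_trans tp p1); have l2 := h2 _ (le_lt_trans tp p2).
have l3 := h3 p p3; have l4 := h4 p p4.
have um : u0 - m <= u0 + m by clear -m0; lra.
have [u /andP[u1 u2] uE] : exists2 u, u0 - m <= u <= u0 + m & E (p 0 0) u = p 0 1.
  have cE := @ss_cont R gamma th cc O (p 0 0).
  have [k0|k0|k0] := ltgtP k 0.
  - apply: (IVT_ge cE um); apply/andP; split; apply: ltW.
      by rewrite -subr_lt0; move: l3; rewrite nmulr_lgt0.
    by rewrite -subr_gt0; move: l4; rewrite nmulr_llt0.
  - apply: (IVT_le cE um); apply/andP; split; apply: ltW.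
      by rewrite -subr_lt0; move: l4; rewrite pmulr_llt0.
    by rewrite -subr_gt0; move: l3; rewrite pmulr_lgt0.
  - by move: l3; rewrite k0 mulr0 ltxx.
have ub : lo (p 0 0) < u < hi (p 0 0) by clear -u1 u2 l1 l2; apply/andP; split; lra.
rewrite (uni p u ub uE); split=> //.
by rewrite -/u0 ltr_distl; clear -u1 u2 md; apply/andP; split; lra.
Qed.

(** The common form of the derivatives of the map and of its inverse, which differ
    by the root [n]. *)
Definition Droot (n : 'rV[R]_2 -> R) p w : R :=
  (w 0 1 - dss (p 0 0) (n p) * w 0 0) / (- dd gamma (p 0 0) (n p)).

Definition Dbounce (n : 'rV[R]_2 -> R) p w : 'rV[R]_2 :=
  pair2 (Droot n p w) (dss (n p) (p 0 0) * Droot n p w - dd gamma (n p) (p 0 0) * w 0 0).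

Lemma bounce_C11 (n : 'rV[R]_2 -> R) p0 : dd gamma (p0 0 0) (n p0) != 0 ->
  (forall d : R, 0 < d -> exists2 r : R, 0 < r & forall p, `|p - p0| < r ->
    `|n p - n p0| < d /\ E (p 0 0) (n p) = p 0 1) ->
  @C11 R V V (fun p => bounce gamma O (n p) (p 0 0)) (Dbounce n) p0.
Proof.
move=> dn nn; have cn : @C11 R V R n (Droot n) p0.
  have := C11_implicit (n := n) (p0 := p0) (ss_C11 (pair2 (p0 0 0) (n p0))).
  rewrite !pair2_0 !pair2_1 oppr_eq0 => /(_ dn) H.
  have n1 (d : R) : 0 < d -> exists2 r : R, 0 < r &
      forall p, `|p - p0| < r -> `|n p - n p0| < d.
    by move=> d0; have [r r0 hr] := nn d d0; exists r => // p /hr[].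
  have n2 : exists2 r : R, 0 < r & forall p, `|p - p0| < r ->
      E (pair2 (p 0 0) (n p) 0 0) (pair2 (p 0 0) (n p) 0 1) = p 0 1.
    have [r r0 hr] := nn 1 ltr01; exists r => // p /hr[_ <-].
    by rewrite pair2_0 pair2_1.
  by apply: C11_eq (H n1 n2) _ => p w; rewrite !pair2_0 !pair2_1.
have h := C11_comp (C11_pair cn (C11_coord 0 p0)) (ss_C11 (pair2 (n p0) (p0 0 0))).
have := C11_pair cn h.
rewrite (_ : (fun p : V => pair2 (n p) _) = (fun p => bounce gamma O (n p) (p 0 0))); last first.
  by apply/funext => p; rewrite pair2_0 pair2_1.
move/C11_eq; apply=> p w; rewrite /Dbounce; congr pair2.
by rewrite /= !mxE /= [- dd _ _ _ * _]mulNr.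
Qed.

Lemma ddC a b : dd gamma a b = - dd gamma b a.
Proof. exact: det2C. Qed.

Lemma Dbounce_area n p v w : dd gamma (p 0 0) (n p) != 0 ->
  det2 (Dbounce n p v) (Dbounce n p w) = det2 v w.
Proof.
move=> dn; rewrite !det2E /Dbounce !pair2_0 !pair2_1 /Droot [dd gamma (n p) _]ddC.
move: (dd gamma (p 0 0) (n p)) dn (dss (p 0 0) (n p)) (dss (n p) (p 0 0)) => D D0 A B.
by move: (v 0 0) (v 0 1) (w 0 0) (w 0 1) => v0 v1 w0 w1; field.
Qed.

Lemma DbounceK n m p w : dd gamma (p 0 0) (n p) != 0 ->
  m (bounce gamma O (n p) (p 0 0)) = p 0 0 ->
  Dbounce m (bounce gamma O (n p) (p 0 0)) (Dbounce n p w) = w.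
Proof.
move=> dn mE.
have E0 : Droot m (bounce gamma O (n p) (p 0 0)) (Dbounce n p w) = w 0 0.
  rewrite /Droot mE !pair2_0 !pair2_1 [dd gamma (n p) _]ddC.
  move: (dd gamma (p 0 0) (n p)) dn (Droot n p w) (dss (n p) (p 0 0)) (w 0 0) => D D0 A B C.
  by field.
apply: vec2P; rewrite /Dbounce ?pair2_0 ?pair2_1 E0 //.
rewrite mE /Droot.
move: (dd gamma (p 0 0) (n p)) dn (dss (p 0 0) (n p)) (w 0 0) (w 0 1) => D D0 A C F.
by field.
Qed.

Definition prev_param p : R :=
  get [set u | star (p 0 0) - 2 * pi < u < p 0 0 /\ p 0 1 = E (p 0 0) u].

Lemma prev_paramE a b : adj gamma a b -> prev_param (bounce gamma O b a) = a.
Proof.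
move=> ab; rewrite /prev_param pair2_0 pair2_1; apply: get_unique.
  by split; [exact/(adj_star_prev cc) | ].
move=> c [/(adj_star_prev cc) cb] e; exact: adj_prev_inj cc O _ _ _ cb ab (esym e).
Qed.

Lemma adj_shift a b (j : int) :
  adj gamma (a + 2 * pi * j%:~R) (b + 2 * pi * j%:~R) <-> adj gamma a b.
Proof.
rewrite !(adjE cc) !(th_turnz cc).
by split=> /andP[h1 h2]; apply/andP; split; lra.
Qed.

Lemma dd_shift a b (i j : int) :
  dd gamma (a + 2 * pi * i%:~R) (b + 2 * pi * j%:~R) = dd gamma a b.
Proof.
have p1 := derive1_periodic (cc_periodic cc).
by rewrite /dd !(periodicz p1).
Qed.

Lemma ss_shift a b (i j : int) : E (a + 2 * pi * i%:~R) (b + 2 * pi * j%:~R) = E a b.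
Proof.
have p1 := derive1_periodic (cc_periodic cc).
by rewrite /ss !(periodicz p1) (periodicz (cc_periodic cc)).
Qed.

Lemma dss_shift a b (i j : int) : dss (a + 2 * pi * i%:~R) (b + 2 * pi * j%:~R) = dss a b.
Proof.
have p2 := derive1_periodic (derive1_periodic (cc_periodic cc)).
by rewrite /dss !(periodicz p2) (periodicz (cc_periodic cc)).
Qed.

Lemma bounce_shift a b (j : int) :
  bounce gamma O (a + 2 * pi * j%:~R) (b + 2 * pi * j%:~R) = bounce gamma O a b + cyl_shift j.
Proof.
by apply: vec2P; rewrite /bounce /cyl_shift !mxE /= ?ss_shift ?addr0.
Qed.

Lemma phase_coord p (j : int) : (p + cyl_shift j) 0 0 = p 0 0 + 2 * pi * j%:~R.
Proof. by rewrite /cyl_shift !mxE. Qed.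

Lemma phase_shift p (j : int) : P p -> P (p + cyl_shift j).
Proof.
move=> /(phase_next cc)[b ab ->]; rewrite -bounce_shift.
by apply: (adj_phase cc); apply/adj_shift.
Qed.

Lemma Dbounce_shift n p w (j : int) : n (p + cyl_shift j) = n p + 2 * pi * j%:~R ->
  Dbounce n (p + cyl_shift j) w = Dbounce n p w.
Proof.
move=> nE; have rE : Droot n (p + cyl_shift j) w = Droot n p w.
  by rewrite /Droot phase_coord nE dss_shift dd_shift.
by rewrite /Dbounce rE phase_coord nE dss_shift dd_shift.
Qed.

Definition Dmap := Dbounce (next_param gamma O).
Definition Dinv := Dbounce prev_param.

Lemma next_near p0 : P p0 -> forall d : R, 0 < d -> exists2 r : R, 0 < r &
  forall p, `|p - p0| < r -> [/\ `|next_param gamma O p - next_param gamma O p0| < d,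
    E (p 0 0) (next_param gamma O p) = p 0 1 & adj gamma (p 0 0) (next_param gamma O p)].
Proof.
move=> Pp d d0; have [b ab pE] := phase_next cc Pp.
have nE : next_param gamma O p0 = b by rewrite pE (next_paramE cc).
have bE : E (p0 0 0) b = p0 0 1 by rewrite [in RHS]pE pair2_1.
have /(adj_star cc) lh := ab.
have cid : continuous (fun t : R => t) by move=> t; exact: cvg_id.
have nlh : p0 0 0 < next_param gamma O p0 < star (p0 0 0) by rewrite nE.
have nE' : E (p0 0 0) (next_param gamma O p0) = p0 0 1 by rewrite nE.
have nd : dd gamma (p0 0 0) (next_param gamma O p0) != 0.
  by rewrite nE; case: ab => _ /lt0r_neq0.
have [|r r0 hr] := root_near cid (star_cont cc) nlh nE' nd _ d0.
  move=> p u /(adj_star cc) pu uE.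
  have -> : p = bounce gamma O (p 0 0) u by apply: vec2P; rewrite ?pair2_0 ?pair2_1.
  exact: (next_paramE cc O pu).
exists r; first exact: r0.
by move=> p /hr[h1 h2 h3]; split; [exact: h1 | exact: h2 | exact/(adj_star cc)].
Qed.

Lemma prev_near p0 : P p0 -> forall d : R, 0 < d -> exists2 r : R, 0 < r &
  forall p, `|p - p0| < r -> [/\ `|prev_param p - prev_param p0| < d,
    E (p 0 0) (prev_param p) = p 0 1 & adj gamma (prev_param p) (p 0 0)].
Proof.
move=> Pp d d0; have [b ab pE] := phase_prev cc Pp.
have nE : prev_param p0 = b by rewrite pE prev_paramE.
have bE : E (p0 0 0) b = p0 0 1 by rewrite [in RHS]pE pair2_1.
have /(adj_star_prev cc) lh := ab.
have clo : continuous (fun t => star t - 2 * pi).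
  move=> t; apply: continuousB; last exact: cst_continuous.
  exact: star_cont cc t.
have cid : continuous (fun t : R => t) by move=> t; exact: cvg_id.
have nlh : star (p0 0 0) - 2 * pi < prev_param p0 < p0 0 0 by rewrite nE.
have nE' : E (p0 0 0) (prev_param p0) = p0 0 1 by rewrite nE.
have nd : dd gamma (p0 0 0) (prev_param p0) != 0.
  by rewrite nE ddC oppr_eq0; case: ab => _ /lt0r_neq0.
have [|r r0 hr] := root_near clo cid nlh nE' nd _ d0.
  move=> p u /(adj_star_prev cc) pu uE.
  have -> : p = bounce gamma O (p 0 0) u by apply: vec2P; rewrite ?pair2_0 ?pair2_1.
  exact: prev_paramE pu.
exists r; first exact: r0.
by move=> p /hr[h1 h2 h3]; split; [exact: h1 | exact: h2 | exact/(adj_star_prev cc)].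
Qed.

Lemma billiard_map_rootE p : billiard_map gamma O p =
  bounce gamma O (next_param gamma O p) (p 0 0).
Proof. by rewrite /billiard_map (L2ss cc). Qed.

Lemma billiard_inv_rootE p : P p -> billiard_inv gamma O p = bounce gamma O (prev_param p) (p 0 0).
Proof.
by move=> /(phase_prev cc)[b ab ->]; rewrite (billiard_invE cc O ab) (prev_paramE ab) pair2_0.
Qed.

Lemma phase_open p0 : P p0 -> exists2 r : R, 0 < r & forall p, `|p - p0| < r -> P p.
Proof.
move=> Pp; have [r r0 hr] := next_near Pp ltr01; exists r; first exact: r0.
move=> p /hr[_ pE ap]; have -> : p = bounce gamma O (p 0 0) (next_param gamma O p).
  by apply: vec2P; rewrite ?pair2_0 ?pair2_1.
exact: (adj_phase cc).
Qed.

(** Both the map and its inverse send [p] to [bounce (n p) (p 0 0)] for a root [n p] of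
    the equation [ss (p 0 0) (n p) = p 0 1], so they are differentiable by the
    implicit function theorem. *)
Lemma billiard_system :
  system P (billiard_map gamma O) (billiard_inv gamma O) Dmap Dinv.
Proof.
have dnext p : P p -> dd gamma (p 0 0) (next_param gamma O p) != 0.
  by move=> Pp; have [r r0 /(_ p)] := next_near Pp ltr01;
    rewrite subrr normr0 => /(_ r0)[_ _ [_ /lt0r_neq0]].
have dprev p : P p -> dd gamma (p 0 0) (prev_param p) != 0.
  by move=> Pp; have [r r0 /(_ p)] := prev_near Pp ltr01;
    rewrite subrr normr0 => /(_ r0)[_ _ [_ /lt0r_neq0]]; rewrite ddC oppr_eq0.
have next_shift p (j : int) : P p -> next_param gamma O (p + cyl_shift j) =
    next_param gamma O p + 2 * pi * j%:~R.
  move=> /(phase_next cc)[b ab ->]; rewrite -bounce_shift (next_paramE cc O ab).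
  exact: (next_paramE cc O ((adj_shift _ _ _).2 ab)).
have prev_shift p (j : int) : P p -> prev_param (p + cyl_shift j) =
    prev_param p + 2 * pi * j%:~R.
  move=> /(phase_prev cc)[b ab ->]; rewrite -bounce_shift (prev_paramE ab).
  exact: (prev_paramE ((adj_shift _ _ _).2 ab)).
split; [split|split| | | | | |].
- by move=> p; exact: (billiard_map_phase cc).
- move=> p Pp; rewrite (_ : billiard_map gamma O =
      fun p => bounce gamma O (next_param gamma O p) (p 0 0)); last first.
    by apply/funext => q; exact: billiard_map_rootE.
  apply: bounce_C11; first exact: dnext.
  move=> d d0; have [r r0 hr] := next_near Pp d0; exists r; first exact: r0.
  by move=> q /hr[].
- by move=> p v w Pp; apply: Dbounce_area; exact: dnext.
- move=> p j /(phase_next cc)[b ab ->]; rewrite -bounce_shift (billiard_mapE cc O ab).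
  by rewrite (billiard_mapE cc O ((adj_shift _ _ _).2 ab)) bounce_shift.
- by move=> p j v Pp; apply: Dbounce_shift; exact: next_shift.
- by move=> p; exact: (billiard_inv_phase cc).
- move=> p Pp; apply: (@C11_local R V V (fun p => bounce gamma O (prev_param p) (p 0 0))).
    apply: bounce_C11; first exact: dprev.
    move=> d d0; have [r r0 hr] := prev_near Pp d0; exists r; first exact: r0.
    by move=> q /hr[].
  have [r r0 hr] := phase_open Pp; apply/nbhs_ballP; exists r; first exact: r0.
  move=> q /=.
  by rewrite -ball_normE /= distrC => /hr/billiard_inv_rootE.
- by move=> p v w Pp; apply: Dbounce_area; exact: dprev.
- move=> p j /(phase_prev cc)[b ab ->]; rewrite -bounce_shift (billiard_invE cc O ab).
  by rewrite (billiard_invE cc O ((adj_shift _ _ _).2 ab)) bounce_shift.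
- by move=> p j v Pp; apply: Dbounce_shift; exact: prev_shift.
- exact: phase_open.
- exact: phase_shift.
- by move=> p; exact: (billiard_mapK cc).
- by move=> p; exact: (billiard_invK cc).
- move=> p v Pp; rewrite billiard_map_rootE; apply: DbounceK; first exact: dnext.
  have [b ab pE] := phase_next cc Pp.
  have -> : next_param gamma O p = b by rewrite pE (next_paramE cc O ab).
  exact: prev_paramE ab.
- move=> p v Pp; rewrite (billiard_inv_rootE Pp); apply: DbounceK; first exact: dprev.
  have [b ab pE] := phase_prev cc Pp.
  have -> : prev_param p = b by rewrite pE (prev_paramE ab).
  exact: (next_paramE cc O ab).
Qed.

End BilliardSystem.

(** * Local stable curves *)

Section Geometric.
Context {R : realType}.
Implicit Types (x y c q A e : R) (m : nat).

Lemma geometric_small c q e : 0 <= q -> q < 1 -> 0 < e -> exists m, c * q ^+ m < e.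
Proof.
move=> q0 q1 e0; have q1' : `|q| < 1 by rewrite ger0_norm.
have C0 : 0 < `|c| + 1 by rewrite ltr_wpDl.
have /cvgrPdist_lt/(_ (e / (`|c| + 1))) := cvg_expr q1'.
rewrite divr_gt0 // => /(_ isT)[m _ /(_ m (leqnn m))] /=.
rewrite sub0r normrN ger0_norm ?exprn_ge0 // ltr_pdivlMr // => h.
exists m; apply: le_lt_trans h; rewrite mulrC ler_wpM2l ?exprn_ge0 //.
by rewrite (le_trans (ler_norm c)) // lerDl.
Qed.

Lemma geometric_le c q x y : 0 <= q -> q < 1 -> (forall m, x <= y + c * q ^+ m) -> x <= y.
Proof.
move=> q0 q1 h; rewrite leNgt; apply/negP => xy.
have xy0 : 0 < x - y by rewrite subr_gt0.
by have [m hm] := geometric_small c q0 q1 xy0; have := h m; lra.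
Qed.

Lemma geometric_limit_real (s : nat -> R) A q : 0 <= A -> 0 <= q -> q < 1 ->
  (forall m, `|s m.+1 - s m| <= A * q ^+ m) ->
  exists l : R, forall m, `|l - s m| <= A / (1 - q) * q ^+ m.
Proof.
move=> A0 q0 q1 hs; pose c m := A / (1 - q) * q ^+ m.
have q2 : 0 < 1 - q by rewrite subr_gt0.
have cS m : c m.+1 + A * q ^+ m = c m.
  by rewrite /c exprS; field; rewrite gt_eqF.
have lo m : s m - c m <= s m.+1 - c m.+1.
  by have := hs m; rewrite ler_distl => /andP[h _]; have := cS m; lra.
have hi m : s m.+1 + c m.+1 <= s m + c m.
  by have := hs m; rewrite ler_distl => /andP[_ h]; have := cS m; lra.
have c0 m : 0 <= c m by rewrite /c mulr_ge0 ?exprn_ge0 // divr_ge0 // ltW.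
have lo' m k : s m - c m <= s (m + k)%N - c (m + k)%N.
  by elim: k => [|k IH]; rewrite ?addn0 // addnS (le_trans IH).
have hi' m k : s (m + k)%N + c (m + k)%N <= s m + c m.
  by elim: k => [|k IH]; rewrite ?addn0 // addnS (le_trans _ IH).
have lohi j m : s j - c j <= s m + c m.
  by have := lo' j m; have := hi' m j; rewrite [(m + j)%N]addnC; have := c0 (j + m)%N; lra.
pose S := [set s m - c m | m in [set: nat]].
have hS : has_sup S.
  by split; [exists (s 0 - c 0); exists 0 | exists (s 0 + c 0) => _ [j _ <-]; exact: lohi].
exists (sup S) => m; rewrite ler_distl; apply/andP; split.
  by apply: (sup_ubound hS.2); exists m.
by apply: ge_sup; [exact: hS.1 | move=> _ [j _ <-]; exact: lohi].
Qed.

Lemma geometric_limit (s : nat -> 'rV[R]_2) A q : 0 <= A -> 0 <= q -> q < 1 ->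
  (forall m, `|s m.+1 - s m| <= A * q ^+ m) ->
  exists l : 'rV[R]_2, forall m, `|l - s m| <= A / (1 - q) * q ^+ m.
Proof.
move=> A0 q0 q1 hs.
have co i : exists l : R, forall m, `|l - s m 0 i| <= A / (1 - q) * q ^+ m.
  apply: geometric_limit_real => // m; apply: le_trans (hs m).
  by have := coord_norm_le (s m.+1 - s m) i; rewrite !mxE.
have [l0 h0] := co 0; have [l1 h1] := co 1; exists (pair2 l0 l1) => m.
apply: rv_norm_le; rewrite ?mxE /= ?mxE //.
by rewrite mulr_ge0 ?exprn_ge0 // divr_ge0 // subr_ge0 ltW.
Qed.

End Geometric.

Section LocalCurve.
Context {R : realType}.
Notation V := ('rV[R]_2 : normedModType R).
Implicit Types (u d : R) (p q w : 'rV[R]_2).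

Lemma diag_norm_le (a b : R) w : `|b| <= `|a| ->
  `|pair2 (a * w 0 0) (b * w 0 1)| <= `|a| * `|w|.
Proof.
move=> ba; apply: rv_norm_le; first by rewrite mulr_ge0.
  by rewrite pair2_0 normrM ler_wpM2l // coord_norm_le.
by rewrite pair2_1 normrM ler_pM // coord_norm_le.
Qed.

(** Poincare's parametrization of the expanding curve of [G] by the linear map of
    multiplier [lam^-1], as the limit of [u |-> G^m (lam^m u, 0)].  The quadratic
    remainders of these curves are bounded uniformly in [m], which makes the limit
    a curve of class C1 with a Lipschitz derivative. *)
Lemma stable_curve_local (G : 'rV[R]_2 -> 'rV[R]_2) DG (lam : R) :
    @C11 R V V G DG 0 -> G 0 = 0 -> 0 < `|lam| < 1 ->
    (forall w, DG 0 w = pair2 (lam^-1 * w 0 0) (lam * w 0 1)) ->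
  exists (rho K : R) (phi psi : R -> 'rV[R]_2),
    [/\ 0 < rho /\ 0 <= K, phi 0 = 0, psi 0 = pair2 1 0,
      forall u u', `|u| <= rho -> `|u'| <= rho ->
        `|phi u' - phi u - (u' - u) *: psi u| <= K * (u' - u) ^+ 2 &
      forall u, `|u| <= rho -> phi u = G (phi (lam * u))].
Proof.
move=> cG G0 /andP[l0 l1] D0; have [addD scaleD] := C11_lin cG.
have [_ [r [C' [r0 C'0 H1' H2' _]]]] := cG.
pose C := C' + 1; have C0 : 0 < C by rewrite ltr_wpDl.
have CC : C' <= C by rewrite lerDl.
have H1 p q : `|p| < r -> `|q| < r -> `|G q - G p - DG p (q - p)| <= C * `|q - p| ^+ 2.
  move=> pr qr; have := H1' p q; rewrite !subr0 => /(_ pr qr) h.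
  by apply: le_trans h _; rewrite ler_wpM2r ?exprn_ge0.
have H2 p q w : `|p| < r -> `|q| < r -> `|DG q w - DG p w| <= C * `|q - p| * `|w|.
  move=> pr qr; have := H2' p q w; rewrite !subr0 => /(_ pr qr) h.
  by apply: le_trans h _; rewrite ler_wpM2r // ler_wpM2r.
pose l := `|lam|; have l0' : 0 < l by []. have l1' : l < 1 by [].
pose mu := l^-1; have mu0 : 0 < mu by rewrite invr_gt0.
have mul : mu * l = 1 by rewrite mulVf // gt_eqF.
have D0le w : `|DG 0 w| <= mu * `|w|.
  rewrite D0; have := @diag_norm_le lam^-1 lam w; rewrite normfV -/l -/mu; apply.
  have : l * l <= 1 * 1 by rewrite ler_pM // ltW.
  by rewrite -[l <= mu](ler_pM2r l0') mul mulr1.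
(* [K] is large enough for the induction step on the remainder to close *)
pose K := 18 * C / (1 - l); have ol : 0 < 1 - l by rewrite subr_gt0.
have K0 : 0 < K by rewrite /K divr_gt0 // mulr_gt0.
have KE : K * (1 - l) = 18 * C by rewrite /K divfK // gt_eqF.
pose rho := Num.min (r / 4) (Num.min (1 / (2 * K)) ((1 - l) / (12 * C))).
have K2 : 0 < 2 * K by rewrite mulr_gt0.
have C12 : 0 < 12 * C by rewrite mulr_gt0.
have rho0 : 0 < rho by rewrite !lt_min (divr_gt0 r0) // (divr_gt0 ltr01 K2) (divr_gt0 ol C12).
have rho1 : rho <= r / 4 by rewrite ge_min lexx.
have rho2 : 2 * K * rho <= 1.
  by rewrite mulrC -ler_pdivlMr // /rho !ge_min lexx orbT.
have rho3 : 12 * C * rho <= 1 - l.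
  by rewrite mulrC -ler_pdivlMr // /rho !ge_min lexx !orbT.
clearbody rho; clearbody K; clearbody C.
have [l0w mu0w C0w] : [/\ 0 <= l, 0 <= mu & 0 <= C] by split; exact: ltW.
have [K0w rho0w] : 0 <= K /\ 0 <= rho by split; exact: ltW.
pose e : 'rV[R]_2 := pair2 1 0.
have ne : `|e| <= 1 by apply: rv_norm_le; rewrite ?pair2_0 ?pair2_1 ?normr0 ?normr1.
(* the iteration on the pairs of a curve and its derivative *)
pose step (s : (R -> 'rV[R]_2) * (R -> 'rV[R]_2)) :=
  (fun u => G (s.1 (lam * u)), fun u => lam *: DG (s.1 (lam * u)) (s.2 (lam * u))).
pose s m := iter m step (fun u => u *: e, fun=> e).
pose phi m := (s m).1; pose psi m := (s m).2.
have phiS m u : phi m.+1 u = G (phi m (lam * u)) by [].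
have psiS m u : psi m.+1 u = lam *: DG (phi m (lam * u)) (psi m (lam * u)) by [].
have phi0 m : phi m 0 = 0.
  by elim: m => [|m IH]; [rewrite /phi /= scale0r | rewrite phiS mulr0 IH].
have psi0 m : psi m 0 = e.
  elim: m => [//|m IH]; rewrite psiS mulr0 phi0 IH D0 pair2_0 pair2_1.
  apply: vec2P; rewrite !mxE /= ?mulr0 // mulr1 mulfV //.
  by rewrite -normr_gt0.
have inl u : `|u| <= rho -> `|lam * u| <= rho /\ `|lam * u| <= l * rho.
  move=> ur; have h : `|lam * u| <= l * rho by rewrite normrM ler_wpM2l // ltW.
  by split=> //; apply: le_trans h _; rewrite ler_piMl // ltW.
(* the uniform quadratic remainder; with [K * rho] small it also confines the
   curves to the ball where the estimates on [G] hold *)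
pose rem m := forall u u', `|u| <= rho -> `|u'| <= rho ->
  `|phi m u' - phi m u - (u' - u) *: psi m u| <= K * (u' - u) ^+ 2.
have z_rho : `|0 : R| <= rho by rewrite normr0 ltW.
have rem_psi m : rem m -> forall u, `|u| <= rho -> `|psi m u - e| <= 2 * K * `|u|.
  move=> h u ur; have [->|u0] := eqVneq u 0; first by rewrite psi0 subrr !normr0 mulr0.
  have h1 := h u 0 ur z_rho; have h2 := h 0 u z_rho ur.
  rewrite -(ler_pM2l (_ : 0 < `|u|)) ?normr_gt0 // -normrZ.
  have -> : u *: (psi m u - e) = (phi m 0 - phi m u - (0 - u) *: psi m u) +
      (phi m u - phi m 0 - (u - 0) *: psi m 0).
    rewrite psi0 phi0; move: (phi m u) (psi m u) (e) => x y z.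
    by apply: vec2P; rewrite !mxE; ring.
  apply: le_trans (ler_normD _ _) _; move: h1 h2; rewrite !subr0 !sub0r sqrrN => h1 h2.
  by rewrite mulrCA -expr2 real_normK ?num_real //; clear -h1 h2; lra.
have rem_phi m : rem m -> forall u, `|u| <= rho -> `|phi m u - u *: e| <= K * u ^+ 2.
  by move=> h u ur; have := h 0 u z_rho ur; rewrite phi0 psi0 !subr0.
have bd_psi m : rem m -> forall u, `|u| <= rho -> `|psi m u| <= 2.
  move=> h u ur; have h1 := rem_psi m h u ur.
  rewrite -[psi m u](subrK e) (le_trans (ler_normD _ _)) //.
  have h2 : 2 * K * `|u| <= 2 * K * rho by rewrite ler_pM2l.
  by clear -h1 h2 ne rho2; lra.
have bd_phi m : rem m -> forall u, `|u| <= rho -> `|phi m u| <= 2 * `|u|.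
  move=> h u ur; have h1 := rem_phi m h u ur.
  rewrite -[phi m u](subrK (u *: e)) (le_trans (ler_normD _ _)) //.
  have h2 : `|u *: e| <= `|u| by rewrite normrZ ler_piMr.
  have h3 : K * u ^+ 2 <= `|u|.
    rewrite -real_normK ?num_real // expr2 mulrA ler_piMl //.
    have h3 : K * `|u| <= K * rho by rewrite ler_pM2l.
    by have h4 := mulr_gt0 K0 rho0; clear -h3 h4 rho2; lra.
  by clear -h1 h2 h3; lra.
have in_r m : rem m -> forall u, `|u| <= rho -> `|phi m u| < r.
  by move=> h u ur; have h1 := bd_phi m h u ur; clear -h1 ur rho1 r0; lra.
have z_r : `|0 : 'rV[R]_2| < r by rewrite normr0.
have opD p w (x : R) : `|p| < r -> `|p| <= x -> `|DG p w| <= (mu + C * x) * `|w|.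
  move=> pr px; rewrite -[DG p w](subrK (DG 0 w)) addrC mulrDl.
  rewrite (le_trans (ler_normD _ _)) // lerD //.
  have := H2 0 p w z_r pr; rewrite subr0 => h; apply: le_trans h _.
  by rewrite ler_wpM2r // ler_pM2l.
have remP m : rem m.
  elim: m => [u u' _ _|m IH u u' ur u'r].
    by rewrite /phi /psi /= -scalerBl subrr normr0 mulr_ge0 ?sqr_ge0 // ltW.
  have [lu lu'] := inl u ur; have [lv lv'] := inl u' u'r.
  rewrite !phiS psiS; set a := phi m (lam * u); set b := phi m (lam * u').
  set d := u' - u; have ar : `|a| < r by exact: in_r. have br : `|b| < r by exact: in_r.
  have R1 := IH _ _ lu lv; rewrite -/a -/b -mulrBr -/d in R1.
  have ba : `|b - a| <= 3 * l * `|d|.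
    rewrite -[b - a](subrK ((lam * d) *: psi m (lam * u))) (le_trans (ler_normD _ _)) //.
    have h1 : `|(lam * d) *: psi m (lam * u)| <= l * `|d| * 2.
      by rewrite normrZ normrM ler_wpM2l ?mulr_ge0 // bd_psi.
    have h2 : K * (lam * d) ^+ 2 <= l * `|d|.
      rewrite -real_normK ?num_real // normrM -/l expr2 mulrA ler_piMl ?mulr_ge0 //.
      have h3 : `|d| <= 2 * rho.
        by apply: le_trans (ler_normB _ _) _; clear -ur u'r; lra.
      have h4 : K * (l * `|d|) <= K * (1 * (2 * rho)).
        by rewrite ler_pM2l // ler_pM // ltW.
      by rewrite (le_trans h4) // mul1r mulrCA mulrA.
    by clear -R1 h1 h2; lra.
  have -> : G b - G a - d *: (lam *: DG a (psi m (lam * u))) =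
      (G b - G a - DG a (b - a)) + DG a (b - a - (lam * d) *: psi m (lam * u)).
    rewrite [DG a (b - a - _)]addD [DG a (_ *: _)]scaleD scalerA [d * lam]mulrC addrA subrK //.
  apply: le_trans (ler_normD _ _) _.
  have e1 : `|G b - G a - DG a (b - a)| <= 9 * C * d ^+ 2.
    apply: le_trans (H1 _ _ ar br) _.
    rewrite [9 * C]mulrC -mulrA ler_pM2l // -[d ^+ 2]real_normK ?num_real //.
    apply: le_trans (_ : (3 * l * `|d|) ^+ 2 <= _).
      by rewrite ler_pXn2r ?nnegrE ?mulr_ge0.
    rewrite !exprMn; have : l ^+ 2 <= 1 by rewrite expr_le1 // ltW.
    move=> l2; rewrite ler_wpM2r ?exprn_ge0 //.
    have e9 : (3 : R) ^+ 2 = 9 by ring.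
    by rewrite e9; clear -l2; lra.
  have e2 : `|DG a (b - a - (lam * d) *: psi m (lam * u))| <=
      (mu + C * (2 * rho)) * (K * (l ^+ 2 * d ^+ 2)).
    apply: le_trans (opD _ _ (2 * rho) ar _) _.
      by apply: le_trans (bd_phi m IH _ lu) _; rewrite ler_pM2l.
    rewrite ler_wpM2l ?addr_ge0 ?mulr_ge0 //.
    by move: R1; rewrite exprMn -[lam ^+ 2]real_normK ?num_real.
  have e3 : (mu + C * (2 * rho)) * (K * (l ^+ 2 * d ^+ 2)) <= (l + (1 - l) / 2) * (K * d ^+ 2).
    have -> : (mu + C * (2 * rho)) * (K * (l ^+ 2 * d ^+ 2)) =
        ((mu * l) * l + 2 * C * rho * l ^+ 2) * (K * d ^+ 2) by ring.
    apply: ler_wpM2r; first by rewrite mulr_ge0 ?sqr_ge0.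
    rewrite mul mul1r lerD2l.
    have h1 : 2 * C * rho * l ^+ 2 <= 2 * C * rho * 1.
      by rewrite ler_wpM2l ?mulr_ge0 // ?expr_le1 // ltW.
    by have h2 := mulr_gt0 C0 rho0; clear -h1 h2 rho3; lra.
  apply: le_trans (lerD e1 (le_trans e2 e3)) _.
  have -> : 9 * C * d ^+ 2 = (1 - l) / 2 * (K * d ^+ 2).
    by transitivity (K * (1 - l) / 2 * d ^+ 2); [rewrite KE|]; field.
  by apply: eq_leR; field.
pose q := (1 + l) / 2; have q0 : 0 <= q by rewrite /q; clear -l0w; lra.
have q1 : q < 1 by rewrite /q; clear -l1'; lra.
pose A := 4 * K; have A0 : 0 <= A by rewrite mulr_ge0 // ltW.
(* near the fixed point one step contracts the distance of two curves tangent to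
   the first axis: composition with [lam * u] gains [l ^+ 2], and [G] loses about
   [mu = l^-1] *)
have cauchy m u : `|u| <= rho ->
    `|phi m.+1 u - phi m u| <= A * q ^+ m * u ^+ 2 /\
    `|psi m.+1 u - psi m u| <= A * q ^+ m * `|u|.
  elim: m u => [|m IH] u ur.
    rewrite expr0 mulr1; split.
      rewrite -[_ - phi 0 u](subrKA (u *: e)) (le_trans (ler_normD _ _)) // [`|u *: e - _|]distrC.
      have h1 := rem_phi _ (remP 0%N) u ur; have h2 := rem_phi _ (remP 1%N) u ur.
      have h0 : 0 <= K * u ^+ 2 by rewrite mulr_ge0 ?sqr_ge0.
      by rewrite /A; clear -h0 h1 h2; lra.
    rewrite -[_ - psi 0 u](subrKA e) (le_trans (ler_normD _ _)) // [`|e - _|]distrC.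
    by have h1 := rem_psi _ (remP 0%N) u ur; have h2 := rem_psi _ (remP 1%N) u ur;
      rewrite /A; clear -h1 h2; lra.
  have [lu lu'] := inl u ur; have [IH1 IH2] := IH _ lu.
  rewrite !(phiS _ u) !(psiS _ u); set a := phi m (lam * u) in IH1 *.
  set b := phi m.+1 (lam * u) in IH1 *.
  have ar : `|a| < r by exact: in_r. have br : `|b| < r by exact: in_r.
  have a2 : `|a| <= 2 * rho by apply: le_trans (bd_phi m (remP m) _ lu) _; rewrite ler_pM2l.
  have b2 : `|b| <= 2 * rho by apply: le_trans (bd_phi _ (remP _) _ lu) _; rewrite ler_pM2l.
  have ba : `|b - a| <= 4 * rho by apply: le_trans (ler_normB _ _) _; clear -a2 b2; lra.
  have lu2 : (lam * u) ^+ 2 = l ^+ 2 * u ^+ 2 by rewrite exprMn -[lam ^+ 2]real_normK ?num_real.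
  have Aq : 0 <= A * q ^+ m by rewrite mulr_ge0 ?exprn_ge0.
  have Cr : 0 <= C * rho by rewrite mulr_ge0 // ltW.
  have l2 : l ^+ 2 <= 1 by rewrite expr_le1 // ltW.
  split.
    rewrite -[G b - G a](subrK (DG a (b - a))) (le_trans (ler_normD _ _)) //.
    have e1 := H1 _ _ ar br; have e2 := opD a (b - a) _ ar a2.
    have e3 : C * `|b - a| ^+ 2 <= C * (4 * rho) * `|b - a|.
      by rewrite expr2 mulrA ler_wpM2r // ler_pM2l.
    apply: le_trans (lerD (le_trans e1 e3) e2) _.
    rewrite -mulrDl; apply: le_trans (_ : (C * (4 * rho) + (mu + C * (2 * rho))) *
        (A * q ^+ m * (l ^+ 2 * u ^+ 2)) <= _).
      by rewrite ler_wpM2l -?lu2 // !addr_ge0 ?mulr_ge0 // ltW.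
    have -> : (C * (4 * rho) + (mu + C * (2 * rho))) * (A * q ^+ m * (l ^+ 2 * u ^+ 2)) =
       ((mu * l) * l + 6 * (C * rho) * l ^+ 2) * (A * q ^+ m * u ^+ 2) by ring.
    have -> : A * q ^+ m.+1 * u ^+ 2 = q * (A * q ^+ m * u ^+ 2) by rewrite exprS; ring.
    apply: ler_wpM2r; first by rewrite mulr_ge0 ?sqr_ge0.
    rewrite mul mul1r /q.
    have h1 : 6 * (C * rho) * l ^+ 2 <= 6 * (C * rho) * 1 by rewrite ler_wpM2l // mulr_ge0.
    by clear -h1 rho3; lra.
  rewrite -scalerBr normrZ -/l.
  set x := psi m (lam * u) in IH2 *; set y := psi m.+1 (lam * u) in IH2 *.
  have -> : DG b y - DG a x = DG b (y - x) + (DG b x - DG a x) by rewrite addD addrA subrK.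
  have e1 := opD b (y - x) _ br b2; have e2 := H2 a b x ar br.
  have x2 : `|x| <= 2 by exact: bd_psi.
  have e3 : C * `|b - a| * `|x| <= C * (A * q ^+ m * (l ^+ 2 * u ^+ 2)) * 2.
    by rewrite ler_pM ?mulr_ge0 // ?(ltW C0) // ler_pM2l // -lu2.
  have e4 : (mu + C * (2 * rho)) * `|y - x| <= (mu + C * (2 * rho)) * (A * q ^+ m * (l * `|u|)).
    rewrite ler_wpM2l ?addr_ge0 ?mulr_ge0 //.
    by move: IH2; rewrite normrM.
  apply: le_trans (_ : l * ((mu + C * (2 * rho)) * (A * q ^+ m * (l * `|u|)) +
      C * (A * q ^+ m * (l ^+ 2 * u ^+ 2)) * 2) <= _).
    rewrite ler_wpM2l // (le_trans (ler_normD _ _)) // lerD //; [exact: le_trans e1 e4|].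
    exact: le_trans e2 e3.
  have -> : l * ((mu + C * (2 * rho)) * (A * q ^+ m * (l * `|u|)) +
      C * (A * q ^+ m * (l ^+ 2 * u ^+ 2)) * 2) =
      ((mu * l) * l + 2 * (C * rho) * l ^+ 2 + 2 * C * l ^+ 3 * `|u|) * (A * q ^+ m * `|u|).
    by rewrite -[u ^+ 2]real_normK ?num_real //; ring.
  have -> : A * q ^+ m.+1 * `|u| = q * (A * q ^+ m * `|u|) by rewrite exprS; ring.
  apply: ler_wpM2r; first by rewrite mulr_ge0.
  rewrite mul mul1r /q; have h1 : 2 * (C * rho) * l ^+ 2 <= 2 * (C * rho) * 1 by rewrite ler_wpM2l // mulr_ge0.
  have h2 : 2 * C * l ^+ 3 * `|u| <= 2 * C * 1 * rho.
    rewrite ler_pM ?mulr_ge0 ?exprn_ge0 // ?(ltW C0) // ler_wpM2l ?mulr_ge0 // ?(ltW C0) //.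
    by rewrite expr_le1 // ltW.
  by clear -h1 h2 Cr rho3; lra.
have lim_phi u : exists x : 'rV[R]_2, `|u| <= rho ->
    forall m, `|x - phi m u| <= A * u ^+ 2 / (1 - q) * q ^+ m.
  have [ur|] := boolP (`|u| <= rho); last by exists 0.
  have [||||x hx] := @geometric_limit R (phi^~ u) (A * u ^+ 2) q; last by exists x.
  - by rewrite mulr_ge0 ?sqr_ge0.
  - by [].
  - by [].
  - by move=> m; have [h _] := cauchy m u ur; rewrite mulrAC.
have lim_psi u : exists x : 'rV[R]_2, `|u| <= rho ->
    forall m, `|x - psi m u| <= A * `|u| / (1 - q) * q ^+ m.
  have [ur|] := boolP (`|u| <= rho); last by exists 0.
  have [||||x hx] := @geometric_limit R (psi^~ u) (A * `|u|) q; last by exists x.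
  - by rewrite mulr_ge0.
  - by [].
  - by [].
  - by move=> m; have [_ h] := cauchy m u ur; rewrite mulrAC.
have [Phi PhiP] := choice lim_phi; have [Psi PsiP] := choice lim_psi.
have norm0 x : `|x| <= 0 -> x = 0 :> 'rV[R]_2 by rewrite normr_le0 => /eqP.
have Phi0 : Phi 0 = 0.
  apply: norm0; have := PhiP 0 z_rho 0%N; rewrite phi0 subr0 expr0n /= mulr0 !mul0r; exact.
have Psi0 : Psi 0 = e.
  apply/subr0_eq/norm0; have := PsiP 0 z_rho 0%N; rewrite psi0 normr0 mulr0 !mul0r; exact.
exists rho, K, Phi, Psi; split=> //.
  move=> u u' ur u'r; set B := A / (1 - q).
  apply: (geometric_le (c := B * u' ^+ 2 + B * u ^+ 2 + `|u' - u| * (B * `|u|)) q0 q1) => m.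
  have h1 := PhiP u ur m; have h2 := PhiP u' u'r m; have h3 := PsiP u ur m.
  have h4 := remP m u u' ur u'r.
  have -> : Phi u' - Phi u - (u' - u) *: Psi u =
      (phi m u' - phi m u - (u' - u) *: psi m u) +
      ((Phi u' - phi m u') - (Phi u - phi m u) - (u' - u) *: (Psi u - psi m u)).
    move: (Phi u') (Phi u) (Psi u) (phi m u') (phi m u) (psi m u).
    by clear=> *; apply: vec2P; rewrite !mxE; ring.
  apply: le_trans (ler_normD _ _) _; apply: lerD => //.
  apply: le_trans (ler_normB _ _) _; rewrite normrZ.
  apply: le_trans (lerD (ler_normB _ _) (lexx _)) _.
  have h5 : `|u' - u| * `|Psi u - psi m u| <= `|u' - u| * (A * `|u| / (1 - q) * q ^+ m).
    by rewrite ler_wpM2l.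
  by rewrite /B; clear -h1 h2 h5; lra.
move=> u ur; have [lu _] := inl u ur.
apply/subr0_eq/norm0.
have Phi_r : `|Phi (lam * u)| < r.
  have h := bd_phi _ (remP _) _ lu.
  have hh : `|Phi (lam * u)| <= 2 * rho.
    apply: (geometric_le (c := A * (lam * u) ^+ 2 / (1 - q)) q0 q1) => m.
    rewrite -[Phi _](subrK (phi m (lam * u))) addrC (le_trans (ler_normD _ _)) // lerD ?PhiP //.
    by apply: le_trans (bd_phi _ (remP m) _ lu) _; rewrite ler_pM2l.
  by clear -hh rho1 r0; lra.
pose M := C * (2 * r) + (mu + C * r).
have lip p p' : `|p| < r -> `|p'| < r -> `|G p' - G p| <= M * `|p' - p|.
  move=> pr pr'; rewrite -[G p' - G p](subrK (DG p (p' - p))) (le_trans (ler_normD _ _)) //.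
  have e2 := opD p (p' - p) r pr (ltW pr).
  have e3 : C * `|p' - p| ^+ 2 <= C * (2 * r) * `|p' - p|.
    rewrite expr2 -[C * (2 * r) * _]mulrA ler_pM2l // ler_wpM2r //.
    by apply: le_trans (ler_normB _ _) _; clear -pr pr'; lra.
  by rewrite mulrDl lerD //; exact: le_trans (H1 _ _ pr pr') e3.
apply: (geometric_le (c := A * u ^+ 2 / (1 - q) * q + M * (A * (lam * u) ^+ 2 / (1 - q))) q0 q1) => m.
rewrite add0r -[Phi u - _](subrKA (phi m.+1 u)) (le_trans (ler_normD _ _)) // mulrDl lerD //.
  by apply: le_trans (PhiP u ur m.+1) _; rewrite -[leRHS]mulrA -exprS.
rewrite phiS (le_trans (lip _ _ Phi_r (in_r _ (remP m) _ lu))) // -mulrA ler_wpM2l //.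
  by rewrite addr_ge0 ?mulr_ge0 ?addr_ge0 ?mulr_ge0 // ltW.
by rewrite distrC PhiP.
Qed.

(** Two points with the same stable coordinate differ by a vector of the unstable
    cone, which the dynamics expands: their orbits cannot both stay near 0. *)
Lemma unstable_cone_expansion (F : 'rV[R]_2 -> 'rV[R]_2) DF (lam mu : R) :
    @C11 R V V F DF 0 -> `|lam| < 1 -> 1 < `|mu| ->
    (forall w, DF 0 w = pair2 (lam * w 0 0) (mu * w 0 1)) ->
  exists2 r : R, 0 < r & forall p q,
    (forall m, `|iter m F p| < r) -> (forall m, `|iter m F q| < r) ->
    p 0 0 = q 0 0 -> p = q.
Proof.
move=> cF l1 m1 D0; have [_ [s [C [s0 C0 H1' H2' _]]]] := cF.
pose e := Num.min ((`|mu| - 1) / 2) (1 - `|lam|).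
have e0 : 0 < e by rewrite lt_min divr_gt0 ?subr_gt0.
have e1 : e <= (`|mu| - 1) / 2 by rewrite ge_min lexx.
have e2 : e <= 1 - `|lam| by rewrite ge_min lexx orbT.
pose r := Num.min s (e / (3 * (C + 1))).
have C3 : 0 < 3 * (C + 1) by rewrite mulr_gt0 // ltr_wpDl.
have r0 : 0 < r by rewrite lt_min s0 divr_gt0.
have rs : r <= s by rewrite ge_min lexx.
have re : 3 * (C + 1) * r <= e by rewrite mulrC -ler_pdivlMr // /r ge_min lexx orbT.
(* near 0 the map is a small Lipschitz perturbation of its diagonal part *)
have main p q : `|p| < r -> `|q| < r ->
    `|F q - F p - pair2 (lam * (q - p) 0 0) (mu * (q - p) 0 1)| <= e * `|q - p|.
  move=> pr qr; rewrite -D0; have ps := lt_le_trans pr rs; have qs := lt_le_trans qr rs.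
  have h1 := H1' p q; have h2 := H2' 0 p (q - p); rewrite !subr0 normr0 in h1 h2.
  have {}h1 := h1 ps qs; have {}h2 := h2 s0 ps.
  rewrite -[_ - DF 0 _](subrKA (DF p (q - p))) (le_trans (ler_normD _ _)) //.
  have h3 : C * `|q - p| ^+ 2 <= C * (2 * r) * `|q - p|.
    rewrite expr2 mulrA ler_wpM2r // ler_wpM2l //.
    by apply: le_trans (ler_normB _ _) _; clear -pr qr; lra.
  have h4 : C * `|p| * `|q - p| <= C * r * `|q - p| by rewrite ler_wpM2r // ler_wpM2l // ltW.
  have h5 : 3 * (C * r) * `|q - p| <= e * `|q - p|.
    by rewrite ler_wpM2r //; clear -re r0; lra.
  by clear -h1 h2 h3 h4 h5; lra.
pose g := (`|mu| + 1) / 2; have g1 : 1 < g by rewrite /g; lra.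
exists r => // p q hp hq pq.
pose x m := (iter m F q - iter m F p) 0 0; pose y m := (iter m F q - iter m F p) 0 1.
have xE : x 0%N = 0 by rewrite /x /= !mxE pq subrr.
have cone m : `|x m| <= `|y m| /\ g ^+ m * `|y 0%N| <= `|y m|.
  elim: m => [|m [IH1 IH2]]; first by rewrite xE normr0 expr0 mul1r.
  have h := main _ _ (hp m) (hq m); set d := iter m F q - iter m F p in h.
  have dn : `|d| = `|y m|.
    apply/eqP; rewrite eq_le; apply/andP; split; last exact: coord_norm_le.
    by apply: rv_norm_le.
  have hx : `|x m.+1 - lam * x m| <= e * `|y m|.
    rewrite -dn; apply: le_trans h; apply: le_trans (coord_norm_le _ 0).
    by rewrite /x /= !mxE /=.
  have hy : `|y m.+1 - mu * y m| <= e * `|y m|.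
    rewrite -dn; apply: le_trans h; apply: le_trans (coord_norm_le _ 1).
    by rewrite /y /= !mxE /=.
  have y1 : g * `|y m| <= `|y m.+1|.
    have h1 : `|mu * y m| <= `|y m.+1| + `|y m.+1 - mu * y m|.
      by rewrite distrC -[in leLHS](subrK (y m.+1) (mu * y m)) addrC ler_normD.
    have h2 : e * `|y m| <= (`|mu| - 1) / 2 * `|y m| by rewrite ler_wpM2r.
    by rewrite normrM in h1; rewrite /g; clear -h1 h2 hy; lra.
  have x1 : `|x m.+1| <= `|y m|.
    rewrite -[x m.+1](subrK (lam * x m)) (le_trans (ler_normD _ _)) //.
    have h1 : `|lam * x m| <= `|lam| * `|y m| by rewrite normrM ler_wpM2l.
    have h2 : e * `|y m| <= (1 - `|lam|) * `|y m| by rewrite ler_wpM2r.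
    by clear -h1 h2 hx; lra.
  split; first by apply: le_trans x1 (le_trans _ y1); rewrite ler_peMl // ltW.
  by rewrite exprS -mulrA (le_trans _ y1) // ler_wpM2l //; lra.
have g0 : 0 < g by lra.
suff y0 : y 0%N = 0.
  by move: xE y0; rewrite /x /y /= !mxE => /subr0_eq ? /subr0_eq ?; apply: vec2P.
have gi1 : g^-1 < 1 by rewrite invf_lt1.
apply/eqP; rewrite -normr_le0.
have gi0 : 0 <= g^-1 by rewrite invr_ge0 ltW.
apply: (geometric_le (c := 2 * r) gi0 gi1) => m; rewrite add0r.
have [_ h] := cone m; rewrite exprVn -ler_pdivrMr ?invr_gt0 ?exprn_gt0 // invrK mulrC.
apply: le_trans h (le_trans (coord_norm_le _ _) (le_trans (ler_normB _ _) _)).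
by have h1 := hp m; have h2 := hq m; clear -h1 h2; lra.
Qed.

End LocalCurve.

(** * Stable manifolds of hyperbolic periodic points *)

Section Iterates.
Context {R : realType}.
Notation V := ('rV[R]_2 : normedModType R).
Implicit Types (p q v w : 'rV[R]_2) (n m : nat) (j : int).

Lemma C11_linear (U W : normedModType R) (h : U -> W) (C : R) (p0 : U) : 0 <= C ->
  (forall (k : R) (u v : U), h (k *: u + v) = k *: h u + h v) ->
  (forall w : U, `|h w| <= C * `|w|) -> C11 h (fun (_ w : U) => h w) p0.
Proof.
move=> C0 lin bd; split=> [_ k u v|]; first exact: lin.
exists 1, C; split=> //.
- move=> p q _ _; have -> : h (q - p) = h q - h p.
    by rewrite addrC -scaleN1r lin scaleN1r addrC.
  by rewrite subrr normr0 mulr_ge0 ?exprn_ge0.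
- by move=> p q w _ _; rewrite subrr normr0 !mulr_ge0.
Qed.

Fixpoint Diter (f : 'rV[R]_2 -> 'rV[R]_2) (Df : 'rV[R]_2 -> 'rV[R]_2 -> 'rV[R]_2) n p v :=
  if n is m.+1 then Df (iter m f p) (Diter f Df m p v) else v.

Lemma flow_iter P f Df n : flow P f Df -> flow P (iter n f) (Diter f Df n).
Proof.
move=> F; elim: n => [|n IH].
  split=> //= p Pp; apply: (@C11_linear V V _ 1) => // w; rewrite mul1r //.
split.
- by move=> p Pp; apply: (flow_in F); exact: (flow_in IH).
- move=> p Pp; exact: C11_comp (flow_C11 IH Pp) (flow_C11 F (flow_in IH Pp)).
- by move=> p v w Pp; rewrite /= (flow_area F) ?(flow_area IH) //; exact: (flow_in IH).
- by move=> p j Pp; rewrite /= (flow_shift IH) // (flow_shift F) //; exact: (flow_in IH).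
- move=> p j v Pp; rewrite /= (flow_shift IH) // (flow_Dshift IH) //.
  by rewrite (flow_Dshift F) //; exact: (flow_in IH).
Qed.

Lemma flow_translate P f Df (j : int) : flow P f Df ->
  (forall p (i : int), P p -> P (p + cyl_shift i)) ->
  flow P (fun p => f p + cyl_shift j) Df.
Proof.
move=> F Ps; split.
- by move=> p Pp; apply: Ps; exact: (flow_in F).
- move=> p Pp; have := C11_add (flow_C11 F Pp) (@C11_cst R V V (cyl_shift j) p).
  by move/C11_eq; apply=> q w; rewrite addr0.
- exact: (flow_area F).
- by move=> p i Pp; rewrite (flow_shift F) // addrAC.
- exact: (flow_Dshift F).
Qed.

Lemma iter_cancel P (f g : 'rV[R]_2 -> 'rV[R]_2) n : (forall p, P p -> P (f p)) ->
  (forall p, P p -> g (f p) = p) -> forall p, P p -> iter n g (iter n f p) = p.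
Proof.
move=> fP fK; elim: n => // n IH p Pp; rewrite iterSr /= fK ?IH //.
by elim: n {IH} => //= n IH; exact: fP.
Qed.

Lemma Diter_S f Df n p v : Diter f Df n.+1 p v = Diter f Df n (f p) (Df p v).
Proof. by elim: n p v => //= n IH p v; rewrite -IH /= -iterSr. Qed.

Lemma Diter_cancel P f Df g Dg n : system P f g Df Dg -> forall p v, P p ->
  Diter g Dg n (iter n f p) (Diter f Df n p v) = v.
Proof.
move=> S; elim: n => // n IH p v Pp.
have Pn : P (iter n f p) := flow_in (flow_iter n (sys_fwd S)) Pp.
by rewrite Diter_S /= (sys_fK S) // (sys_DfK S) // IH.
Qed.

(** Passing to the period and correcting by the deck translation turns a periodic
    point into a fixed point of another system. *)
Lemma system_power P f g Df Dg n (j : int) : system P f g Df Dg ->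
  system P (fun p => iter n f p + cyl_shift j) (fun p => iter n g p + cyl_shift (- j))
    (Diter f Df n) (Diter g Dg n).
Proof.
move=> S; have F := flow_iter n (sys_fwd S); have G := flow_iter n (sys_bwd S).
have Ps p i := @sys_shift _ _ _ _ _ _ S p i.
have fP p : P p -> P (f p) := flow_in (sys_fwd S) (p := p).
have gP p : P p -> P (g p) := flow_in (sys_bwd S) (p := p).
split; [exact: flow_translate|exact: flow_translate|exact: (sys_open S)|exact: Ps| | | |].
- move=> p Pp; rewrite (flow_shift G) ?(iter_cancel n fP (sys_fK S)) //; last exact: (flow_in F).
  by rewrite -addrA cyl_shiftD subrr cyl_shift0 addr0.
- move=> p Pp; rewrite (flow_shift F) ?(iter_cancel n gP (sys_gK S)) //; last exact: (flow_in G).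
  by rewrite -addrA cyl_shiftD addNr cyl_shift0 addr0.
- by move=> p v Pp; rewrite (flow_Dshift G) ?(Diter_cancel n S) //; exact: (flow_in F).
- move=> p v Pp; rewrite (flow_Dshift F) ?(Diter_cancel n (system_inv S)) //.
  exact: (flow_in G).
Qed.

Lemma C11_curve (c : R -> 'rV[R]_2) D (u0 : R) : @C11 R R V c D u0 ->
  is_derive u0 1 c (D u0 1) /\ {for u0, continuous (derive1 c)}.
Proof.
move=> cc; have [_ sD] := C11_lin cc; have [_ [r [C [r0 C0 H1 H2 _]]]] := cc.
have dc u : `|u - u0| < r -> is_derive u 1 c (D u 1).
  move=> ur; pose s := r - `|u - u0|; have s0 : 0 < s by rewrite subr_gt0.
  apply: (@is_derive_quadratic R V c u (D u 1) s C s0) => h hs.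
  have -> : h *: D u 1 = D u h by rewrite -sD /GRing.scale /= mulr1.
  have e : u + h - u = h by rewrite addrAC subrr add0r.
  have := H1 u (u + h) ur; rewrite e -[h ^+ 2]real_normK ?num_real //; apply.
  rewrite addrAC (le_lt_trans (ler_normD _ _)) //; move: hs; rewrite /s; lra.
have z : `|u0 - u0| < r by rewrite subrr normr0.
split; first exact: dc.
apply/cvgrPdist_lt => e e0; near=> u.
have ur : `|u - u0| < r by near: u; exact: cvgr_distC_lt.
rewrite !derive1E (@derive_val _ _ _ _ _ _ _ (dc u ur)) (@derive_val _ _ _ _ _ _ _ (dc u0 z)).
rewrite distrC; apply: le_lt_trans (H2 _ _ 1 z ur) _; rewrite normr1 mulr1.
apply: le_lt_trans (_ : (C + 1) * `|u - u0| < e); first by rewrite ler_wpM2r // lerDl.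
rewrite -ltr_pdivlMl ?ltr_wpDl // mulrC.
by near: u; apply: cvgr_distC_lt; rewrite ?divr_gt0 ?ltr_wpDl.
Unshelve. all: by end_near. Qed.

Lemma curve_C11 (c d : R -> 'rV[R]_2) (K rho u0 : R) : 0 <= K -> `|u0| < rho ->
  (forall u u', `|u| <= rho -> `|u'| <= rho ->
    `|c u' - c u - (u' - u) *: d u| <= K * (u' - u) ^+ 2) ->
  @C11 R R V c (fun u h => h *: d u) u0.
Proof.
move=> K0 u0r H; split=> [p k v w|]; first by rewrite scalerDl [in RHS]scalerA.
pose r := rho - `|u0|; have r0 : 0 < r by rewrite subr_gt0.
have inr u : `|u - u0| < r -> `|u| <= rho.
  move=> ur; rewrite -[u](subrK u0) (le_trans (ler_normD _ _)) //.
  by move: ur; rewrite /r; lra.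
have lip (p q : R) : `|p| <= rho -> `|q| <= rho -> `|d q - d p| <= 2 * K * `|q - p|.
  move=> pr qr; have [->|pq] := eqVneq q p; first by rewrite !subrr !normr0 mulr0.
  have h1 := H p q pr qr; have h2 := H q p qr pr.
  rewrite -(ler_pM2l (_ : 0 < `|q - p|)) ?normr_gt0 ?subr_eq0 // -normrZ.
  have -> : (q - p) *: (d q - d p) =
      (c q - c p - (q - p) *: d p) + (c p - c q - (p - q) *: d q).
    by apply: vec2P; rewrite !mxE; ring.
  apply: le_trans (ler_normD _ _) _.
  have e : (p - q) ^+ 2 = (q - p) ^+ 2 by ring.
  by rewrite e in h2; rewrite mulrCA -expr2 real_normK ?num_real //; lra.
exists r, (2 * K + `|d u0| + 2 * K * r); split=> //.
- by rewrite !addr_ge0 ?mulr_ge0 // ltW.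
- move=> p q pr qr; apply: le_trans (H p q (inr p pr) (inr q qr)) _.
  rewrite real_normK ?num_real // ler_wpM2r ?sqr_ge0 //.
  have : 0 <= 2 * K * r by rewrite !mulr_ge0 // ltW.
  have : 0 <= `|d u0| by [].
  by lra.
- move=> p q w pr qr; rewrite -scalerBr normrZ mulrC ler_wpM2r //.
  apply: le_trans (lip p q (inr p pr) (inr q qr)) _; rewrite ler_wpM2r //.
  by rewrite -addrA lerDl addr_ge0 // !mulr_ge0 // ltW.
- move=> p w pr; rewrite normrZ mulrC ler_wpM2r //.
  rewrite -[d p](subrK (d u0)) (le_trans (ler_normD _ _)) //.
  have := lip u0 p (ltW u0r) (inr p pr).
  have : 2 * K * `|p - u0| <= 2 * K * r by rewrite ler_wpM2l ?mulr_ge0 // ltW.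
  by lra.
Qed.

Lemma det2_le (u v : 'rV[R]_2) : `|det2 u v| <= 2 * `|u| * `|v|.
Proof.
rewrite det2E (le_trans (ler_normB _ _)) // !normrM.
have h1 : `|u 0 0| * `|v 0 1| <= `|u| * `|v| by rewrite ler_pM // coord_norm_le.
have h2 : `|u 0 1| * `|v 0 0| <= `|u| * `|v| by rewrite ler_pM // coord_norm_le.
by lra.
Qed.

Lemma cyl_shift_norm (j : int) : j != 0 -> 1 < `|cyl_shift j : 'rV[R]_2|.
Proof.
move=> j0; apply: lt_le_trans (coord_norm_le _ 0); rewrite pair2_0 normrM.
have p2 : 1 < 2 * pi :> R by have := @pi_ge2 R; lra.
have j1 : 1 <= `|j%:~R : R| by rewrite -intr_norm -[1]/(1%:~R) ler_int -gtz0_ge1 normr_gt0.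
have p0 : 0 < 2 * pi :> R by rewrite mulr_gt0 ?pi_gt0.
by rewrite gtr0_norm //; apply: lt_le_trans p2 _; rewrite ler_peMr // ltW.
Qed.

End Iterates.

Section FixedPoint.
Context {R : realType}.
Notation V := ('rV[R]_2 : normedModType R).
Implicit Types (p q v w : 'rV[R]_2) (m k : nat) (u : R).

Context (P : set 'rV[R]_2) (f g : 'rV[R]_2 -> 'rV[R]_2)
  (Df Dg : 'rV[R]_2 -> 'rV[R]_2 -> 'rV[R]_2) (S : system P f g Df Dg).
Context (x : 'rV[R]_2) (Px : P x) (fx : f x = x).
Context (lam mu : R) (vs vu : 'rV[R]_2).
Context (lam0 : 0 < `|lam| < 1) (lammu : lam * mu = 1) (vsu : det2 vs vu != 0).
Context (Dvs : Df x vs = lam *: vs) (Dvu : Df x vu = mu *: vu).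

Let D := det2 vs vu.
Let ev w : 'rV[R]_2 := w 0 0 *: vs + w 0 1 *: vu.
Let co p : 'rV[R]_2 := pair2 (det2 p vu / D) (det2 vs p / D).

Let evK p : ev (co p) = p.
Proof.
apply: vec2P; rewrite /ev /co !mxE /= /D !det2E; move: vsu; rewrite det2E => dn;
  by field.
Qed.

Let coK w : co (ev w) = w.
Proof.
apply: vec2P; rewrite /ev /co !mxE /= /D !det2E !mxE; move: vsu; rewrite det2E => dn;
  by field.
Qed.

Let ev_lin (k : R) v w : ev (k *: v + w) = k *: ev v + ev w.
Proof. by apply: vec2P; rewrite /ev !mxE; ring. Qed.

Let co_lin (k : R) v w : co (k *: v + w) = k *: co v + co w.
Proof. by apply: vec2P; rewrite /co !mxE /= !det2E !mxE; ring. Qed.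

Let ev_le w : `|ev w| <= (`|vs| + `|vu|) * `|w|.
Proof.
rewrite /ev (le_trans (ler_normD _ _)) // !normrZ mulrDl.
by rewrite ![_ * `|w|]mulrC lerD // ler_wpM2r // coord_norm_le.
Qed.

Let co_le p : `|co p| <= (2 * `|vu| / `|D| + 2 * `|vs| / `|D|) * `|p|.
Proof.
have a0 : 0 <= 2 * `|vu| / `|D| * `|p| by rewrite !mulr_ge0 ?invr_ge0.
have b0 : 0 <= 2 * `|vs| / `|D| * `|p| by rewrite !mulr_ge0 ?invr_ge0.
have i0 : 0 <= `|D|^-1 by rewrite invr_ge0.
rewrite mulrDl; apply: rv_norm_le; first by rewrite addr_ge0.
  rewrite pair2_0 normrM normfV.
  have h : `|det2 p vu| / `|D| <= 2 * `|p| * `|vu| / `|D| by rewrite ler_wpM2r // det2_le.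
  by apply: le_trans h _; apply: le_trans (_ : 2 * `|vu| / `|D| * `|p| <= _);
    [apply: eq_leR; ring | rewrite lerDl].
rewrite pair2_1 normrM normfV.
have h : `|det2 vs p| / `|D| <= 2 * `|vs| * `|p| / `|D| by rewrite ler_wpM2r // det2_le.
by apply: le_trans h _; apply: le_trans (_ : 2 * `|vs| / `|D| * `|p| <= _);
  [apply: eq_leR; ring | rewrite lerDr].
Qed.

Let C11_ev p : @C11 R V V ev (fun _ w => ev w) p.
Proof. by apply: (C11_linear _ _ ev_lin ev_le); rewrite addr_ge0. Qed.

Let C11_co p : @C11 R V V co (fun _ w => co w) p.
Proof.
by apply: (C11_linear _ _ co_lin co_le); rewrite addr_ge0 // !mulr_ge0 ?invr_ge0.
Qed.

(** The system read in the eigenbasis at the fixed point. *)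
Let read (h : 'rV[R]_2 -> 'rV[R]_2) p := co (h (ev p + x) + - x).
Let Dread (Dh : 'rV[R]_2 -> 'rV[R]_2 -> 'rV[R]_2) p w := co (Dh (ev p + x) (ev w)).

Let ev0 : ev 0 = 0. Proof. by rewrite /ev !mxE !scale0r addr0. Qed.
Let co0 : co 0 = 0. Proof. by rewrite -ev0 coK. Qed.

Let C11_read h Dh : @C11 R V V h Dh x -> @C11 R V V (read h) (Dread Dh) 0.
Proof.
move=> ch; have c1 := C11_add (C11_ev 0) (@C11_cst R V V x 0).
have ch' : @C11 R V V h Dh (ev 0 + x) by rewrite ev0 add0r.
have c2 := C11_add (C11_comp c1 ch') (@C11_cst R V V (- x) 0).
have := C11_comp c2 (C11_co _); move/C11_eq; apply=> p w.
by rewrite /Dread !addr0.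
Qed.

Let gx : g x = x. Proof. by rewrite -[in LHS]fx (sys_fK S). Qed.

Let lam_n0 : lam != 0. Proof. by case/andP: lam0; rewrite normr_gt0. Qed.
Let muE : mu = lam^-1. Proof. by apply: (mulfI lam_n0); rewrite lammu mulfV. Qed.

Let Df_lin := C11_lin (flow_C11 (sys_fwd S) Px).
Let Dg_lin := C11_lin (flow_C11 (sys_bwd S) Px).

Let Dgvs : Dg x vs = lam^-1 *: vs.
Proof.
have h : lam *: Dg x vs = vs by rewrite -(Dg_lin.2) -Dvs -[x in Dg x]fx (sys_DfK S).
by rewrite -[in RHS]h scalerA mulVf // scale1r.
Qed.

Let Dgvu : Dg x vu = lam *: vu.
Proof.
have h : mu *: Dg x vu = vu by rewrite -(Dg_lin.2) -Dvu -[x in Dg x]fx (sys_DfK S).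
by rewrite -[in RHS]h scalerA lammu scale1r.
Qed.

Let lin_ev (Dh : 'rV[R]_2 -> 'rV[R]_2 -> 'rV[R]_2) (a b : R) w :
  (forall p (k : R) v w, Dh p (k *: v + w) = k *: Dh p v + Dh p w) ->
  (forall p (k : R) w, Dh p (k *: w) = k *: Dh p w) ->
  Dh x vs = a *: vs -> Dh x vu = b *: vu ->
  Dread Dh 0 w = pair2 (a * w 0 0) (b * w 0 1).
Proof.
move=> l1 l2 e1 e2; rewrite /Dread ev0 add0r /ev l1 l2 e1 e2 -[RHS]coK; congr co.
by rewrite /ev pair2_0 pair2_1 !scalerA ![_ * w 0 _]mulrC.
Qed.

(** The local curve, with its values in the phase space and its nonvanishing
    tangent. *)
Let local : exists (rho K : R) (phi psi : R -> 'rV[R]_2),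
    [/\ 0 < rho /\ 0 <= K, phi 0 = x /\ psi 0 = vs,
      forall u u', `|u| <= rho -> `|u'| <= rho ->
        `|phi u' - phi u - (u' - u) *: psi u| <= K * (u' - u) ^+ 2,
      forall u, `|u| <= rho -> phi u = g (phi (lam * u)) &
      forall u, `|u| <= rho -> P (phi u)].
Proof.
have Dg0 w : Dread Dg 0 w = pair2 (lam^-1 * w 0 0) (lam * w 0 1).
  apply: lin_ev Dgvs Dgvu; last exact: Dg_lin.2.
  exact: (flow_C11 (sys_bwd S) Px).1.
have g00 : read g 0 = 0 by rewrite /read ev0 add0r gx subrr co0.
have [rho [K [phi [psi [[rho0 K0] phi0 psi0 rem fe]]]]] :=
  stable_curve_local (C11_read (flow_C11 (sys_bwd S) Px)) g00 lam0 Dg0.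
have [r r0 hr] := sys_open S Px.
pose N := `|vs| + `|vu|; have N0 : 0 <= N by rewrite addr_ge0.
pose rho' := Num.min rho (Num.min 1 (r / (N * (K + 1) + 1))).
have d0 : 0 < N * (K + 1) + 1 by rewrite ltr_wpDl // mulr_ge0 // addr_ge0.
have rho'0 : 0 < rho' by rewrite !lt_min rho0 ltr01 divr_gt0.
have le1 u : `|u| <= rho' -> `|u| <= rho by rewrite !le_min => /and3P[].
exists rho', (N * K), (fun u => ev (phi u) + x), (fun u => ev (psi u)); split.
- by split=> //; rewrite mulr_ge0.
- rewrite phi0 psi0 ev0 add0r; split=> //.
  by rewrite /ev pair2_0 pair2_1 scale1r scale0r addr0.
- move=> u u' /le1 ur /le1 u'r.
  have -> : ev (phi u') + x - (ev (phi u) + x) - (u' - u) *: ev (psi u) =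
      ev (phi u' - phi u - (u' - u) *: psi u).
    by apply: vec2P; rewrite /ev !mxE; ring.
  by apply: le_trans (ev_le _) _; rewrite -/N -mulrA ler_wpM2l // rem.
- by move=> u /le1 ur; rewrite [in LHS]fe // /read evK subrK.
- move=> u ur; apply: hr; rewrite addrK.
  have ur1 : `|u| <= 1 by move: ur; rewrite !le_min => /and3P[].
  have ur2 : `|u| <= r / (N * (K + 1) + 1) by move: ur; rewrite !le_min => /and3P[].
  have h := rem 0 u; rewrite phi0 psi0 !subr0 normr0 in h.
  have {}h := h (ltW rho0) (le1 u ur).
  have n1 : `|pair2 1 0 : 'rV[R]_2| <= 1.
    by apply: rv_norm_le; rewrite ?pair2_0 ?pair2_1 ?normr1 ?normr0.
  have h2 : `|phi u| <= (K + 1) * `|u|.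
    rewrite -[phi u](subrK (u *: pair2 1 0)) (le_trans (ler_normD _ _)) // mulrDl mul1r.
    apply: lerD; last by rewrite normrZ ler_piMr.
    apply: le_trans h _; rewrite -real_normK ?num_real // expr2 ler_wpM2l //.
    by rewrite ler_piMl.
  apply: le_lt_trans (ev_le _) _; rewrite -/N.
  have h3 : N * `|phi u| <= N * ((K + 1) * `|u|) by rewrite ler_wpM2l.
  apply: le_lt_trans h3 _; rewrite mulrA.
  have [->|u0] := eqVneq u 0; first by rewrite normr0 mulr0.
  apply: lt_le_trans (_ : (N * (K + 1) + 1) * `|u| <= r); last first.
    by rewrite mulrC -ler_pdivlMr.
  by rewrite ltr_pM2r ?normr_gt0 // ltrDl.
Qed.

Let contract u m : `|lam ^+ m * u| <= `|u|.
Proof.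
have l1 : `|lam| <= 1 by apply: ltW; case/andP: lam0.
by rewrite normrM normrX ler_piMl // exprn_ile1.
Qed.

(** The local curve is extended to all parameters by its own functional equation
    [phi u = g^m (phi (lam^m * u))], with [m] so large that the right-hand side is
    defined. *)
Lemma stable_curve : exists phi : R -> 'rV[R]_2,
  [/\ phi 0 = x, forall u, P (phi u), forall u, f (phi u) = phi (lam * u) &
  [/\ forall u, exists D, @C11 R R V phi D u, derive1 phi 0 = vs,
    forall u, Df (phi u) (derive1 phi u) = lam *: derive1 phi (lam * u) &
    exists2 s : R, 0 < s & forall u u', `|u| < s -> `|u'| < s -> phi u = phi u' -> u = u']].
Proof.
have [rho [K [phi [psi [[rho0 K0] [phi0 psi0] rem fe Pphi]]]]] := local.
have l1 : `|lam| < 1 by case/andP: lam0.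
have small u : exists m, `|lam ^+ m * u| < rho.
  have [m hm] := geometric_small `|u| (normr_ge0 lam) l1 rho0.
  by exists m; rewrite normrM normrX mulrC.
have [m0 m0P] := choice small.
have smaller u k : `|u| <= rho -> `|lam ^+ k * u| <= rho.
  by move=> ur; apply: le_trans ur; exact: contract.
have gk k u : `|u| <= rho -> iter k g (phi (lam ^+ k * u)) = phi u.
  elim: k u => [|k IH] u ur; first by rewrite expr0 mul1r.
  rewrite iterSr exprS -mulrA -fe; last exact: smaller.
  exact: IH.
pose Phi u := iter (m0 u) g (phi (lam ^+ m0 u * u)).
have PhiE u k : `|lam ^+ k * u| <= rho -> Phi u = iter k g (phi (lam ^+ k * u)).
  move=> kr; have mr := ltW (m0P u).
  rewrite /Phi -(gk k _ mr) -(gk (m0 u) _ kr) -!iterD addnC.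
  by rewrite !mulrA -!exprD [(m0 u + k)%N]addnC.
have PPhi u : P (Phi u).
  by rewrite /Phi; apply: (flow_in (flow_iter _ (sys_bwd S))); apply: Pphi; exact: ltW.
have fPhi u : f (Phi u) = Phi (lam * u).
  have [m hm] := small u; have hm1 : `|lam ^+ m * (lam * u)| <= rho.
    by rewrite mulrCA -[lam in X in `|X|]expr1; apply: smaller; exact: ltW.
  have hmS : `|lam ^+ m.+1 * u| <= rho by rewrite exprSr -mulrA.
  rewrite (PhiE u m.+1 hmS) (PhiE _ m hm1) /= (sys_gK S) ?exprSr -?mulrA //.
  apply: (flow_in (flow_iter _ (sys_bwd S))); exact: Pphi.
have locC u : `|u| < rho -> @C11 R R V phi (fun u h => h *: psi u) u.
  by move=> ur; exact: curve_C11 ur rem.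
have globC u : exists D, @C11 R R V Phi D u.
  have [m hm] := small u.
  have c1 : @C11 R R R (fun u => lam ^+ m * u) (fun _ h => lam ^+ m * h) u.
    apply: (@C11_linear R R R _ `|lam ^+ m|) => // [k a b|w]; last by rewrite normrM.
    by rewrite /GRing.scale /=; ring.
  have c3 := C11_comp (C11_comp c1 (locC _ hm))
    (flow_C11 (flow_iter m (sys_bwd S)) (Pphi _ (ltW hm))).
  eexists; apply: C11_local c3 _; near=> t; rewrite -PhiE //.
  rewrite -[t](subrK u) mulrDr (le_trans (ler_normD _ _)) // normrM.
  have : `|t - u| < rho - `|lam ^+ m * u|.
    by near: t; apply: cvgr_distC_lt; rewrite ?subr_gt0.
  have : `|lam ^+ m| * `|t - u| <= 1 * `|t - u|.
    by rewrite ler_wpM2r // normrX exprn_ile1 // ltW.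
  by lra.
have z0 : `|0 : R| <= rho by rewrite normr0 ltW.
have Phi0 : Phi 0 = x by rewrite (PhiE 0 0%N) ?mulr0.
have dPhi0 : derive1 Phi 0 = vs.
  have c := locC 0 (le_lt_trans (eq_leR (normr0 _)) rho0).
  have c' : @C11 R R V Phi (fun u h => h *: psi u) 0.
    apply: C11_local c _; near=> t.
    have tr : `|t| < rho by rewrite -[t]subr0; near: t; exact: cvgr_distC_lt.
    by rewrite (PhiE t 0%N) mul1r // ltW.
  have [d _] := C11_curve c'.
  by rewrite derive1E (@derive_val _ _ _ _ _ _ _ d) psi0 scale1r.
exists Phi; split=> //; split=> //.
- move=> u; have [D1 c1] := globC u; have [D2 c2] := globC (lam * u).
  have [d1 _] := C11_curve c1; have [d2 _] := C11_curve c2.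
  have cl : @C11 R R R (fun u => lam * u) (fun _ h => lam * h) u.
    apply: (@C11_linear R R R _ `|lam|) => // [k a b|w]; last by rewrite normrM.
    by rewrite /GRing.scale /=; ring.
  have [e1 _] := C11_curve (C11_comp c1 (flow_C11 (sys_fwd S) (PPhi u))).
  have [e2 _] := C11_curve (C11_comp cl c2).
  have ee : (fun u => f (Phi u)) = (fun u => Phi (lam * u)) by apply/funext.
  rewrite ee in e1; have := @derive_val _ _ _ _ _ _ _ e1.
  rewrite (@derive_val _ _ _ _ _ _ _ e2) !derive1E.
  rewrite (@derive_val _ _ _ _ _ _ _ d1) (@derive_val _ _ _ _ _ _ _ d2) => <-.
  by have [_ sc] := C11_lin c2; rewrite -sc /GRing.scale.
- have vs0 : 0 < `|vs|.
    rewrite normr_gt0; apply: contraNneq vsu => ->.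
    by rewrite det2E !mxE !mul0r subrr.
  pose s := Num.min rho (`|vs| / (8 * (K + 1))).
  have K8 : 0 < 8 * (K + 1) by rewrite mulr_gt0 // ltr_wpDl.
  exists s; first by rewrite lt_min rho0 divr_gt0.
  move=> u u'; rewrite !lt_min => /andP[ur us] /andP[u'r u's].
  have E t : `|t| < rho -> Phi t = phi t.
    by move=> tr; rewrite (PhiE t 0%N) ?expr0 ?mul1r // ltW.
  rewrite !E // => e; apply/eqP; apply: contraT => uu'.
  have h1 := rem u u' (ltW ur) (ltW u'r); rewrite -e subrr sub0r normrN normrZ in h1.
  have h2 : `|psi u| <= K * `|u' - u|.
    rewrite -(ler_pM2l (_ : 0 < `|u' - u|)) ?normr_gt0 ?subr_eq0 1?eq_sym //.
    by apply: le_trans h1 _; rewrite [leRHS]mulrCA -expr2 real_normK ?num_real.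
  have h3 : `|vs - psi u| <= 2 * K * `|u|.
    have [->|u0] := eqVneq u 0; first by rewrite psi0 subrr !normr0 mulr0.
    have g1 := rem u 0 (ltW ur) z0; have g2 := rem 0 u z0 (ltW ur).
    rewrite -(ler_pM2l (_ : 0 < `|u|)) ?normr_gt0 // -normrZ.
    have -> : u *: (vs - psi u) =
        - ((phi 0 - phi u - (0 - u) *: psi u) + (phi u - phi 0 - (u - 0) *: psi 0)).
      by rewrite psi0; apply: vec2P; rewrite !mxE; ring.
    rewrite normrN; apply: le_trans (ler_normD _ _) _.
    move: g1 g2; rewrite !subr0 !sub0r sqrrN => g1 g2.
    by rewrite [leRHS]mulrCA -expr2 real_normK ?num_real //; lra.
  have h4 : `|vs| <= `|vs - psi u| + `|psi u| by rewrite -[in leLHS](subrK (psi u) vs) ler_normD.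
  have h5 : K * `|u' - u| <= K * (`|u'| + `|u|) by rewrite ler_wpM2l // ler_normB.
  have bound (t : R) : `|t| < `|vs| / (8 * (K + 1)) -> K * `|t| <= `|vs| / 8.
    move=> ts; apply: le_trans (_ : (K + 1) * `|t| <= _); first by rewrite ler_wpM2r // lerDl.
    have : (K + 1) * `|t| <= (K + 1) * (`|vs| / (8 * (K + 1))) by rewrite ler_wpM2l ?addr_ge0 // ltW.
    move=> h; apply: le_trans h _; apply: eq_leR; field.
    by rewrite gt_eqF // ltr_wpDl.
  have b1 := bound u us; have b2 := bound u' u's.
  by exfalso; lra.
Unshelve. all: by end_near. Qed.

(** A point whose forward orbit stays near the fixed point is on the curve: compare
    it with the point of the curve that has the same stable coordinate. *)
Lemma stable_curve_complete (phi : R -> 'rV[R]_2) : phi 0 = x ->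
    (forall u, f (phi u) = phi (lam * u)) ->
    (forall u, exists D, @C11 R R V phi D u) -> derive1 phi 0 = vs ->
  exists2 r : R, 0 < r & forall q, (forall m, `|iter m f q - x| < r) ->
    exists u, q = phi u.
Proof.
move=> phi0 fphi cphi dphi.
have Df0 w : Dread Df 0 w = pair2 (lam * w 0 0) (mu * w 0 1).
  apply: lin_ev Dvs Dvu; last exact: Df_lin.2.
  exact: (flow_C11 (sys_fwd S) Px).1.
have l1 : `|lam| < 1 by case/andP: lam0.
have m1 : 1 < `|mu| by rewrite muE normfV invf_gt1 //; case/andP: lam0.
have [r r0 hr] := unstable_cone_expansion (C11_read (flow_C11 (sys_fwd S) Px)) l1 m1 Df0.
have readit m q : iter m (read f) (co (q + - x)) = co (iter m f q + - x).
  by elim: m => //= m ->; rewrite /read evK subrK.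
pose h u := co (phi u + - x).
have ch u : exists D, @C11 R R V h D u.
  have [D1 c1] := cphi u; have c2 := C11_add c1 (@C11_cst R R V (- x) u).
  by have c3 := C11_comp c2 (C11_co _); eexists; exact: c3.
have h0 : h 0 = 0 by rewrite /h phi0 subrr co0.
have ch1 : continuous (fun u => h u 0 0).
  move=> u; have [D1 c1] := ch u; have c2 := C11_comp c1 (C11_coord 0 _).
  exact: C11_cont c2.
have dh0 : is_derive (0 : R) (1 : R) (fun u => h u 0 0) (1 : R).
  have [D1 c1] := cphi 0; have c2 := C11_add c1 (@C11_cst R R V (- x) 0).
  have c3 := C11_comp (C11_comp c2 (C11_co _)) (C11_coord 0 _).
  have [d1 _] := C11_curve c1.
  have e1 : D1 0 1 = vs by rewrite -dphi derive1E (@derive_val _ _ _ _ _ _ _ d1).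
  have dd0 : is_derive (0 : R) 1 (fun u => h u 0 0) (co (D1 0 1 + 0) 0 0).
    by have [Dc [rc [Cc [rc0 Cc0 H1 _ _]]]] := c3; apply: (@is_derive_quadratic R R _ 0 _ rc Cc) => // t tr;
      have := H1 0 t; rewrite !subr0 normr0 add0r => /(_ rc0 tr);
      rewrite -[t ^+ 2]real_normK ?num_real //;
      have [_ sc] := C11_lin c3; have := sc 0 t 1; rewrite /GRing.scale /= mulr1 => ->.
  apply: isD_eq dd0 _; rewrite addr0 e1 /co pair2_0 divff //.
have [s s0 hs] : exists2 s : R, 0 < s & forall u, `|u| <= s -> `|h u| < r.
  have [D1 c1] := ch 0; have [t [L [t0 L0 HL]]] := C11_lip c1.
  have t02 : 0 < t / 2 by rewrite divr_gt0.
  exists (Num.min (t / 2) (r / (2 * (L + 1)))).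
    by rewrite lt_min t02 divr_gt0 // mulr_gt0 // ltr_wpDl.
  move=> u; rewrite le_min => /andP[ut ur].
  have ut' : `|u - 0| < t by rewrite subr0; lra.
  have := HL 0 u _ ut'; rewrite h0 !subr0 normr0 => /(_ t0) hl.
  apply: le_lt_trans hl _; apply: le_lt_trans (_ : (L + 1) * `|u| < _).
    by rewrite ler_wpM2r // lerDl.
  have : (L + 1) * `|u| <= (L + 1) * (r / (2 * (L + 1))) by rewrite ler_wpM2l // addr_ge0.
  have -> : (L + 1) * (r / (2 * (L + 1))) = r / 2.
    by field; rewrite gt_eqF // ltr_wpDl.
  by lra.
have dneg : is_derive (0 : R) (1 : R) (fun u => - h u 0 0) (- 1 : R) by exact: is_deriveN.
have [|t t0 ht] := derive_lt0_local dneg; first by rewrite oppr_lt0.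
pose a := Num.min s (t / 2).
have a0 : 0 < a by rewrite lt_min s0 divr_gt0.
have as_ : a <= s by rewrite ge_min lexx.
have at_ : a < t.
  by have : a <= t / 2 by [rewrite ge_min lexx orbT]; lra.
have h00 : h 0 0 0 = 0 by rewrite h0 mxE.
have ha : 0 < h a 0 0.
  have [|/(_ a0) + _] := ht a; first by rewrite subr0 gtr0_norm.
  by rewrite h00 ltrN2.
have hna : h (- a) 0 0 < 0.
  have [|_ +] := ht (- a); first by rewrite subr0 normrN gtr0_norm.
  by rewrite oppr_lt0 h00 ltrN2; apply.
pose b := Num.min (h a 0 0) (- h (- a) 0 0).
have b0 : 0 < b by rewrite lt_min ha oppr_gt0.
pose N := 2 * `|vu| / `|D| + 2 * `|vs| / `|D|.
have N0 : 0 <= N by rewrite addr_ge0 // !mulr_ge0 ?invr_ge0.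
have N1 : 0 < N + 1 by rewrite ltr_wpDl.
exists (Num.min r b / (N + 1)); first by rewrite divr_gt0 // lt_min r0.
move=> q hq.
have hqc m : `|co (iter m f q + - x)| < Num.min r b.
  apply: le_lt_trans (co_le _) _; rewrite -/N.
  apply: le_lt_trans (_ : (N + 1) * `|iter m f q - x| < _); first by rewrite ler_wpM2r // lerDl.
  by rewrite -ltr_pdivlMl // mulrC; exact: hq.
have q00 : `|co (q + - x) 0 0| < b.
  by apply: le_lt_trans (coord_norm_le _ _) _; have := hqc 0%N; rewrite lt_min => /andP[].
move: q00; rewrite ltr_norml lt_min => /andP[q1 /andP[q2 q3]].
have b1 : b <= h a 0 0 by rewrite ge_min lexx.
have b2 : h (- a) 0 0 <= - b by rewrite lerNr ge_min lexx orbT.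
have [u ur hu] : exists2 u : R, - a <= u <= a & h u 0 0 = co (q + - x) 0 0.
  apply: IVT_le ch1 _ _; first lra.
  move: (h a 0 0) (h (- a) 0 0) (co (q + - x) 0 0) b b1 b2 q1 q2 q3 {b0 hq hqc ha hna}.
  by move=> A B X b' ???? ?; lra.
have us m : `|lam ^+ m * u| <= s.
  apply: le_trans (contract _ m) _; rewrite (le_trans _ as_) // ler_norml.
  by case/andP: ur => -> ->.
have iterphi m : iter m f (phi u) = phi (lam ^+ m * u).
  elim: m => [|m IH]; first by rewrite mul1r.
  by rewrite iterS IH fphi mulrA exprS.
have e : co (q + - x) = h u.
  apply: hr; rewrite ?hu // => m; rewrite readit.
    by have := hqc m; rewrite lt_min => /andP[].
  by rewrite iterphi; apply: hs; exact: us.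
exists u; apply: (addIr (- x)); rewrite -(evK (q + - x)) -(evK (phi u + - x)).
by rewrite e.
Qed.

End FixedPoint.

Section CylinderDistance.
Context {R : realType}.
Implicit Types (p q : 'rV[R]_2) (j : int).

Let dist_lbound p q : has_inf [set `|p - q - cyl_shift j| | j in [set: int]].
Proof.
split; first by exists `|p - q - cyl_shift 0|, 0.
by exists 0 => _ [j _ <-].
Qed.

Lemma cyl_dist_ge0 p q : 0 <= cyl_dist p q.
Proof.
apply: lb_le_inf; first by case: (dist_lbound p q).
by move=> _ [j _ <-].
Qed.

Lemma cyl_dist_le p q j : cyl_dist p q <= `|p - q - cyl_shift j|.
Proof. by apply: ge_inf; [case: (dist_lbound p q) | exists j]. Qed.

Lemma cyl_dist_lt p q (e : R) : cyl_dist p q < e -> exists j, `|p - q - cyl_shift j| < e.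
Proof.
move=> h; have e0 : 0 < e - cyl_dist p q by rewrite subr_gt0.
have [_ [j _ <-]] := inf_adherent e0 (dist_lbound p q).
by rewrite [ltRHS]addrC subrK => hj; exists j.
Qed.

End CylinderDistance.

Section PeriodicPoint.
Context {R : realType}.
Notation V := ('rV[R]_2 : normedModType R).
Implicit Types (p q v w z : 'rV[R]_2) (m i : nat) (u : R) (j : int).

Definition stable_set (P : set 'rV[R]_2) (f : 'rV[R]_2 -> 'rV[R]_2) x : set 'rV[R]_2 :=
  [set z | P z /\ cyl_dist (iter m f z) (iter m f x) @[m --> \oo] --> (0 : R)].

Lemma DiterD f Df (a b : nat) p v :
  Diter f Df (a + b) p v = Diter f Df a (iter b f p) (Diter f Df b p v).
Proof. by elim: a => //= a ->; rewrite iterD. Qed.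

Context (P : set 'rV[R]_2) (f g : 'rV[R]_2 -> 'rV[R]_2)
  (Df Dg : 'rV[R]_2 -> 'rV[R]_2 -> 'rV[R]_2) (S : system P f g Df Dg).
Context (x : 'rV[R]_2) (Px : P x) (n : nat) (n0 : (0 < n)%N).
Context (j0 : int) (per : iter n f x = x + cyl_shift j0).
Context (lam mu : R) (vs vu : 'rV[R]_2).
Context (lam0 : 0 < `|lam| < 1) (lammu : lam * mu = 1) (vsu : det2 vs vu != 0).
Context (Dvs : Diter f Df n x vs = lam *: vs) (Dvu : Diter f Df n x vu = mu *: vu).

Let F p := iter n f p + cyl_shift (- j0).
Let G p := iter n g p + cyl_shift (- - j0).
Let SF : system P F G (Diter f Df n) (Diter g Dg n) := system_power n (- j0) S.
Let Fx : F x = x.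
Proof. by rewrite /F per -addrA cyl_shiftD subrr cyl_shift0 addr0. Qed.

Let fn i := flow_iter i (sys_fwd S).
Let Fn i := flow_iter i (sys_fwd SF).

Let iterF m : exists j, forall p, P p -> iter (m * n) f p = iter m F p + cyl_shift j.
Proof.
elim: m => [|m [j IH]]; first by exists 0 => p _; rewrite mul0n cyl_shift0 addr0.
exists (j + j0) => p Pp; rewrite mulSn iterD IH // (flow_shift (fn n)); last exact: (flow_in (Fn m)).
rewrite (_ : iter m.+1 F p = iter n f (iter m F p) + cyl_shift (- j0)) //.
rewrite -[RHS]addrA cyl_shiftD; congr (_ + cyl_shift _).
by rewrite addrCA addNr addr0.
Qed.

(** The curve conjugates the return map to [u |-> lam * u].  It is injective on the
    cylinder because iteration brings two parameters near 0, where it is injective.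
    It is the whole stable set because an orbit asymptotic to that of [x] on the
    cylinder eventually stays near one and the same lift of it: consecutive lifts
    differ by less than a deck translation. *)
Theorem stable_manifold : exists phi : R -> 'rV[R]_2,
  [/\ immersed_curve (stable_set P f x) phi, phi 0 = x /\ derive1 phi 0 = vs,
    forall u, P (phi u) /\ exists D, @C11 R R V phi D u &
    forall m, exists j, forall u, iter (m * n) f (phi u) = phi (lam ^+ m * u) + cyl_shift j /\
      Diter f Df (m * n) (phi u) (derive1 phi u) = lam ^+ m *: derive1 phi (lam ^+ m * u)].
Proof.
have [phi [phi0 Pphi Fphi [cphi dphi Dphi [s s0 inj]]]] :=
  stable_curve SF Px Fx lam0 lammu vsu Dvs Dvu.
have [r r0 compl] :=
  stable_curve_complete SF Px lam0 lammu vsu Dvs Dvu phi0 Fphi cphi dphi.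
have [l0 l1] := andP lam0.
have lam_n0 : lam != 0 by rewrite -normr_gt0.
have small u (d : R) : 0 < d -> exists m, forall m', (m <= m')%N -> `|lam ^+ m' * u| < d.
  move=> d0; have [m hm] := geometric_small `|u| (normr_ge0 lam) l1 d0.
  exists m => m' mm'; apply: le_lt_trans hm.
  by rewrite normrM normrX mulrC ler_wpM2l // ler_wiXn2l // ltW.
have iterphi m u : iter m F (phi u) = phi (lam ^+ m * u).
  elim: m => [|m IH]; first by rewrite mul1r.
  by rewrite iterS IH Fphi mulrA exprS.
have Diterphi m u : Diter f Df (m * n) (phi u) (derive1 phi u) =
    lam ^+ m *: derive1 phi (lam ^+ m * u).
  elim: m => [|m IH]; first by rewrite mul0n expr0 mul1r scale1r.
  have [j hj] := iterF m.
  rewrite mulSn DiterD IH (hj (phi u) (Pphi u)) iterphi.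
  rewrite (flow_Dshift (fn n) _ _ (Pphi (lam ^+ m * u))).
  have [_ sc] := C11_lin (flow_C11 (fn n) (Pphi u)).
  by rewrite sc Dphi scalerA -exprSr mulrA -exprS.
have dn0 : exists2 d : R, 0 < d & forall u, `|u| < d -> derive1 phi u != 0.
  have [D1 c1] := cphi 0; have [_ cd] := C11_curve c1.
  have vs0 : 0 < `|vs|.
    by rewrite normr_gt0; apply: contraNneq vsu => ->; rewrite det2E !mxE !mul0r subrr.
  move/cvgrPdist_lt/(_ _ vs0)/nbhs_ballP: cd => [d /= d0 hd].
  exists d => // u ud; apply/eqP => e.
  by have := hd u; rewrite /ball /= sub0r normrN e subr0 dphi ltxx => /(_ ud).
have phi_near k (e : R) : 0 < e -> exists2 d : R, 0 < d & forall i u, (i < k)%N -> `|u| < d ->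
    `|iter i f (phi u) - iter i f x| < e.
  move=> e0; elim: k => [|k [d d0 hd]]; first by exists 1.
  have [D1 c1] := cphi 0; have c0 : @C11 R V V (iter k f) (Diter f Df k) (phi 0).
    by rewrite phi0; exact: (flow_C11 (fn k) Px).
  have cc := C11_cont (C11_comp c1 c0).
  move/cvgrPdist_lt/(_ _ e0)/nbhs_ballP: cc => [d' /= d'0 hd'].
  exists (Num.min d d'); first by rewrite lt_min d0.
  move=> i u; rewrite lt_min ltnS leq_eqVlt => /orP[/eqP -> /andP[_ ud]|ik /andP[ud _]].
    by have := hd' u; rewrite /ball /= sub0r normrN phi0 distrC; apply.
  exact: hd.
exists phi; split=> //; last first.
  move=> m; have [j hj] := iterF m; exists j => u; split; last exact: Diterphi.
  by rewrite hj // iterphi.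
split.
- by move=> u; have [D1 c1] := cphi u; have [d _] := C11_curve c1; exact: ex_derive.
- by move=> u; have [D1 c1] := cphi u; have [_ cd] := C11_curve c1.
- move=> u; have [d d0 hd] := dn0; have [m hm] := small u d d0.
  apply: contra_neq (hd _ (hm m (leqnn m))) => e.
  have := Diterphi m u; rewrite e (_ : Diter _ _ _ _ 0 = 0); last first.
    have [_ sc] := C11_lin (flow_C11 (fn (m * n)%N) (Pphi u)).
    by have := sc (phi u) 0 0; rewrite !scale0r.
  by move/esym/eqP; rewrite scaler_eq0 expf_eq0 (negbTE lam_n0) andbF => /eqP.
- move=> u v [j e].
  have [d d0 hd] := phi_near n (2^-1) (ltac:(by rewrite invr_gt0)).
  have [m1 hm1] := small u (Num.min d s) (ltac:(by rewrite lt_min d0)).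
  have [m2 hm2] := small v (Num.min d s) (ltac:(by rewrite lt_min d0)).
  pose m := maxn m1 m2.
  have := hm1 m (leq_maxl _ _); rewrite lt_min => /andP[ud us].
  have := hm2 m (leq_maxr _ _); rewrite lt_min => /andP[vd vss].
  have em : phi (lam ^+ m * u) = phi (lam ^+ m * v) + cyl_shift j.
    by rewrite -!iterphi e (flow_shift (Fn m)).
  have j00 : j = 0.
    apply/eqP; apply: contraT => jn0.
    have h1 := hd 0%N _ n0 ud; have h2 := hd 0%N _ n0 vd; rewrite /= in h1 h2.
    have := cyl_shift_norm jn0 (R := R).
    rewrite (_ : cyl_shift j = (phi (lam ^+ m * u) - x) - (phi (lam ^+ m * v) - x)); last first.
      by rewrite em opprB addrA subrK addrC addKr.
    move/lt_le_trans/(_ (ler_normB _ _)); lra.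
  have := inj _ _ us vss; rewrite em j00 cyl_shift0 addr0 => /(_ erefl).
  by apply: mulfI; rewrite expf_neq0.
- apply/seteqP; split=> z.
    move=> [Pz cz].
    have [t [K [t0 K0 lip]]] := C11_lip (flow_C11 (sys_fwd SF) Px).
    pose e := Num.min (Num.min r t) (1 / (K + 1)).
    have e0 : 0 < e by rewrite !lt_min r0 t0 divr_gt0 // ltr_wpDl.
    move/cvgrPdist_lt/(_ _ e0): cz => [M _ hM].
    have near m : (M <= m)%N -> exists j, `|iter m F z - x - cyl_shift j| < e.
      move=> Mm; have [j hj] := iterF m.
      have Mmn : (M <= m * n)%N by rewrite (leq_trans Mm) // leq_pmulr.
      have := hM _ Mmn; rewrite /= sub0r normrN ger0_norm ?cyl_dist_ge0 //.
      move/cyl_dist_lt => [j' h]; exists j'; move: h; rewrite (hj z Pz) (hj x Px) (iter_fix m Fx).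
      by rewrite opprD addrACA subrr addr0.
    have [js hjs] : exists js : nat -> int, forall m, (M <= m)%N ->
        `|iter m F z - x - cyl_shift (js m)| < e.
      have : forall m, exists j, (M <= m)%N -> `|iter m F z - x - cyl_shift j| < e.
        by move=> m; case: (leqP M m) => [/near[j hj]|_]; [exists j | exists 0].
      by case/choice => js hjs; exists js.
    (* the index of the nearby lift cannot jump *)
    have const m : js (M + m)%N = js M.
      elim: m => [|m IH]; first by rewrite addn0.
      rewrite -[RHS]IH addnS; apply/eqP; rewrite -subr_eq0; apply: contraT => jn0.
      have h1 := hjs (M + m)%N (leq_addr _ _).
      have h2 := hjs (M + m).+1 (leqW (leq_addr _ _)).
      set q := iter (M + m) F z in h1; rewrite iterS -/q in h2.
      set j1 := js (M + m)%N in h1 jn0 *; set j2 := js (M + m).+1 in h2 jn0 *.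
      have Pq : P q by exact: (flow_in (Fn _)).
      have et : e <= t by rewrite !ge_min lexx orbT.
      have h3 := lip x (q + cyl_shift (- j1)).
      have e1 : q + cyl_shift (- j1) - x = q - x - cyl_shift j1 by rewrite cyl_shiftN addrAC.
      rewrite subrr normr0 e1 (flow_shift (sys_fwd SF)) // Fx cyl_shiftN in h3.
      have {}h3 := h3 t0 (lt_le_trans h1 et).
      have ek : e <= 1 / (K + 1) by rewrite ge_min lexx orbT.
      have h4 : (K + 1) * e <= 1 by rewrite mulrC -ler_pdivlMr // ltr_wpDl.
      have := cyl_shift_norm jn0 (R := R).
      rewrite (_ : cyl_shift (j2 - j1) =
          (F q - cyl_shift j1 - x) - (F q - x - cyl_shift j2)); last first.
        rewrite -cyl_shiftD cyl_shiftN; move: (cyl_shift _) (cyl_shift _) (F q) => A B C.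
        by apply: vec2P; rewrite !mxE; ring.
      move/lt_le_trans/(_ (ler_normB _ _)).
      have h5 : K * `|q - x - cyl_shift j1| <= K * e by rewrite ler_wpM2l // ltW.
      rewrite mulrDl mul1r in h4.
      by move: h2 h3 h4 h5; move: (`|_|) (`|_|) (`|_|) (K * e) => A B C D; lra.
    pose q := iter M F z + cyl_shift (- js M).
    have Pq : P q by apply: (sys_shift SF); exact: (flow_in (Fn _)).
    have [u hu] : exists u, q = phi u.
      apply: compl => m; rewrite (flow_shift (Fn m)); last exact: (flow_in (Fn _)).
      have := hjs (m + M)%N (leq_addl _ _); rewrite [in js _]addnC const iterD.
      rewrite cyl_shiftN addrAC => /lt_le_trans; apply.
      by rewrite !ge_min lexx.
    exists (lam ^- M * u), (js M).
    have h : iter M F (z + cyl_shift (- js M)) = iter M F (phi (lam ^- M * u)).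
      by rewrite iterphi mulrA mulfV ?expf_neq0 // mul1r -hu (flow_shift (Fn M)).
    have FK := iter_cancel M (flow_in (sys_fwd SF)) (sys_fK SF).
    have Pz' : P (z + cyl_shift (- js M)) by exact: (sys_shift SF).
    have := congr1 (iter M G) h; rewrite !FK // => <-.
    by rewrite -addrA cyl_shiftD addNr cyl_shift0 addr0.
  move=> [u [j ->]]; split; first exact: (sys_shift SF).
  apply/cvgrPdist_lt => e e0; have [d d0 hd] := phi_near n e e0.
  have [M hM] := small u d d0; exists (M * n)%N => // m /= Mm.
  rewrite sub0r normrN ger0_norm ?cyl_dist_ge0 //; apply: le_lt_trans (cyl_dist_le _ _ j) _.
  have [j' hj'] := iterF (m %/ n)%N.
  rewrite (flow_shift (fn m) j (Pphi u)) addrAC addrK.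
  rewrite (divn_eq m n) addnC !iterD (hj' _ (Pphi u)) (hj' x Px) (iter_fix _ Fx) iterphi.
  rewrite (flow_shift (fn _) _ (Pphi _)) (flow_shift (fn _) _ Px) opprD addrACA subrr addr0.
  by apply: hd; [rewrite ltn_mod | apply: hM; rewrite leq_divRL].
Qed.

End PeriodicPoint.

(** * Eigenvectors of area-preserving hyperbolic matrices *)

Section Hyperbolicity.
Context {R : realType}.
Notation V := ('rV[R]_2 : normedModType R).
Implicit Types (p q v w : 'rV[R]_2).

Lemma det_mx2 (F : comNzRingType) (M : 'M[F]_2) :
  \det M = M 0 0 * M 1 1 - M 0 1 * M 1 0.
Proof.
rewrite (expand_det_row _ 0) !big_ord_recl big_ord0 addr0 /cofactor.
rewrite !det_mx11 !mxE /= !expr0 !mul1r /bump /= expr1.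
have -> : lift (0 : 'I_2) 0 = 1 by exact: val_inj.
have -> : lift (1 : 'I_2) 0 = 0 by exact: val_inj.
by rewrite mulN1r mulrN.
Qed.

Lemma eigenvalue_mx2 (F : fieldType) (M : 'M[F]_2) (a : F) :
  a ^+ 2 - (M 0 0 + M 1 1) * a + \det M = 0 -> eigenvalue M a.
Proof.
move=> h; rewrite /eigenvalue /eigenspace kermx_eq0 row_free_unit unitmxE unitfE negbK.
by rewrite -h !det_mx2 !mxE /= !mulr1n !mulr0n; apply/eqP; ring.
Qed.

Lemma det2_colinear v w : det2 v w = 0 -> v != 0 -> exists k : R, w = k *: v.
Proof.
rewrite det2E => h v0; have [v00|v00] := eqVneq (v 0 0) 0.
  have v01 : v 0 1 != 0.
    by apply: contra_neq v0 => v01; apply: vec2P; rewrite ?v00 ?v01 mxE.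
  exists (w 0 1 / v 0 1); apply: vec2P; rewrite !mxE; last by rewrite divfK.
  move: h; rewrite v00 mulr0 mul0r sub0r => /eqP; rewrite oppr_eq0 mulf_eq0 (negbTE v01).
  by move/eqP.
exists (w 0 0 / v 0 0); apply: vec2P; rewrite !mxE; first by rewrite divfK.
by apply: (mulfI v00); move/subr0_eq: h => ->; rewrite mulrA mulrCA mulfV // mulr1 mulrC.
Qed.

(** With determinant 1 and trace [tau], the eigenvalues lie on the unit circle when
    [tau ^+ 2 <= 4] and are real and inverse to each other otherwise. *)
Lemma hyperbolic_eigenvectors (M : 'M[R]_2) : \det M = 1 ->
    (forall lambda : R[i], eigenvalue (map_mx (real_complex R) M) lambda -> `|lambda| != 1) ->
  exists (lam mu : R) (vs vu : 'rV[R]_2),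
    [/\ 0 < `|lam| < 1, lam * mu = 1, det2 vs vu != 0,
      vs *m M = lam *: vs & vu *m M = mu *: vu].
Proof.
move=> dM hyp; pose tau := M 0 0 + M 1 1.
have [tau2|tau2] := lerP (tau ^+ 2) 4.
  pose s := Num.sqrt (1 - tau ^+ 2 / 4).
  have s2 : s ^+ 2 = 1 - tau ^+ 2 / 4 by rewrite sqr_sqrtr //; lra.
  have /hyp/negP[] : eigenvalue (map_mx (real_complex R) M) (Complex (tau / 2) s).
    apply: eigenvalue_mx2; rewrite det_map_mx dM !mxE rmorph1 -rmorphD -/tau.
    apply/eqP; rewrite eq_complex expr2 /=; apply/andP; split; apply/eqP.
      by rewrite -!expr2 s2; field.
    by field.
  have n1 : (tau / 2) ^+ 2 + (1 - tau ^+ 2 / 4) = 1 by field.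
  by rewrite normc_def /= s2 n1 sqrtr1.
pose s := Num.sqrt (tau ^+ 2 - 4).
have s2 : s ^+ 2 = tau ^+ 2 - 4 by rewrite sqr_sqrtr //; lra.
have s0 : 0 < s by rewrite sqrtr_gt0 subr_gt0.
(* the sign of the trace, which selects the eigenvalue of modulus less than 1 *)
pose e : R := if 0 < tau then 1 else -1.
have e2 : e ^+ 2 = 1 by rewrite /e; case: ifP => _; ring.
have et : 0 < e * tau.
  rewrite /e; have [h|h|h] := ltrgtP 0 tau; rewrite ?mul1r ?mulN1r ?oppr_gt0 //.
  by move: tau2; rewrite -h expr0n /= => ?; lra.
pose lam := (tau - e * s) / 2; pose mu := (tau + e * s) / 2.
have lm : lam * mu = 1.
  have -> : lam * mu = (tau ^+ 2 - e ^+ 2 * s ^+ 2) / 4 by rewrite /lam /mu; field.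
  by rewrite e2 s2; field.
have lam_n0 : lam != 0 by apply: contraTneq isT => h; move: lm; rewrite h mul0r => /eqP; rewrite eq_sym oner_eq0.
have lamE : lam ^+ 2 - tau * lam + 1 = 0.
  have -> : tau = lam + mu by rewrite /lam /mu; field.
  by rewrite -lm; ring.
have muE : mu ^+ 2 - tau * mu + 1 = 0.
  have -> : tau = lam + mu by rewrite /lam /mu; field.
  by rewrite -lm; ring.
have lt_lm : `|lam| < `|mu|.
  rewrite -(ltr_pXn2r (n := 2)) ?nnegrE // !real_normK ?num_real // -subr_gt0.
  have -> : mu ^+ 2 - lam ^+ 2 = e * tau * s by rewrite /lam /mu; field.
  by rewrite mulr_gt0.
have /eigenvalueP[vs Mvs vs0] : eigenvalue M lam.
  by apply: eigenvalue_mx2; rewrite dM -/tau.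
have /eigenvalueP[vu Mvu vu0] : eigenvalue M mu.
  by apply: eigenvalue_mx2; rewrite dM -/tau.
exists lam, mu, vs, vu; split=> //.
  rewrite normr_gt0 lam_n0 /=; have h : `|lam| * `|mu| = 1 by rewrite -normrM lm normr1.
  rewrite ltNge; apply/negP => l1.
  have : 1 < `|mu| by exact: le_lt_trans lt_lm.
  have : `|mu| <= `|lam| * `|mu| by rewrite ler_peMl.
  by rewrite h; lra.
apply/eqP => /det2_colinear/(_ vs0)[k vuE]; move: Mvu; rewrite vuE -scalemxAl Mvs !scalerA.
move/eqP; rewrite -subr_eq0 -scalerBl scaler_eq0 (negbTE vs0) orbF [mu * k]mulrC -mulrBr mulf_eq0.
case/orP=> [/eqP k0|]; first by rewrite vuE k0 scale0r eqxx in vu0.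
by rewrite subr_eq0 => /eqP lmE; rewrite lmE ltxx in lt_lm.
Qed.

Lemma C11_jacobian (F : 'rV[R]_2 -> 'rV[R]_2) DF x w : @C11 R V V F DF x ->
  w *m jacobian F x = DF x w.
Proof.
move=> cF; have [addD scaleD] := C11_lin cF.
have [_ [r [C [r0 C0 H1 _ H3]]]] := cF.
pose M : 'M[R]_2 := \matrix_(i, j) DF x (delta_mx 0 i) 0 j.
have DE v : DF x v = v *m M.
  have -> : DF x v = v 0 0 *: DF x (delta_mx 0 0) + DF x (v 0 1 *: delta_mx 0 1).
    by rewrite -cF.1; congr (DF x _); apply: vec2P; rewrite !mxE /=; ring.
  rewrite scaleD; apply: vec2P; rewrite !mxE !big_ord_recl big_ord0 !mxE /=.
    by rewrite addr0 (_ : lift _ _ = 1) //; exact: val_inj.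
  by rewrite addr0 (_ : lift _ _ = 1) //; exact: val_inj.
rewrite mul_rV_lin1 DE.
have -> : 'd F x = mulmxr M :> (V -> V); last by [].
apply: diff_unique.
  have cD : continuous (DF x).
    move=> v; apply: (@C11_cont R V V _ (fun _ => DF x)).
    apply: C11_linear C0 _ _ => [k u u'|u]; first exact: cF.1.
    by apply: H3; rewrite subrr normr0.
  have e : DF x = mulmxr M by apply/funext => u; rewrite DE.
  by rewrite e in cD.
apply/eqaddoP => _/posnumP[e].
have e0 : 0 < e%:num / (C + 1) by rewrite divr_gt0 // ltr_wpDl.
near=> h.
have hr : `|h| < r by rewrite -[h]subr0; near: h; exact: cvgr_distC_lt.
have he : `|h| < e%:num / (C + 1).
  by rewrite -[h]subr0; near: h; exact: cvgr_distC_lt.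
have := H1 x (h + x); rewrite subrr normr0 addrK => /(_ r0 hr) h1.
rewrite /= /cst !fctE /= -DE opprD addrA; apply: le_trans h1 _.
rewrite expr2 mulrA ler_wpM2r //; apply: le_trans (_ : (C + 1) * `|h| <= _).
  by rewrite ler_wpM2r // lerDl.
by rewrite mulrC -ler_pdivlMr ?ltr_wpDl // ltW.
Unshelve. all: by end_near. Qed.

End Hyperbolicity.

Section Saddles.
Context {R : realType}.
Notation V := ('rV[R]_2 : normedModType R).
Implicit Types (P : set 'rV[R]_2) (f g : 'rV[R]_2 -> 'rV[R]_2) (x v w : 'rV[R]_2).

(** A periodic point whose return map has the stable eigenvector [vs] of multiplier
    [lam] and the unstable eigenvector [vu] of multiplier [mu]; [j] is the number of
    turns around the cylinder in a period. *)
Record saddle P f (Df : 'rV[R]_2 -> 'rV[R]_2 -> 'rV[R]_2) x n (j : int) (lam mu : R) vs vu :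
    Prop := Saddle {
  sad_in : P x;
  sad_gt0 : (0 < n)%N;
  sad_per : iter n f x = x + cyl_shift j;
  sad_lam : 0 < `|lam| < 1;
  sad_mu : lam * mu = 1;
  sad_free : det2 vs vu != 0;
  sad_stable : Diter f Df n x vs = lam *: vs;
  sad_unstable : Diter f Df n x vu = mu *: vu }.

Lemma saddle_inv P f g Df Dg x n j lam mu vs vu : system P f g Df Dg ->
  saddle P f Df x n j lam mu vs vu -> saddle P g Dg x n (- j) lam mu vu vs.
Proof.
move=> S [Px n0 per l01 lm fr Dvs Dvu].
have G := flow_iter n (sys_bwd S).
have per' : iter n g x = x + cyl_shift (- j).
  have := iter_cancel n (flow_in (sys_fwd S)) (sys_fK S) Px.
  by rewrite per (flow_shift G _ Px) => e; rewrite -[in RHS]e cyl_shiftN addrK.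
have DK v : Diter g Dg n x (Diter f Df n x v) = v.
  by rewrite -[RHS](Diter_cancel n S v Px) per (flow_Dshift G).
have [_ sc] := C11_lin (flow_C11 G Px).
have lam_n0 : lam != 0 by case/andP: l01; rewrite normr_gt0.
split=> //.
- by rewrite det2C oppr_eq0.
- by rewrite -[in RHS](DK vu) Dvu sc scalerA lm scale1r.
- by rewrite -[in RHS](DK vs) Dvs sc scalerA mulrC lm scale1r.
Qed.

Lemma hyperbolic_saddle P f g Df Dg x n j : system P f g Df Dg ->
    P x -> (0 < n)%N -> iter n f x = x + cyl_shift j ->
    (forall lambda : R[i], eigenvalue (map_mx (real_complex R) (jacobian (iter n f) x)) lambda ->
      `|lambda| != 1) ->
  exists lam mu vs vu, saddle P f Df x n j lam mu vs vu.
Proof.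
move=> S Px n0 per hyp; have F := flow_iter n (sys_fwd S).
have JE w := C11_jacobian w (flow_C11 F Px).
have dJ : \det (jacobian (iter n f) x) = 1.
  rewrite det_mx2; have := flow_area F (delta_mx 0 0) (delta_mx 0 1) Px.
  by rewrite -!JE -!rowE !det2E !mxE /= => ->; ring.
have [lam [mu [vs [vu [l01 lm fr e1 e2]]]]] := hyperbolic_eigenvectors dJ hyp.
by exists lam, mu, vs, vu; split; rewrite // -JE.
Qed.

End Saddles.

(** * Small normal perturbations of a convex curve *)

Section RegionInterior.
Context {R : realType}.
Implicit Types (gamma : R -> 'rV[R]_2) (p q O : 'rV[R]_2) (A : set 'rV[R]_2).

Let convex A := forall p q (k : R), 0 <= k -> k <= 1 -> A p -> A q -> A (k *: p + (1 - k) *: q).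

Lemma convex_setP A : convex_set (M := 'rV[R]_2) A <-> convex A.
Proof.
split=> [cA p q k k0 k1 /mem_set Ap /mem_set Aq|cA p q l /set_mem Ap /set_mem Aq].
  exact: set_mem (cA p q (Itv01 k0 k1) Ap Aq).
by apply: mem_set; apply: (cA p q l%:inum).
Qed.

Lemma region_convex gamma : convex (region gamma).
Proof.
move=> p q k k0 k1 hp hq A [/convex_setP cA sA].
by apply: (cA p q k k0 k1); [apply: hp | apply: hq]; split=> //; apply/convex_setP.
Qed.

Lemma region_sub gamma A : convex A -> (forall t, A (gamma t)) -> region gamma `<=` A.
Proof.
by move=> cA sA p; apply; split; [apply/convex_setP | move=> _ [t _ <-]; exact: sA].
Qed.

Lemma region_curve gamma t : region gamma (gamma t).
Proof. by move=> A [_]; apply; exists t. Qed.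

(** Lets two horizontal segments and a vertical one replace barycentric coordinates
    in showing that four points near the corners of a square surround its centre. *)
Lemma convex_vertical A p q (u : R) : convex A -> A p -> A q -> p 0 0 <= u <= q 0 0 ->
  exists2 w, A w & w 0 0 = u /\ Num.min (p 0 1) (q 0 1) <= w 0 1 <= Num.max (p 0 1) (q 0 1).
Proof.
move=> cA Ap Aq /andP[pu uq].
have [e|pq] := eqVneq (p 0 0) (q 0 0).
  exists p => //; split; first by lra.
  by rewrite ge_min le_max lexx.
have d0 : 0 < q 0 0 - p 0 0 by rewrite subr_gt0 lt_neqAle pq (le_trans pu).
pose k := (q 0 0 - u) / (q 0 0 - p 0 0).
have k0 : 0 <= k by rewrite divr_ge0 ?subr_ge0 // (le_trans pu uq).
have k1 : k <= 1 by rewrite ler_pdivrMr // mul1r; lra.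
have k1' : 0 <= 1 - k by rewrite subr_ge0.
exists (k *: p + (1 - k) *: q); first exact: cA.
rewrite !mxE; split; first by rewrite /k; field; rewrite gt_eqF.
move: (p 0 1) (q 0 1) => a b.
have m1 : Num.min a b <= a by rewrite ge_min lexx.
have m2 : Num.min a b <= b by rewrite ge_min lexx orbT.
have M1 : a <= Num.max a b by rewrite le_max lexx.
have M2 : b <= Num.max a b by rewrite le_max lexx orbT.
move: (Num.min a b) (Num.max a b) m1 m2 M1 M2 => m M m1 m2 M1 M2.
have h1 : k * m <= k * a by rewrite ler_wpM2l.
have h2 : k * a <= k * M by rewrite ler_wpM2l.
have h3 : (1 - k) * m <= (1 - k) * b by rewrite ler_wpM2l.
have h4 : (1 - k) * b <= (1 - k) * M by rewrite ler_wpM2l.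
by apply/andP; split; lra.
Qed.

(** Being surrounded by the curve is stable: the corners of a small square around
    [O] are approximated by points of the new region, whose hull contains a
    smaller square. *)
Lemma region_interior_stable gamma O : (region gamma)° O ->
  exists2 d : R, 0 < d & forall gamma', (forall t, `|gamma' t - gamma t| <= d) ->
    (region gamma')° O.
Proof.
move=> /nbhs_ballP[r /= r0 hr]; exists (r / 4); first by rewrite divr_gt0.
move=> gamma' near.
have approx p : `|p - O| < r -> exists2 q, region gamma' q & `|p - q| <= r / 4.
  move=> pr; pose A := [set p | exists2 q, region gamma' q & `|p - q| <= r / 4].
  apply: (@region_sub gamma A) => [a b k k0 k1 [a' ha' ea] [b' hb' eb]|t|]; last 2 first.
  - by exists (gamma' t); [exact: region_curve | rewrite distrC].
  - by apply: hr; rewrite -ball_normE /= distrC.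
  exists (k *: a' + (1 - k) *: b'); first exact: region_convex.
  have -> : k *: a + (1 - k) *: b - (k *: a' + (1 - k) *: b') =
      k *: (a - a') + (1 - k) *: (b - b') by apply: vec2P; rewrite !mxE; ring.
  apply: le_trans (ler_normD _ _) _; rewrite !normrZ ger0_norm // ger0_norm ?subr_ge0 //.
  have h1 : k * `|a - a'| <= k * (r / 4) by rewrite ler_wpM2l.
  have h2 : (1 - k) * `|b - b'| <= (1 - k) * (r / 4) by rewrite ler_wpM2l ?subr_ge0.
  by lra.
have corner (a b : R) : `|a| <= r / 2 -> `|b| <= r / 2 -> exists2 q, region gamma' q &
    `|O 0 0 + a - q 0 0| <= r / 4 /\ `|O 0 1 + b - q 0 1| <= r / 4.
  move=> ar br; have [|q hq e] := approx (O + pair2 a b).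
    apply: le_lt_trans (_ : r / 2 < r); last by lra.
    by rewrite addrAC subrr add0r; apply: rv_norm_le; rewrite ?pair2_0 ?pair2_1 // divr_ge0 // ltW.
  by exists q => //; split; [have := coord_norm_le (O + pair2 a b - q) 0 |
    have := coord_norm_le (O + pair2 a b - q) 1]; rewrite !mxE /= => /le_trans; apply.
have h0 : `|r / 2| <= r / 2 by rewrite ger0_norm // divr_ge0 // ltW.
have h1 : `|- (r / 2)| <= r / 2 by rewrite normrN.
have [a ha [a0 a1]] := corner _ _ h0 h0.
have [b hb [b0 b1]] := corner _ _ h1 h0.
have [c hc [c0 c1]] := corner _ _ h0 h1.
have [d hd [d0 d1]] := corner _ _ h1 h1.
move: a0 a1 b0 b1 c0 c1 d0 d1; rewrite !ler_norml.
move=> /andP[a0 a0'] /andP[a1 a1'] /andP[b0 b0'] /andP[b1 b1'].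
move=> /andP[c0 c0'] /andP[c1 c1'] /andP[d0 d0'] /andP[d1 d1'].
apply/nbhs_ballP; exists (r / 4); first by rewrite /= divr_gt0.
move=> p; rewrite -ball_normE /= distrC => pr.
have := le_lt_trans (coord_norm_le (p - O) 0) pr.
have := le_lt_trans (coord_norm_le (p - O) 1) pr.
rewrite !mxE !ltr_norml => /andP[p1 p1'] /andP[p0 p0'].
have cR := @region_convex gamma'.
have [|u hu [u0 /andP[u1 _]]] := convex_vertical (u := p 0 0) cR hb ha.
  by clear -a0 b0' p0 p0' a0' b0; apply/andP; split; lra.
have [|v hv [v0 /andP[_ v1]]] := convex_vertical (u := p 0 0) cR hd hc.
  by clear -c0 d0' p0 p0' c0' d0; apply/andP; split; lra.
have u1' : p 0 1 <= u 0 1 by apply: le_trans u1; clear -a1 a1' b1 b1' p1 p1'; rewrite le_min; apply/andP; split; lra.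
have v1' : v 0 1 <= p 0 1 by apply: le_trans v1 _; clear -c1 c1' d1 d1' p1 p1'; rewrite ge_max; apply/andP; split; lra.
have [e|uv] := eqVneq (u 0 1) (v 0 1).
  by have -> : p = u; [clear -u0 u1' v1' e; apply: vec2P; lra | ].
have D0 : 0 < u 0 1 - v 0 1 by rewrite subr_gt0 lt_neqAle eq_sym uv (le_trans v1').
pose k := (p 0 1 - v 0 1) / (u 0 1 - v 0 1).
have -> : p = k *: u + (1 - k) *: v.
  apply: vec2P; rewrite !mxE ?u0 ?v0 /k; first by ring.
  by field; rewrite gt_eqF.
apply: cR => //; first by rewrite divr_ge0 ?subr_ge0 // (le_trans v1').
by rewrite ler_pdivrMr // mul1r; clear -u1'; lra.
Qed.

End RegionInterior.

Section Converse.
Context {R : realType}.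
Implicit Types (gamma : R -> 'rV[R]_2) (th : R -> R).

(** Only injectivity needs an argument: seen from the tangent line at a point, the
    height of the curve increases and then decreases over one turn. *)
Lemma convex_curve_strongly_convex gamma th : convex_curve gamma th -> strongly_convex gamma.
Proof.
move=> cc; split; [exact: cc_smooth cc | exact: cc_periodic cc | | |].
- move=> t1 t2 e; have P0 : 0 < 2 * pi :> R by rewrite mulr_gt0 ?pi_gt0.
  have [j] := period_representative t2 P0 t1.
  set u := t1 + _ => /andP[tu ut].
  have e' : gamma u = gamma t2 by rewrite /u (periodicz (cc_periodic cc)).
  suff h : u = t2 by exists (- j); rewrite -h /u rmorphN /= mulrN addrK.
  move: tu; rewrite le_eqVlt => /predU1P[//|tu]; exfalso.
  have es : ss gamma 0 t2 u = ss gamma 0 t2 t2 by rewrite /ss e'.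
  have [us|su] := lerP u (star gamma t2).
    by have := ss_decr cc 0 (lexx t2) tu us; rewrite es ltxx.
  have := @ss_incr _ _ _ cc 0 t2 (u - 2 * pi) t2.
  have -> : ss gamma 0 t2 (u - 2 * pi) = ss gamma 0 t2 t2.
    by rewrite -es -(ss_periodic cc 0 t2) subrK.
  by rewrite ltxx => h; suff : false by []; apply: h; lra.
- by move=> t; have := cc_speed cc t; rewrite /speed eucl_gt0.
- move=> t; rewrite /curvature divr_gt0 ?exprn_gt0 //; first exact: (cc_bending cc t).
  exact: (cc_speed cc t).
Qed.

End Converse.

Section Perturbation.
Context {R : realType}.
Implicit Types (f g : R -> R) (F G : R -> 'rV[R]_2) (t e : R).

Let P0 : 0 < 2 * pi :> R. Proof. by rewrite mulr_gt0 ?pi_gt0. Qed.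

Lemma smoothD f g : smooth f -> smooth g -> smooth (fun t => f t + g t).
Proof. by move=> /smoothE sf /smoothE sg; apply/smoothE => n; exact: CnD. Qed.

Lemma smoothM f g : smooth f -> smooth g -> smooth (fun t => f t * g t).
Proof. by move=> /smoothE sf /smoothE sg; apply/smoothE => n; exact: CnM. Qed.

Lemma smoothN f : smooth f -> smooth (fun t => - f t).
Proof. by move=> /smoothE sf; apply/smoothE => n; exact: CnN. Qed.

Lemma smoothB f g : smooth f -> smooth g -> smooth (fun t => f t - g t).
Proof. by move=> sf sg; exact: smoothD sf (smoothN sg). Qed.

Let sp f := smooth f /\ periodic f (2 * pi).

Let spB f g : sp f -> sp g -> sp (fun t => f t - g t).
Proof. by move=> [sf pf] [sg pg]; split; [exact: smoothB | move=> t; rewrite pf pg]. Qed.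

Let spD f g : sp f -> sp g -> sp (fun t => f t + g t).
Proof. by move=> [sf pf] [sg pg]; split; [exact: smoothD | move=> t; rewrite pf pg]. Qed.

Let spM f g : sp f -> sp g -> sp (fun t => f t * g t).
Proof. by move=> [sf pf] [sg pg]; split; [exact: smoothM | move=> t; rewrite pf pg]. Qed.

Let spc (c : R) : sp (fun=> c).
Proof. by split=> //; apply/smoothE => n; exact: Cn_cst. Qed.

Let sp_coord F i : smooth F -> periodic F (2 * pi) -> sp (fun t => F t 0 i).
Proof. by move=> sF pF; split; [exact: smooth_coord | move=> t; rewrite pF]. Qed.

Lemma quadratic_gt0 f g h : sp f -> sp g -> sp h -> (forall t, 0 < f t) ->
  exists2 e0 : R, 0 < e0 & forall e, 0 < e < e0 -> forall t, 0 < f t + e * g t + e ^+ 2 * h t.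
Proof.
move=> [sf pf] [sg pg] [sh ph] f0.
have [m m0 hm] := periodic_lower P0 pf (smooth_cont sf) f0.
have [M M0 hM] := periodic_bounded P0 pg (smooth_cont sg).
have [N N0 hN] := periodic_bounded P0 ph (smooth_cont sh).
have MN : 0 < M + N by rewrite addr_gt0.
exists (Num.min 1 (m / (M + N))); first by rewrite lt_min ltr01 divr_gt0.
move=> e; rewrite lt_min => /andP[e0 /andP[e1 em]] t.
have h1 : - M <= g t by have := hM t; rewrite ler_norml => /andP[].
have h2 : - N <= h t by have := hN t; rewrite ler_norml => /andP[].
have h3 : e * - M <= e * g t by rewrite ler_wpM2l // ltW.
have h4 : e ^+ 2 * - N <= e ^+ 2 * h t by rewrite ler_wpM2l // sqr_ge0.
have h5 : e * (M + N) < m by rewrite -ltr_pdivlMr.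
have h6 : e ^+ 2 * N <= e * N by rewrite ler_wpM2r ?ltW // expr2 gtr_pMr.
have := hm t; rewrite mulrDr in h5.
by rewrite !mulrN in h3 h4; lra.
Qed.

Lemma derive1_line (V : normedModType R) (F G : R -> V) e : smooth F -> smooth G ->
  derive1 (fun t => F t + e *: G t) = fun t => derive1 F t + e *: derive1 G t.
Proof.
move=> sF sG; apply/funext => t; have dF : derivable F t 1 := sF 0%N t.
have dG : derivable G t 1 := sG 0%N t.
have dZ : derivable (fun t => e *: G t) t 1 by exact: derivableZ.
by rewrite !derive1E (deriveD dF dZ) deriveZ.
Qed.

Lemma derive1n_scale (V : normedModType R) (G : R -> V) e n : smooth G ->
  derive1n n (fun t => e *: G t) = fun t => e *: derive1n n G t.
Proof.
move=> sG; elim: n => [|n IH]; first by rewrite /derive1n.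
rewrite derive1nS IH; apply/funext => t; rewrite derive1E deriveZ; last exact: sG.
by rewrite -derive1E -derive1nS.
Qed.

Lemma smooth_line F G e : smooth F -> smooth G -> smooth (fun t => F t + e *: G t).
Proof.
move=> sF sG; apply: coord_smooth => i; apply/smoothE => n.
apply: (@eq_Cn _ _ (fun t => F t 0 i + e * G t 0 i)).
  by apply/funext => t; rewrite !mxE.
by apply: CnD; [|apply: CnM; first exact: Cn_cst]; move: n; apply/smoothE; exact: smooth_coord.
Qed.

Lemma Ck_norm_lt F k (eta : R) : 0 < eta -> (forall j t, (j <= k)%N -> `|derive1n j F t| <= eta / 2) ->
  Ck_norm k F < eta.
Proof.
move=> eta0 h; apply: le_lt_trans (_ : eta / 2 < eta); last by lra.
rewrite /Ck_norm; apply: (big_ind (fun x => x <= eta / 2)) => [|a b ha hb|j _]; first by rewrite divr_ge0 // ltW.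
  by rewrite ge_max ha.
apply: ge_sup => [|_ [t _ <-]]; first by exists `|derive1n j F 0|, 0.
by apply: h; rewrite -ltnS.
Qed.

Lemma line_close (nu : R -> 'rV[R]_2) k (eta : R) : smooth nu -> periodic nu (2 * pi) ->
  0 < eta -> exists2 e0 : R, 0 < e0 & forall e, 0 < e < e0 ->
  (forall t, `|e *: nu t| <= eta) /\ Ck_norm k (fun t => e *: nu t) < eta.
Proof.
move=> snu pnu eta0.
have bound j : exists2 M : R, 0 < M & forall t, `|derive1n j nu t| <= M.
  have sj : smooth (derive1n j nu).
    by elim: j => [|j sj]; [exact: snu | rewrite derive1nS; exact: (smooth_derive1 sj)].
  have pj : periodic (derive1n j nu) (2 * pi) by elim: j {sj} => [|j pj];
    [exact: pnu | rewrite derive1nS; exact: (derive1_periodic pj)].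
  have bd i : exists2 M : R, 0 < M & forall t, `|derive1n j nu t 0 i| <= M.
    have [s p] := sp_coord i sj pj; exact: periodic_bounded P0 p (smooth_cont s).
  have [M M0 hM] := bd 0; have [N N0 hN] := bd 1.
  exists (M + N) => [|t]; first by rewrite addr_gt0.
  apply: rv_norm_le; first by rewrite addr_ge0 // ltW.
    by apply: le_trans (hM t) _; rewrite lerDl ltW.
  by apply: le_trans (hN t) _; rewrite lerDr ltW.
have [M M0 hM] : exists2 M : R, 0 < M & forall j t, (j <= k)%N -> `|derive1n j nu t| <= M.
  elim: k => [|k [M M0 hM]].
    by have [M M0 hM] := bound 0%N; exists M => // j t; rewrite leqn0 => /eqP ->.
  have [N N0 hN] := bound k.+1; exists (M + N) => [|j t]; first by rewrite addr_gt0.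
  rewrite leq_eqVlt => /orP[/eqP ->|jk].
    by apply: le_trans (hN t) _; rewrite lerDr ltW.
  by apply: le_trans (hM j t jk) _; rewrite lerDl ltW.
exists (eta / (2 * M)); first by rewrite divr_gt0 // mulr_gt0.
move=> e /andP[e0 eM].
have small j t : (j <= k)%N -> `|e *: derive1n j nu t| <= eta / 2.
  move=> jk; rewrite normrZ gtr0_norm //; apply: le_trans (_ : e * M <= _).
    by rewrite ler_wpM2l ?hM // ltW.
  have : e * (2 * M) < eta by rewrite -ltr_pdivlMr // mulr_gt0.
  by lra.
split=> [t|]; first by have := small 0%N t (leq0n k); rewrite /derive1n; lra.
by apply: Ck_norm_lt => // j t jk; rewrite derive1n_scale //; exact: small.
Qed.

Context (gamma : R -> 'rV[R]_2) (th : R -> R) (cc : convex_curve gamma th).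
Context (nu : R -> 'rV[R]_2) (snu : smooth nu) (pnu : periodic nu (2 * pi)).

Let g1 := derive1 gamma. Let g2 := derive1 (derive1 gamma).
Let n1 := derive1 nu. Let n2 := derive1 (derive1 nu).
Let sg1 : smooth g1 := smooth_derive1 (cc_smooth cc).
Let sg2 : smooth g2 := smooth_derive1 sg1.
Let sn1 : smooth n1 := smooth_derive1 snu.
Let sn2 : smooth n2 := smooth_derive1 sn1.
Let pg1 : periodic g1 (2 * pi) := derive1_periodic (cc_periodic cc).
Let pg2 : periodic g2 (2 * pi) := derive1_periodic pg1.
Let pn1 : periodic n1 (2 * pi) := derive1_periodic pnu.
Let pn2 : periodic n2 (2 * pi) := derive1_periodic pn1.

Let sp_det F G : smooth F -> periodic F (2 * pi) -> smooth G -> periodic G (2 * pi) ->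
  sp (fun t => det2 (F t) (G t)).
Proof.
move=> sF pF sG pG; have -> : (fun t => det2 (F t) (G t)) =
    (fun t => F t 0 0 * G t 0 1 - F t 0 1 * G t 0 0) by apply/funext => t; rewrite det2E.
by apply: spB; apply: spM; exact: sp_coord.
Qed.

Let dot F G t := F t 0 0 * G t 0 0 + F t 0 1 * G t 0 1.

Let sp_dot F G : smooth F -> periodic F (2 * pi) -> smooth G -> periodic G (2 * pi) ->
  sp (dot F G).
Proof. by move=> sF pF sG pG; apply: spD; apply: spM; exact: sp_coord. Qed.

Let line e t := gamma t + e *: nu t.

Let det2_line (a b c d : 'rV[R]_2) e : det2 (a + e *: c) (b + e *: d) =
  det2 a b + e * (det2 c b + det2 a d) + e ^+ 2 * det2 c d.
Proof. by rewrite !det2E !mxE; ring. Qed.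

Let eucl_line (a c : 'rV[R]_2) e : eucl (a + e *: c) ^+ 2 =
  a 0 0 * a 0 0 + a 0 1 * a 0 1 + e * (2 * (a 0 0 * c 0 0 + a 0 1 * c 0 1)) +
  e ^+ 2 * (c 0 0 * c 0 0 + c 0 1 * c 0 1).
Proof. by rewrite eucl_sqr !mxE; ring. Qed.

Let line1 e : derive1 (line e) = fun t => g1 t + e *: n1 t.
Proof. exact: (derive1_line e (cc_smooth cc) snu). Qed.

Let line2 e : derive1 (derive1 (line e)) = fun t => g2 t + e *: n2 t.
Proof. by rewrite line1; exact: (derive1_line e sg1 sn1). Qed.

Let b0 t := det2 (g1 t) (g2 t).
Let b1 t := det2 (n1 t) (g2 t) + det2 (g1 t) (n2 t).
Let b2 t := det2 (n1 t) (n2 t).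
Let v0 := dot g1 g1.
Let v1 t := 2 * dot g1 n1 t.
Let v2 := dot n1 n1.

Let bendingE e t : bending (line e) t = b0 t + e * b1 t + e ^+ 2 * b2 t.
Proof. by rewrite /bending line2 line1; exact: det2_line. Qed.

Let speedE e t : speed (line e) t ^+ 2 = v0 t + e * v1 t + e ^+ 2 * v2 t.
Proof. by rewrite /speed line1; exact: eucl_line. Qed.

Let spb0 : sp b0. Proof. exact: (sp_det sg1 pg1 sg2 pg2). Qed.
Let spb1 : sp b1. Proof. exact: (spD (sp_det sn1 pn1 sg2 pg2) (sp_det sg1 pg1 sn2 pn2)). Qed.
Let spb2 : sp b2. Proof. exact: (sp_det sn1 pn1 sn2 pn2). Qed.
Let spv0 : sp v0. Proof. exact: (sp_dot sg1 pg1 sg1 pg1). Qed.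
Let spv1 : sp v1. Proof. exact: (spM (spc 2) (sp_dot sg1 pg1 sn1 pn1)). Qed.
Let spv2 : sp v2. Proof. exact: (sp_dot sn1 pn1 sn1 pn1). Qed.

Let b0_gt0 t : 0 < b0 t. Proof. exact: (cc_bending cc t). Qed.

Let v0E t : v0 t = speed gamma t ^+ 2.
Proof. by rewrite eucl_sqr /v0 /dot !expr2. Qed.

Let v0_gt0 t : 0 < v0 t.
Proof. by rewrite v0E exprn_gt0 // (cc_speed cc). Qed.

(** Positivity of the curvature is an open condition; so is turning number one,
    because the angular speed of the perturbed tangent stays below twice the
    original one. *)
Lemma convex_curve_stable : exists2 e0 : R, 0 < e0 & forall e, 0 < e < e0 ->
  exists th', convex_curve (fun t => gamma t + e *: nu t) th'.
Proof.
have [eb eb0 hb] := quadratic_gt0 spb0 spb1 spb2 b0_gt0.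
have [ev ev0 hv] := quadratic_gt0 spv0 spv1 spv2 v0_gt0.
pose w0 t := b0 t * v0 t.
pose w1 t := 2 * (b0 t * v1 t) - b1 t * v0 t.
pose w2 t := 2 * (b0 t * v2 t) - b2 t * v0 t.
have spw i j : sp i -> sp j -> sp (fun t => 2 * (b0 t * i t) - j t * v0 t).
  by move=> si sj; exact: (spB (spM (spc 2) (spM spb0 si)) (spM sj spv0)).
have [ew ew0 hw] := quadratic_gt0 (spM spb0 spv0) (spw _ _ spv1 spb1) (spw _ _ spv2 spb2)
  (fun t => mulr_gt0 (b0_gt0 t) (v0_gt0 t)).
exists (Num.min eb (Num.min ev ew)); first by rewrite !lt_min eb0 ev0.
move=> e /andP[e0]; rewrite !lt_min => /and3P[e1 e2 e3].
have sl : smooth (line e) by exact: smooth_line e (cc_smooth cc) snu.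
have pl : periodic (line e) (2 * pi) by move=> t; rewrite /line (cc_periodic cc) pnu.
have sp0 t : 0 < speed (line e) t.
  rewrite lt_neqAle sqrtr_ge0 andbT eq_sym -(@sqrf_eq0 R) speedE gt_eqF // hv //.
  by rewrite e0.
have bp0 t : 0 < bending (line e) t by rewrite bendingE hb // e0.
have [th' [k [k0 ang]]] := tangent_angle_exists sl pl sp0 bp0.
(* the angle of the original tangent counted twice, minus the new one, increases *)
have k1 : k = 1%N.
  have d t := isD_sub (isD_mul (isD_cst 2 t) (angle_derive (cc_angle cc) t)) (angle_derive ang t).
  have := @increasing_of_derive R _ _ d.
  have pos t : 0 < 0 * th t + 2 * (bending gamma t / speed gamma t ^+ 2) -
      bending (line e) t / speed (line e) t ^+ 2.
    rewrite mul0r add0r subr_gt0 ltr_pdivrMr; last exact/exprn_gt0/sp0.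
    rewrite (speedE e t) (bendingE e t) -v0E.
    have e3' : 0 < e < ew by rewrite e0.
    have := hw e e3' t; rewrite -/(b0 t).
    move: (v0_gt0 t) (b0_gt0 t); rewrite /bending -/(g1 t) -/(g2 t) -/(b0 t).
    move: (b0 t) (b1 t) (b2 t) (v0 t) (v1 t) (v2 t) => B0 B1 B2 V0 V1 V2 V00 B00 h.
    rewrite -subr_gt0.
    have -> : 2 * (B0 / V0) * (V0 + e * V1 + e ^+ 2 * V2) - (B0 + e * B1 + e ^+ 2 * B2) =
        (B0 * V0 + e * (2 * (B0 * V1) - B1 * V0) + e ^+ 2 * (2 * (B0 * V2) - B2 * V0)) / V0.
      by field; rewrite gt_eqF.
    by rewrite divr_gt0.
  move/(_ pos 0 (2 * pi) P0).
  have := angle_turn ang 0; have := angle_turn (cc_angle cc) 0; rewrite !add0r => -> ->.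
  rewrite mulr1 => h; have : 2 * pi * k%:R < 2 * pi * 2%:R :> R by lra.
  by rewrite ltr_pM2l // ltr_nat; case: k k0 {ang h} => [|[|k]].
by exists th'; rewrite k1 in ang; exact: ConvexCurve sl pl sp0 bp0 ang.
Qed.

End Perturbation.

Section NormalPerturbation.
Context {R : realType}.
Context (gamma : R -> 'rV[R]_2) (th : R -> R) (cc : convex_curve gamma th).
Context (mu : R -> R) (smu : smooth mu) (pmu : periodic mu (2 * pi)).

Definition normal_field t : 'rV[R]_2 := mu t *: unit_normal gamma t.

Lemma normal_perturbationE e :
  normal_perturbation gamma e mu = fun t => gamma t + e *: normal_field t.
Proof. by apply/funext => t; rewrite /normal_perturbation /normal_field scalerA. Qed.

Lemma normal_field_smooth : smooth normal_field /\ periodic normal_field (2 * pi).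
Proof.
have sg := smooth_derive1 (cc_smooth cc).
have pg := derive1_periodic (cc_periodic cc).
have si : smooth (fun t => (speed gamma t)^-1).
  apply/smoothE => n; apply: CnV => [t|]; first by rewrite gt_eqF // (cc_speed cc).
  by move: n; apply/smoothE; apply: smooth_speed (cc_smooth cc) (cc_speed cc).
split; last by move=> t; rewrite /normal_field /unit_normal /= pmu pg.
apply: coord_smooth; apply: ord2P.
  have -> : (fun s => normal_field s 0 0) =
      fun t => mu t * ((speed gamma t)^-1 * - derive1 gamma t 0 1).
    by apply/funext => t; rewrite !mxE.
  exact: smoothM smu (smoothM si (smoothN (@smooth_coord _ _ 1 sg))).
have -> : (fun s => normal_field s 0 1) =
    fun t => mu t * ((speed gamma t)^-1 * derive1 gamma t 0 0).
  by apply/funext => t; rewrite !mxE.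
exact: smoothM smu (smoothM si (@smooth_coord _ _ 0 sg)).
Qed.

Theorem normal_perturbation_small O k (eta : R) : (region gamma)° O -> 0 < eta ->
  exists2 e0 : R, 0 < e0 & forall e, 0 < e < e0 ->
    [/\ exists th', convex_curve (normal_perturbation gamma e mu) th',
      (region (normal_perturbation gamma e mu))° O &
      Ck_norm k (normal_perturbation gamma e mu \- gamma) < eta].
Proof.
move=> intO eta0; have [sn pn] := normal_field_smooth.
have [d d0 hd] := region_interior_stable intO.
have [e1 e10 h1] := convex_curve_stable cc sn pn.
have [e2 e20 h2] := line_close 0 sn pn d0.
have [e3 e30 h3] := line_close k sn pn eta0.
exists (Num.min e1 (Num.min e2 e3)); first by rewrite !lt_min e10 e20.
move=> e /andP[e0]; rewrite !lt_min => /and3P[ea eb ec]; rewrite normal_perturbationE; split.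
- by apply: h1; rewrite e0.
- by apply: hd => t; rewrite addrAC subrr add0r; apply: (h2 e _).1; rewrite e0.
- have -> : (fun t => gamma t + e *: normal_field t) \- gamma = fun t => e *: normal_field t.
    by apply/funext => t /=; rewrite addrAC subrr add0r.
  by apply: (h3 e _).2; rewrite e0.
Qed.

End NormalPerturbation.

(** * Tangent vectors contracted in the past or in the future *)

Section Decay.
Context {R : realType}.
Notation V := ('rV[R]_2 : normedModType R).
Implicit Types (P : set 'rV[R]_2) (f g : 'rV[R]_2 -> 'rV[R]_2) (p x z v w : 'rV[R]_2).
Implicit Types (Df Dg : 'rV[R]_2 -> 'rV[R]_2 -> 'rV[R]_2).

(** Along the multiples of the period [n] only: this is what the return map controls,
    and it suffices for comparing two vectors. *)
Definition decays f Df (n : nat) z w : Prop :=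
  forall e : R, 0 < e -> exists K : nat, forall k, (K <= k)%N -> `|Diter f Df (k * n) z w| < e.

(** Area preservation makes the contracted directions at a point parallel. *)
Lemma decays_det P f Df n z w w' : flow P f Df -> P z ->
  decays f Df n z w -> decays f Df n z w' -> det2 w w' = 0.
Proof.
move=> F Pz dw dw'; apply/eqP; rewrite -normr_le0; apply/ler_addgt0Pr => e e0; rewrite add0r.
pose a := Num.min 1 (e / 2).
have a0 : 0 < a by rewrite lt_min ltr01 divr_gt0.
have [K hK] := dw a a0; have [K' hK'] := dw' a a0.
have h1 := hK (maxn K K') (leq_maxl _ _); have h2 := hK' (maxn K K') (leq_maxr _ _).
rewrite -(flow_area (flow_iter (maxn K K' * n) F) w w' Pz); apply: le_trans (det2_le _ _) _.
move: h1 h2; move: (`|_|) (normr_ge0 (Diter f Df (maxn K K' * n) z w)) => A A0.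
move: (`|_|) (normr_ge0 (Diter f Df (maxn K K' * n) z w')) => B B0 Aa Ba.
have a1 : a <= 1 by rewrite ge_min lexx.
have a2 : a <= e / 2 by rewrite ge_min lexx orbT.
have h : A * B <= 1 * (e / 2).
  exact: ler_pM A0 B0 (le_trans (ltW Aa) a1) (le_trans (ltW Ba) a2).
by rewrite -mulrA; lra.
Qed.

Lemma decays_scale P f Df n z w (k : R) : flow P f Df -> P z ->
  decays f Df n z w -> decays f Df n z (k *: w).
Proof.
move=> F Pz dw e e0; have k1 : 0 < `|k| + 1 by rewrite ltr_wpDl.
have [K hK] := dw (e / (`|k| + 1)) (divr_gt0 e0 k1); exists K => i /hK h.
have [_ sc] := C11_lin (flow_C11 (flow_iter (i * n) F) Pz); rewrite sc normrZ.
apply: le_lt_trans (_ : (`|k| + 1) * `|Diter f Df (i * n) z w| < e).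
  by rewrite ler_wpM2r // lerDl.
by rewrite mulrC -ltr_pdivlMr.
Qed.

Lemma decays_iter f Df n (m : nat) z w : decays f Df n z w ->
  decays f Df n (iter (m * n) f z) (Diter f Df (m * n) z w).
Proof.
move=> dw e e0; have [K hK] := dw e e0; exists K => k Kk.
by rewrite -DiterD -mulnDl; apply: hK; exact: leq_trans (leq_addr _ _).
Qed.

Lemma decays_eq f Df g Dg n z w : (forall k, Diter f Df k z w = Diter g Dg k z w) ->
  decays f Df n z w -> decays g Dg n z w.
Proof. by move=> e dw a a0; have [K hK] := dw a a0; exists K => k; rewrite -e; exact: hK. Qed.

Lemma decays_shift P f Df n z w (j : int) : flow P f Df -> P z ->
  decays f Df n (z + cyl_shift j) w <-> decays f Df n z w.
Proof.
move=> F Pz.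
have e k : Diter f Df (k * n) (z + cyl_shift j) w = Diter f Df (k * n) z w.
  exact: (flow_Dshift (flow_iter (k * n) F) j w Pz).
by split=> dw a a0; have [K hK] := dw a a0; exists K => k /hK; rewrite e.
Qed.

(** What [stable_manifold] provides about the curve [phi]. *)
Definition stable_param P f Df x n (lam : R) vs (phi : R -> 'rV[R]_2) : Prop :=
  [/\ immersed_curve (stable_set P f x) phi, phi 0 = x /\ derive1 phi 0 = vs,
    forall u : R, P (phi u) /\ exists D, @C11 R R V phi D u &
    forall m, exists j, forall u : R, iter (m * n) f (phi u) = phi (lam ^+ m * u) + cyl_shift j /\
      Diter f Df (m * n) (phi u) (derive1 phi u) = lam ^+ m *: derive1 phi (lam ^+ m * u)].

Lemma saddle_stable_param P f g Df Dg x n j lam mu vs vu : system P f g Df Dg ->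
  saddle P f Df x n j lam mu vs vu -> exists phi, stable_param P f Df x n lam vs phi.
Proof.
move=> S [Px n0 per l01 lm fr Dvs Dvu].
by have [phi] := stable_manifold S Px n0 per l01 lm fr Dvs Dvu; exists phi.
Qed.

Lemma stable_tangent_decays P f Df x n (lam : R) vs phi (u : R) :
  stable_param P f Df x n lam vs phi -> `|lam| < 1 -> decays f Df n (phi u) (derive1 phi u).
Proof.
move=> [[_ cphi _ _ _] _ _ it] l1 e e0.
have /cvgrPdist_lt/(_ _ ltr01)/nbhs_ballP[d /= d0 hd] := cphi 0.
pose B := `|derive1 phi 0| + 1; have B0 : 0 < B by rewrite ltr_wpDl.
have [K1 hK1] := geometric_small `|u| (normr_ge0 lam) l1 d0.
have [K2 hK2] := geometric_small B (normr_ge0 lam) l1 e0.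
exists (maxn K1 K2) => k; rewrite geq_max => /andP[k1 k2].
have [j /(_ u)[_ ->]] := it k; rewrite normrZ normrX.
have mono (a b : nat) : (a <= b)%N -> `|lam| ^+ b <= `|lam| ^+ a.
  by move=> ab; rewrite ler_wiXn2l // ltW.
have ud : `|lam ^+ k * u| < d.
  apply: le_lt_trans hK1; rewrite normrM normrX mulrC.
  by rewrite ler_wpM2l // mono.
have hB : `|derive1 phi (lam ^+ k * u)| <= B.
  have := hd (lam ^+ k * u); rewrite /ball /= sub0r normrN => /(_ ud) h.
  rewrite -[derive1 phi _](subrK (derive1 phi 0)) (le_trans (ler_normD _ _)) //.
  by rewrite /B addrC lerD2l distrC ltW.
apply: le_lt_trans (_ : `|lam| ^+ k * B < e); first by rewrite ler_wpM2l // exprn_ge0.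
apply: le_lt_trans hK2; rewrite mulrC; apply: ler_wpM2l; [exact: ltW | exact: mono].
Qed.

Lemma det2_independent (a b : 'rV[R]_2) : det2 a b != 0 ->
  (<[a]> + <[b]>)%VS = fullv /\ directv (<[a]> + <[b]>)%VS.
Proof.
move=> dab; have full : (<[a]> + <[b]>)%VS = fullv.
  apply/eqP; rewrite eqEsubv subvf /=; apply/subvP => w _.
  have -> : w = (det2 w b / det2 a b) *: a + (det2 a w / det2 a b) *: b.
    move: dab; rewrite !det2E => dab.
    by apply: vec2P; rewrite !mxE; field.
  by rewrite memv_add // memvZ // memv_line.
split=> //; have a0 : a != 0 by apply: contraNneq dab => ->; rewrite det2E !mxE !mul0r subrr.
have b0 : b != 0 by apply: contraNneq dab => ->; rewrite det2E !mxE !mulr0 subrr.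
by rewrite directvE /= full !dim_vline a0 b0 dimvf.
Qed.

(** The tangent of each invariant curve is contracted in its own direction of time.
    If the two tangents at [z] were parallel, they would be contracted in both. *)
Lemma transverse_tangent_spaces P f g Df Dg x y n n' (lam lam' : R) vs vs' phi psi (u v : R) z :
    system P f g Df Dg -> P z -> `|lam| < 1 -> `|lam'| < 1 ->
    stable_param P f Df x n lam vs phi -> stable_param P g Dg y n' lam' vs' psi ->
    cyl_eq z (phi u) -> cyl_eq z (psi v) ->
    (forall w, decays f Df n z w -> decays g Dg n' z w -> w = 0) ->
  exists Vs Vu : {vspace 'rV[R]_2},
    [/\ is_tangent_space (stable_set P f x) z Vs, is_tangent_space (stable_set P g y) z Vu,
      directv (Vs + Vu)%VS & (Vs + Vu)%VS = fullv].
Proof.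
move=> S Pz l1 l1' hphi hpsi zphi zpsi no.
have [iphi _ Pphi _] := hphi; have [ipsi _ Ppsi _] := hpsi.
have [_ _ phi'0 _ _] := iphi; have [_ _ psi'0 _ _] := ipsi.
pose a := derive1 phi u; pose b := derive1 psi v.
have da : decays f Df n z a.
  case: zphi => [j ->]; apply/(decays_shift _ _ _ (sys_fwd S)); first by case: (Pphi u).
  exact: stable_tangent_decays hphi l1.
have db : decays g Dg n' z b.
  case: zpsi => [j ->]; apply/(decays_shift _ _ _ (sys_bwd S)); first by case: (Ppsi v).
  exact: stable_tangent_decays hpsi l1'.
have dab : det2 a b != 0.
  apply/eqP => /det2_colinear/(_ (phi'0 u))[k bE].
  have := no b _ db; rewrite {1}bE => /(_ (decays_scale k (sys_fwd S) Pz da)) /eqP.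
  by rewrite (negbTE (psi'0 v)).
exists <[a]>%VS, <[b]>%VS; split=> //.
- by exists phi, u.
- by exists psi, v.
- exact: (det2_independent dab).2.
- exact: (det2_independent dab).1.
Qed.

Lemma cos_eq1 (t : R) : cos t = 1 -> `|t| < 2 * pi -> t = 0.
Proof.
move=> c1 t2; have s0 : sin (t / 2) = 0.
  have := cosD (t / 2) (t / 2); rewrite -splitr c1 -!expr2 cos2sin2 => h.
  by apply/eqP; rewrite -(@sqrf_eq0 R); apply/eqP; move: (sin (t / 2) ^+ 2) h => X; lra.
move: t2; rewrite ltr_norml => /andP[t2 t2'].
have [t0|t0|//] := ltgtP t 0; exfalso.
  have : 0 < sin (- (t / 2)) by apply: sin_gt0_pi; lra.
  by rewrite sinN s0 oppr0 ltxx.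
have : 0 < sin (t / 2) by apply: sin_gt0_pi; lra.
by rewrite s0 ltxx.
Qed.

Lemma cosB_periodic (a b : R) (j : int) : cos (a + 2 * pi * j%:~R - b) = cos (a - b).
Proof.
have p : periodic (fun t : R => cos (t - b)) (2 * pi).
  by move=> t; rewrite addrAC cosD2pi'.
exact: (periodicz p).
Qed.

(** If [h 0] is not the position [a] of the circle, this is continuity; if it is, the
    nonzero speed moves [h] away from it. *)
Lemma leaves_position (h : R -> R) (rho a : R) : is_derive (0 : R) (1 : R) h rho -> rho != 0 ->
  exists2 d : R, 0 < d & forall u, u != 0 -> `|u| < d -> cos (h u - a) != 1.
Proof.
move=> dh rho0.
have ch : {for 0, continuous h} := is_derive_cont dh.
have P0 : 0 < 2 * pi :> R by rewrite mulr_gt0 ?pi_gt0.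
have [c1|c1] := eqVneq (cos (h 0 - a)) 1.
  have [d1 d10 hd1] : exists2 d : R, 0 < d & forall u, u != 0 -> `|u| < d -> h u != h 0.
    have [r0|r0|e] := ltgtP rho 0; last by rewrite e eqxx in rho0.
      have [r r00 hr] := derive_lt0_local dh r0; exists r => // u u0 ur.
      have [|h1 h2] := hr u; first by rewrite subr0.
      by move: u0; rewrite neq_lt => /orP[/h2/gt_eqF->|/h1/lt_eqF->].
    have dN : is_derive (0 : R) (1 : R) (fun u => - h u) (- rho) by exact: is_deriveN.
    have [|r r00 hr] := derive_lt0_local dN; first by rewrite oppr_lt0.
    exists r => // u u0 ur; have [|h1 h2] := hr u; first by rewrite subr0.
    by rewrite -(inj_eq oppr_inj); move: u0; rewrite neq_lt => /orP[/h2/gt_eqF->|/h1/lt_eqF->].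
  move/cvgrPdist_lt/(_ _ P0)/nbhs_ballP: ch => [d2 /= d20 hd2].
  exists (Num.min d1 d2); first by rewrite lt_min d10.
  move=> u u0; rewrite lt_min => /andP[ud1 ud2]; apply/eqP => cu.
  have := hd2 u; rewrite /ball /= sub0r normrN distrC => /(_ ud2) close.
  have s0 : sin (h 0 - a) = 0.
    by apply/eqP; rewrite -(@sqrf_eq0 R) sin2cos2 c1 expr1n subrr.
  have /cos_eq1/(_ close) : cos (h u - h 0) = 1.
    have -> : h u - h 0 = (h u - a) - (h 0 - a) by ring.
    by rewrite cosB cu c1 s0 mulr0 addr0 mulr1.
  by move/eqP; rewrite subr_eq0; apply/negP; exact: hd1.
have c0 : cos (h 0 - a) < 1 by rewrite lt_neqAle c1 cos_le1.
have cc : {for 0, continuous (fun u => cos (h u - a))}.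
  exact: is_derive_cont (isD_comp (is_derive_cos _) (isD_sub dh (isD_cst a 0))).
have e0 : 0 < 1 - cos (h 0 - a) by rewrite subr_gt0.
move/cvgrPdist_lt/(_ _ e0)/nbhs_ballP: cc => [d /= d0 hd]; exists d => // u _ ud.
apply/eqP => cu; have := hd u; rewrite /ball /= sub0r normrN => /(_ ud).
by rewrite cu distrC ger0_norm ?ltxx // subr_ge0 cos_le1.
Qed.

(** The orbit of [z] follows the stable curve into [x], so that its bounces pass near
    the bounce of [x] without repeating it, and its contracted vector is tangent to
    the curve.  If the curve is vertical at [x], then by the twist property its image
    under one step is not. *)
Lemma generic_time P f g Df Dg x n (lam : R) vs phi (u : R) z (X : seq R) :
    system P f g Df Dg -> 0 < `|lam| < 1 -> vs != 0 ->
    (forall p w, P p -> w != 0 -> w 0 0 = 0 -> (Df p w) 0 0 != 0) ->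
    stable_param P f Df x n lam vs phi -> cyl_eq z (phi u) -> u != 0 ->
  exists i, (forall a, a \in X -> cos ((iter i f z) 0 0 - a) != 1) /\
    (forall w, w != 0 -> decays f Df n z w -> (Diter f Df i z w) 0 0 != 0).
Proof.
move=> S /andP[l0 l1] vs0 twist hphi [j zE] u0.
have [[_ _ phi'0 _ _] [phi0 phi'vs] Pphi it] := hphi.
have lam_n0 : lam != 0 by rewrite -normr_gt0.
(* 0 or 1 steps make the curve transverse to the vertical *)
have [r rE] : exists r, (Diter f Df r x vs) 0 0 != 0.
  have [e|] := eqVneq (vs 0 0) 0; last by exists 0%N.
  by exists 1%N; apply: twist => //; rewrite -phi0; case: (Pphi 0).
pose c t := iter r f (phi t).
have cC11 t : exists2 D, @C11 R R V c D t & D t 1 = Diter f Df r (phi t) (derive1 phi t).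
  have [Pt [D1 c1]] := Pphi t; have [d1 _] := C11_curve c1.
  have c2 := C11_comp c1 (flow_C11 (flow_iter r (sys_fwd S)) Pt).
  by eexists; first exact: c2; rewrite /= derive1E (@derive_val _ _ _ _ _ _ _ d1).
have c'E t : derive1 c t = Diter f Df r (phi t) (derive1 phi t).
  have [D1 c1 <-] := cC11 t; have [d1 _] := C11_curve c1.
  by rewrite derive1E (@derive_val _ _ _ _ _ _ _ d1).
have [D0 c0 D0E] := cC11 0.
have dg : is_derive (0 : R) (1 : R) (fun t => c t 0 0) ((Diter f Df r x vs) 0 0).
  have [dc _] := C11_curve c0.
  have dc1 : derivable c 0 1 := @ex_derive _ _ _ _ _ _ _ dc.
  have h := derivable_is (@coord_derivable R c 0 0 dc1).
  by rewrite derive1_coord // c'E phi0 phi'vs in h.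
have [d1 d10 hd1] : exists2 d : R, 0 < d & forall t, `|t| < d -> (derive1 c t) 0 0 != 0.
  have [_ cc] := C11_curve c0; pose rho := (Diter f Df r x vs) 0 0.
  have r0 : 0 < `|rho| by rewrite normr_gt0.
  move/cvgrPdist_lt/(_ _ r0)/nbhs_ballP: cc => [d /= d0 hd]; exists d => // t td.
  apply/eqP => e; have := hd t; rewrite /ball /= sub0r normrN => /(_ td) close.
  have := le_lt_trans (coord_norm_le _ 0) close.
  by rewrite !mxE e subr0 c'E phi0 phi'vs ltxx.
have [d2 d20 hd2] : exists2 d : R, 0 < d & forall t, t != 0 -> `|t| < d ->
    forall a, a \in X -> cos (c t 0 0 - a) != 1.
  elim: X => [|b X [d d0 IH]]; first by exists 1.
  have [d' d'0 hd'] := leaves_position b dg rE.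
  exists (Num.min d d'); first by rewrite lt_min d0.
  move=> t t0; rewrite lt_min => /andP[td td'] a; rewrite inE => /predU1P[->|aX].
    exact: hd'.
  exact: IH.
have d0 : 0 < Num.min d1 d2 by rewrite lt_min d10.
have [k hk] := geometric_small `|u| (normr_ge0 lam) l1 d0.
have lk0 : lam ^+ k != 0 by rewrite expf_neq0.
have t0 : lam ^+ k * u != 0 by rewrite mulf_neq0.
have : `|lam ^+ k * u| < Num.min d1 d2 by rewrite normrM normrX mulrC.
rewrite lt_min => /andP[t1 t2].
have [j' hj'] := it k; have [it1 it2] := hj' u.
have Pu : P (phi u) by case: (Pphi u).
have Pt : P (phi (lam ^+ k * u)) by case: (Pphi (lam ^+ k * u)).
have fr := flow_iter r (sys_fwd S); have fk := flow_iter (k * n) (sys_fwd S).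
exists (r + k * n)%N; split=> [a aX|w w0 dw].
  rewrite iterD zE (flow_shift fk j Pu) it1 -addrA cyl_shiftD (flow_shift fr _ Pt).
  by rewrite phase_coord cosB_periodic; exact: hd2.
have dw' : decays f Df n (phi u) w.
    by move: dw; rewrite zE; exact: (decays_shift n w j (sys_fwd S) Pu).1.
have dphi := stable_tangent_decays u hphi l1.
have [q wE] := det2_colinear (decays_det (sys_fwd S) Pu dphi dw') (phi'0 u).
have q0 : q != 0 by apply: contra_neq w0 => q0; rewrite wE q0 scale0r.
have -> : Diter f Df (r + k * n) z w = (q * lam ^+ k) *: derive1 c (lam ^+ k * u).
  rewrite DiterD zE (flow_shift fk j Pu) it1 -addrA cyl_shiftD (flow_Dshift fr _ _ Pt).
  rewrite (flow_Dshift fk _ _ Pu) wE (C11_lin (flow_C11 fk Pu)).2 it2 scalerA.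
  by rewrite (C11_lin (flow_C11 fr Pt)).2 c'E.
by rewrite mxE mulf_neq0 ?mulf_neq0 // hd1.
Qed.

End Decay.

Section Separation.
Context {R : realType}.
Implicit Types (P : set 'rV[R]_2) (f : 'rV[R]_2 -> 'rV[R]_2) (x z : 'rV[R]_2) (t a b c : R).

Lemma cos_lipschitz a b : cos a <= cos b + `|a - b|.
Proof.
have key (u v : R) : u < v -> `|cos v - cos u| <= v - u.
  move=> uv; have [t _ ->] := mean_value uv (@is_derive_cos R).
  rewrite normrM normrN [`|v - u|]gtr0_norm ?subr_gt0 //; apply: ler_piMl.
    by rewrite subr_ge0 ltW.
  by rewrite ler_norml sin_geN1 sin_le1.
rewrite -lerBlDl; apply: le_trans (ler_norm _) _.
have [ab|ab|->] := ltgtP a b; last by rewrite !subrr normr0.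
  by rewrite distrC; apply: le_trans (key _ _ ab) _; rewrite distrC ler_norm.
by apply: le_trans (key _ _ ab) _; rewrite ler_norm.
Qed.

Lemma isolated_from_1 (s : nat -> R) c1 K : c1 < 1 -> (forall i, s i <= 1) ->
    (forall i, (K <= i)%N -> s i <= c1 \/ s i = 1) ->
  exists2 c, c < 1 & c1 <= c /\ forall i, s i <= c \/ s i = 1.
Proof.
move=> + s1; elim: K c1 => [|K IH] c1 c11 h; first by exists c1 => //; split=> // i; exact: h.
have [sK|sK] := ltrP (s K) 1.
  have [||c c_1 [c1c hc]] := IH (Num.max c1 (s K)).
  - by rewrite gt_max c11.
  - move=> i; rewrite leq_eqVlt => /predU1P[<-|/h[si|]]; [|by left; rewrite le_max si|by right].
    by left; rewrite le_max lexx orbT.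
  by exists c => //; split=> //; apply: le_trans c1c; rewrite le_max lexx.
apply: IH => // i; rewrite leq_eqVlt => /predU1P[<-|/h //].
by right; apply/eqP; rewrite eq_le s1.
Qed.

Lemma iter_period P f Df x n (j : int) : flow P f Df -> P x ->
  iter n f x = x + cyl_shift j -> forall q, cyl_eq (iter (q * n) f x) x.
Proof.
move=> F Px per; elim=> [|q [k kE]]; first by exists 0; rewrite cyl_shift0 addr0.
exists (j + k); rewrite mulSn iterD kE (flow_shift (flow_iter n F) k Px) per.
by rewrite -addrA cyl_shiftD.
Qed.

Lemma periodic_orbit_apart P f Df x n (j : int) tm : flow P f Df -> P x -> (0 < n)%N ->
    iter n f x = x + cyl_shift j -> (forall i, (i < n)%N -> cos ((iter i f x) 0 0 - tm) != 1) ->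
  exists2 c, c < 1 & forall i, cos ((iter i f x) 0 0 - tm) <= c.
Proof.
move=> F Px n0 per h; pose s i := if (i < n)%N then cos ((iter i f x) 0 0 - tm) else -1.
have s1 i : s i <= 1 by rewrite /s; case: ifP => _; [exact: cos_le1 | lra].
have [||c c1 [_ hc]] := @isolated_from_1 s (-1) n _ s1; first lra.
  by move=> i ni; left; rewrite /s ltnNge ni.
exists c => // i; have [k kE] := iter_period F Px per (i %/ n).
rewrite [i in iter i](divn_eq i n) addnC iterD kE (flow_shift (flow_iter _ F) k Px).
have im : (i %% n < n)%N by rewrite ltn_mod.
rewrite phase_coord cosB_periodic; have := hc (i %% n)%N; rewrite /s im => -[//|e].
by have := h _ im; rewrite e eqxx.
Qed.

Lemma asymptotic_orbit_apart f x z tm c0 : c0 < 1 ->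
    cyl_dist (iter m f z) (iter m f x) @[m --> \oo] --> (0 : R) ->
    (forall i, cos ((iter i f x) 0 0 - tm) <= c0) ->
  exists K, exists2 c, c < 1 &
    (forall i, cos ((iter i f z) 0 0 - tm) <= c \/ cos ((iter i f z) 0 0 - tm) = 1) /\
    (forall i, (K <= i)%N -> cos ((iter i f z) 0 0 - tm) <= c).
Proof.
move=> c01 cz h; have e0 : 0 < (1 - c0) / 2 by rewrite divr_gt0 // subr_gt0.
move/cvgrPdist_lt/(_ _ e0): cz => [K _ hK].
have tail i : (K <= i)%N -> cos ((iter i f z) 0 0 - tm) <= (1 + c0) / 2.
  move=> Ki; have := hK i Ki; rewrite /= sub0r normrN ger0_norm ?cyl_dist_ge0 //.
  move/cyl_dist_lt => [j hj]; have hj0 := le_lt_trans (coord_norm_le _ 0) hj.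
  rewrite -(cosB_periodic _ tm (- j)).
  apply: le_trans (cos_lipschitz _ ((iter i f x) 0 0 - tm)) _; have hi := h i.
  have e : (iter i f z) 0 0 + 2 * pi * (- j)%:~R - tm - ((iter i f x) 0 0 - tm) =
      (iter i f z - iter i f x - cyl_shift j) 0 0.
    rewrite /cyl_shift !mxE /= rmorphN /=.
    by move: (iter i f z 0 0) (iter i f x 0 0) (j%:~R : R) => A B J; ring.
  rewrite e; lra.
have c11 : (1 + c0) / 2 < 1 by lra.
have [|c c1 [c1c hc]] := @isolated_from_1 (fun i => cos ((iter i f z) 0 0 - tm)) _ K c11
  (fun i => cos_le1 _).
  by move=> i /tail; left.
exists K, c => //; split=> // i Ki; exact: le_trans (tail i Ki) c1c.
Qed.

End Separation.

(** * Jacobi fields along billiard orbits *)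

Section JacobiFields.
Context {R : realType}.
Context (gamma : R -> 'rV[R]_2) (th : R -> R) (cc : convex_curve gamma th).
Context (O : 'rV[R]_2).
Implicit Types (p w : 'rV[R]_2) (a b c u : R) (i n : nat).

Notation P := (phase_space gamma O).
Notation T := (billiard_map gamma O).
Notation Ti := (billiard_inv gamma O).
Notation g1 := (derive1 gamma).
Notation g2 := (derive1 (derive1 gamma)).

Lemma ss_inside a u : a < u < a + 2 * pi -> ss gamma O a u < ss gamma O a a.
Proof.
move=> /andP[au ua]; have [us|su] := lerP u (star gamma a).
  by have := ss_decr cc O (lexx a) au us.
rewrite -[ltLHS](ss_periodic cc O a) -[u](subrK (2 * pi)) (ss_periodic cc O a).
rewrite (ss_periodic cc O a); apply: (ss_incr cc); lra.
Qed.

Definition base p : R := p 0 0.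

Lemma billiard_step p : P p ->
  [/\ adj gamma (base p) (base (T p)), p = bounce gamma O (base p) (base (T p)) &
    T p = bounce gamma O (base (T p)) (base p)].
Proof.
move=> /(phase_next cc)[b ab pE]; have Tp : T p = bounce gamma O b (base p).
  by rewrite [in LHS]pE (billiard_mapE cc).
by have bE : base (T p) = b by [rewrite Tp /base pair2_0]; rewrite bE.
Qed.

Lemma billiard_back p : P p ->
  [/\ adj gamma (base (Ti p)) (base p), p = bounce gamma O (base p) (base (Ti p)) &
    Ti p = bounce gamma O (base (Ti p)) (base p)].
Proof.
move=> /(phase_prev cc)[b ab pE]; have Tp : Ti p = bounce gamma O b (base p).
  by rewrite [in LHS]pE (billiard_invE cc).
by have bE : base (Ti p) = b by [rewrite Tp /base pair2_0]; rewrite bE.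
Qed.

(** The reflection law says that the chord is parallel to the tangent at [b].  It is
    positively so because [c] lies less than one turn after [a]. *)
Lemma reflection_chord a b c : adj gamma a b -> adj gamma b c ->
  ss gamma O b a = ss gamma O b c -> exists2 k, 0 < k & gamma c - gamma a = k *: g1 b.
Proof.
move=> ab bc e; have ac : a < c < a + 2 * pi.
  have /(adjE cc)/andP[h1 h2] := ab; have /(adjE cc)/andP[h3 h4] := bc.
  have hc := th_turn cc a.
  have thl := angle_lt (cc_speed cc) (cc_bending cc) (cc_angle cc).
  have h5 : th a < th c by lra.
  have h6 : th c < th (a + 2 * pi) by rewrite hc; lra.
  by rewrite !thl in h5 h6; rewrite h5.
have par : det2 (g1 b) (gamma c - gamma a) = 0.
  move: e; rewrite /ss; move: (g1 b) (gamma a) (gamma c) => B A C.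
  by rewrite !det2E !mxE; lra.
have pos : 0 < det2 (g1 a) (gamma c - gamma a).
  have := ss_inside ac; rewrite /ss; move: (g1 a) (gamma a) (gamma c) => B A C.
  by rewrite !det2E !mxE; lra.
have b0 : g1 b != 0 by have := cc_speed cc b; rewrite /speed eucl_gt0.
have [k kE] := det2_colinear par b0; exists k => //.
by have := pos; rewrite kE det2Zr (pmulr_lgt0 _ ab.2).
Qed.

Lemma billiard_chord p : P p -> exists2 k, 0 < k &
  gamma (base (T (T p))) - gamma (base p) = k *: g1 (base (T p)).
Proof.
move=> Pp; have [ab _ e1] := billiard_step Pp.
have [bc e2 _] := billiard_step (billiard_map_phase cc Pp).
apply: (reflection_chord ab bc).
have := congr1 (fun q : 'rV[R]_2 => q 0 1) (etrans (esym e1) e2).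
by rewrite !pair2_1.
Qed.

Lemma next_paramT p : next_param gamma O p = base (T p).
Proof. by rewrite /base (billiard_map_rootE cc) pair2_0. Qed.

Lemma prev_paramT p : P p -> prev_param gamma O p = base (Ti p).
Proof. by move=> Pp; rewrite /base (billiard_inv_rootE cc Pp) pair2_0. Qed.

Let D := Diter T (Dmap gamma O).
Let a_ p := dd gamma (base p) (base (T p)).

Lemma a_gt0 p : P p -> 0 < a_ p. Proof. by move=> /billiard_step[[_ ]]. Qed.

Lemma Dmap_momentum p w : P p ->
  w 0 1 = dss gamma O (base p) (base (T p)) * w 0 0 - a_ p * Dmap gamma O p w 0 0.
Proof.
move=> Pp; have a0 := a_gt0 Pp.
rewrite /Dmap /Dbounce pair2_0 /Droot next_paramT -/(base p) -/(a_ p).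
by move: (a_ p) (dss _ _ _ _) (w 0 0) (w 0 1) a0 => A B C E a0; field; rewrite gt_eqF.
Qed.

Lemma Dmap_momentum_next p w : P p ->
  Dmap gamma O p w 0 1 =
    dss gamma O (base (T p)) (base p) * Dmap gamma O p w 0 0 + a_ p * w 0 0.
Proof.
move=> Pp; rewrite /Dmap /Dbounce pair2_1 pair2_0 next_paramT -/(base p) ddC /a_.
by move: (dss _ _ _ _) (Droot _ _ _ _ _) (dd _ _ _) (w 0 0) => A B C E; ring.
Qed.

(** The twist property: a vector without displacement consists of its momentum, which
    is [- a_ p] times the next displacement. *)
Lemma Dmap_twist p w : P p -> w != 0 -> w 0 0 = 0 -> Dmap gamma O p w 0 0 != 0.
Proof.
move=> Pp w0 w00; apply: contra_neq w0 => e; apply: vec2P; rewrite mxE //.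
by rewrite (Dmap_momentum w Pp) w00 e !mulr0 subrr.
Qed.

(** The linearization as a three-term recurrence for the displacement of the
    bounces. *)
Lemma jacobi_equation p w i : P p -> let q := iter i T p in
  a_ (T q) * D i.+2 p w 0 0 + det2 (g2 (base (T q)))
    (gamma (base (T (T q))) - gamma (base q)) * D i.+1 p w 0 0 + a_ q * D i p w 0 0 = 0.
Proof.
move=> Pp q; have Pq : P q := flow_in (flow_iter i (sys_fwd (billiard_system cc O))) Pp.
have PTq := billiard_map_phase cc Pq.
have e1 := Dmap_momentum_next (D i p w) Pq.
have e2 := Dmap_momentum (D i.+1 p w) PTq.
have -> : D i.+2 p w 0 0 = Dmap gamma O (T q) (D i.+1 p w) 0 0 by [].
have eD : Dmap gamma O q (D i p w) = D i.+1 p w by [].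
rewrite eD in e1; rewrite e1 /dss in e2.
move: e2; move: (Dmap gamma O (T q) _ 0 0) (D i.+1 p w 0 0) (D i p w 0 0) => X Y Z.
move: (a_ (T q)) (a_ q) (g2 _) (gamma _) (gamma (base q)) => A B G C E.
by rewrite !det2E !mxE => e2; lra.
Qed.

End JacobiFields.

Section Wronskian.
Context {R : realType}.
Implicit Types (a b beta x y : nat -> R) (e : R) (n j : nat).

(** The equation of a discrete Schrodinger operator, with [a] the off-diagonal and [b]
    the diagonal coefficients. *)
Definition jacobi a b x : Prop :=
  forall j, a j.+1 * x j.+2 + b j.+1 * x j.+1 + a j * x j = 0.

Lemma wronskian_sum a b beta e x y : jacobi a b x ->
    jacobi a (fun j => b j - e * beta j) y -> y 0%N = x 0%N -> y 1%N = x 1%N ->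
  forall n, a n * (x n * y n.+1 - x n.+1 * y n) = e * \sum_(1 <= j < n.+1) beta j * (x j * y j).
Proof.
move=> jx jy y0 y1; elim=> [|n IH].
  by rewrite big_geq // y0 y1; ring.
rewrite big_nat_recr //= [RHS]mulrDr -IH; have := jx n; have := jy n.
move: (x n.+2) (x n.+1) (x n) (y n.+2) (y n.+1) (y n) (a n.+1) (a n) (b n.+1) (beta n.+1).
move=> X2 X1 X0 Y2 Y1 Y0 A1 A0 B be h1 h2.
have e1 : A1 * Y2 = - (B - e * be) * Y1 - A0 * Y0 by lra.
have e2 : A1 * X2 = - B * X1 - A0 * X0 by lra.
have -> : A1 * (X1 * Y2 - X2 * Y1) = X1 * (A1 * Y2) - (A1 * X2) * Y1 by ring.
by rewrite e1 e2; ring.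
Qed.

(** The solutions depend polynomially on [e]; a linear bound is all that is used. *)
Lemma jacobi_close a b beta x : (forall j, 0 < a j) -> jacobi a b x ->
  forall n, exists2 C, 0 <= C & forall e y, 0 <= e <= 1 ->
    jacobi a (fun j => b j - e * beta j) y -> y 0%N = x 0%N -> y 1%N = x 1%N ->
    `|y n - x n| <= C * e.
Proof.
move=> a0 jx; suff key n : exists2 C, 0 <= C & forall e y, 0 <= e <= 1 ->
    jacobi a (fun j => b j - e * beta j) y -> y 0%N = x 0%N -> y 1%N = x 1%N ->
    `|y n - x n| <= C * e /\ `|y n.+1 - x n.+1| <= C * e.
  by move=> n; have [C C0 h] := key n; exists C => // e y he jy y0 y1; case: (h e y he jy y0 y1).
elim: n => [|n [C C0 IH]].
  by exists 0 => // e y _ _ -> ->; rewrite !subrr normr0 mul0r.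
pose B : R := `|b n.+1|; pose be : R := `|beta n.+1|; pose X : R := `|x n.+1|.
pose C' : R := (B * C + be * (X + C) + a n * C) / a n.+1.
have a1 := a0 n.+1; have an := a0 n; have a10 := ltW a1; have an0 := ltW an.
have B0 : 0 <= B := normr_ge0 _; have be0 : 0 <= be := normr_ge0 _.
have X0 : 0 <= X := normr_ge0 _.
have C'0 : 0 <= C'.
  apply: divr_ge0 (a10); apply: addr_ge0; last exact: mulr_ge0.
  by apply: addr_ge0; apply: mulr_ge0 => //; exact: addr_ge0.
exists (C + C'); first exact: addr_ge0.
move=> e y he jy y0 y1; have [h1 h2] := IH e y he jy y0 y1; case/andP: he => e0 e1.
have Ce : C * e <= (C + C') * e by rewrite ler_wpM2r // lerDl.
split; first exact: le_trans Ce.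
apply: le_trans (_ : C' * e <= _); last by rewrite ler_wpM2r // lerDr.
rewrite -(ler_pM2l a1) -{1}[a n.+1]gtr0_norm // -normrM.
have -> : a n.+1 * (C' * e) = (B * C + be * (X + C) + a n * C) * e.
  by rewrite /C'; field; rewrite gt_eqF.
have := jy n; have := jx n.
have yX : `|y n.+1| <= X + C.
  rewrite -[y n.+1](subrK (x n.+1)) addrC (le_trans (ler_normD _ _)) // lerD2l.
  by apply: le_trans h2 _; rewrite ler_piMr.
move=> jx' jy'.
have -> : a n.+1 * (y n.+2 - x n.+2) =
    - (b n.+1 * (y n.+1 - x n.+1)) + e * (beta n.+1 * y n.+1) - a n * (y n - x n).
  move: jx' jy'; move: (x n.+2) (x n.+1) (x n) (y n.+2) (y n.+1) (y n) => x2 x1 x0 y2 y1' y0'.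
  by move: (a n.+1) (a n) (b n.+1) (beta n.+1) => A1 A0 B1 be1 ja jb; lra.
apply: le_trans (ler_normB _ _) _; rewrite [leRHS]mulrDl; apply: lerD; last first.
  by rewrite normrM gtr0_norm // -mulrA ler_wpM2l // ltW.
apply: le_trans (ler_normD _ _) _; rewrite [leRHS]mulrDl; apply: lerD.
  by rewrite normrN normrM -mulrA ler_wpM2l.
rewrite normrM (ger0_norm e0) mulrC ler_wpM2r // normrM ler_wpM2l //.
Qed.

(** Bending the table at some bounces, always to the same side, separates the
    perturbed Jacobi field from the original one: to first order in [e] their
    Wronskian is a sum of squares. *)
Lemma wronskian_neq0 a b beta x n m : (forall j, 0 < a j) -> jacobi a b x ->
    (forall j, 0 <= beta j) -> (0 < m <= n)%N -> 0 < beta m -> x m != 0 ->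
  exists2 e0 : R, 0 < e0 & forall e y, 0 < e < e0 ->
    jacobi a (fun j => b j - e * beta j) y -> y 0%N = x 0%N -> y 1%N = x 1%N ->
    x n * y n.+1 - x n.+1 * y n != 0.
Proof.
move=> a0 jx be0 /andP[m0 mn] bm xm.
have cl := jacobi_close beta a0 jx.
pose s := \sum_(1 <= j < n.+1) beta j * (x j * x j).
have s0 : 0 < s.
  have t0 j : 0 <= beta j * (x j * x j) by rewrite mulr_ge0 // -expr2 sqr_ge0.
  rewrite /s (bigD1_seq m) //= ?iota_uniq ?mem_index_iota ?m0 ?ltnS //.
  by rewrite ltr_wpDr ?sumr_ge0 // mulr_gt0 // -expr2 exprn_even_gt0.
have [K K0 hK] : exists2 K, 0 <= K & forall e y, 0 <= e <= 1 ->
    jacobi a (fun j => b j - e * beta j) y -> y 0%N = x 0%N -> y 1%N = x 1%N ->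
    s - K * e <= \sum_(1 <= j < n.+1) beta j * (x j * y j).
  rewrite /s; elim: n {mn s s0} => [|n [K K0 IH]].
    by exists 0 => // e y _ _ _ _; rewrite !big_geq // mul0r subr0.
  have [C C0 hC] := cl n.+1; exists (K + beta n.+1 * (`|x n.+1| * C)).
    by rewrite addr_ge0 // !mulr_ge0.
  move=> e y he jy y0 y1; rewrite [in leLHS]big_nat_recr //= [in leRHS]big_nat_recr //=.
  have h1 := IH e y he jy y0 y1; have h2 := hC e y he jy y0 y1.
  have h3 : - (beta n.+1 * (`|x n.+1| * (C * e))) <= beta n.+1 * (x n.+1 * (y n.+1 - x n.+1)).
    rewrite -mulrN ler_wpM2l //; apply: le_trans (_ : - `|x n.+1 * (y n.+1 - x n.+1)| <= _).
      by rewrite lerN2 normrM ler_wpM2l.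
    by rewrite lerNl -normrN ler_norm.
  move: h1 h3; move: (\sum_(1 <= j < n.+1) _) (\sum_(1 <= j < n.+1) _) => S1 S2.
  move: (x n.+1) (y n.+1) (`|_|) (beta n.+1) => A B C1 D1 h1 h3.
  by lra.
exists (Num.min 1 (s / (K + 1))); first by rewrite lt_min ltr01 divr_gt0 // ltr_wpDl.
move=> e y /andP[e0]; rewrite lt_min => /andP[e1 eK] jy y0 y1.
have he : 0 <= e <= 1 by rewrite !ltW.
have hs := hK e y he jy y0 y1; have := wronskian_sum jx jy y0 y1 n.
have eK' : e * (K + 1) < s by rewrite -ltr_pdivlMr // ltr_wpDl.
have pos : 0 < \sum_(1 <= j < n.+1) beta j * (x j * y j) by apply: lt_le_trans hs; lra.
move=> e2; apply: contraTneq (mulr_gt0 e0 pos) => z.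
by rewrite -e2 z mulr0 ltxx.
Qed.

End Wronskian.

Lemma mulmx_row_inj (R : realType) (M N : 'M[R]_2) :
  (forall w : 'rV[R]_2, w *m M = w *m N) -> M = N.
Proof. by move=> h; apply/row_matrixP => i; rewrite !rowE h. Qed.

Lemma iter_same (A : Type) (f f' : A -> A) p :
  (forall i, f' (iter i f p) = f (iter i f p)) -> forall i, iter i f' p = iter i f p.
Proof. by move=> h; elim=> //= i ->. Qed.

Lemma Diter_same (R : realType) (f f' : 'rV[R]_2 -> 'rV[R]_2) Df Df' p :
    (forall i, iter i f' p = iter i f p) ->
    (forall i w, Df' (iter i f p) w = Df (iter i f p) w) ->
  forall i w, Diter f' Df' i p w = Diter f Df i p w.
Proof. by move=> it h; elim=> //= i IH w; rewrite it h IH. Qed.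

Lemma jacobi_sequence (R : realType) (gamma : R -> 'rV[R]_2) th O p w (cc : convex_curve gamma th)
    (Pp : phase_space gamma O p) : let t j := base (iter j (billiard_map gamma O) p) in
  jacobi (fun j => dd gamma (t j) (t j.+1))
    (fun j => if j is k.+1 then det2 (derive1 (derive1 gamma) (t k.+1))
      (gamma (t k.+2) - gamma (t k)) else 0)
    (fun j => Diter (billiard_map gamma O) (Dmap gamma O) j p w 0 0).
Proof. by move=> t j; exact: (jacobi_equation cc w j Pp). Qed.

Lemma jacobi_ext (R : realType) (a a' b b' : nat -> R) x : (forall j, a' j = a j) ->
  (forall j, b' j.+1 = b j.+1) -> jacobi a' b' x -> jacobi a b x.
Proof. by move=> ea eb jx j; have := jx j; rewrite !ea eb. Qed.

Section Contact.
Context {R : realType}.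
Context (gamma gamma' : R -> 'rV[R]_2) (th th' : R -> R).
Context (cc : convex_curve gamma th) (cc' : convex_curve gamma' th') (O : 'rV[R]_2).
Implicit Types (p w : 'rV[R]_2) (a b t : R) (i n : nat).

Notation P := (phase_space gamma O).
Notation P' := (phase_space gamma' O).
Notation T := (billiard_map gamma O).
Notation T' := (billiard_map gamma' O).
Notation Ti := (billiard_inv gamma O).
Notation Ti' := (billiard_inv gamma' O).

Definition touch t : Prop := gamma' t = gamma t /\ derive1 gamma' t = derive1 gamma t.

Definition osculate t : Prop :=
  touch t /\ derive1 (derive1 gamma') t = derive1 (derive1 gamma) t.

Let touch_bounce a b : touch a -> touch b -> bounce gamma' O a b = bounce gamma O a b.
Proof. by move=> [_ a1] [b0 _]; rewrite /bounce /ss a1 b0. Qed.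

Let touch_adj a b : touch a -> touch b -> adj gamma a b -> adj gamma' a b.
Proof. by move=> [_ a1] [_ b1]; rewrite /adj /dd a1 b1. Qed.

(** Orbits only see the curve to first order at their bounces, and their
    linearization to second order. *)
Lemma touch_map p : P p -> touch (base p) -> touch (base (T p)) -> P' p /\ T' p = T p.
Proof.
move=> Pp tp tq; have [ab pE qE] := billiard_step cc Pp.
have ab' := touch_adj tp tq ab.
have pE' : p = bounce gamma' O (base p) (base (T p)) by rewrite touch_bounce.
split; first by rewrite pE'; exact: (adj_phase cc' O ab').
by rewrite [in LHS]pE' (billiard_mapE cc' O ab') touch_bounce.
Qed.

Lemma touch_inv p : P p -> touch (base p) -> touch (base (Ti p)) -> Ti' p = Ti p.
Proof.
move=> Pp tp tq; have [ab pE qE] := billiard_back cc Pp.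
have ab' := touch_adj tq tp ab.
have pE' : p = bounce gamma' O (base p) (base (Ti p)) by rewrite touch_bounce.
by rewrite [in LHS]pE' (billiard_invE cc' O ab') touch_bounce.
Qed.

Let fwd i p (Pp : P p) : P (iter i T p) :=
  flow_in (flow_iter i (sys_fwd (billiard_system cc O))) Pp.
Let bwd i p (Pp : P p) : P (iter i Ti p) :=
  flow_in (flow_iter i (sys_bwd (billiard_system cc O))) Pp.

Lemma touch_orbit p : P p -> (forall i, touch (base (iter i T p))) ->
  P' p /\ forall i, iter i T' p = iter i T p.
Proof.
move=> Pp tc; split; first exact: (touch_map Pp (tc 0%N) (tc 1%N)).1.
by apply: iter_same => i; exact: (touch_map (fwd i Pp) (tc i) (tc i.+1)).2.
Qed.

Lemma touch_back_orbit p : P p -> (forall i, touch (base (iter i Ti p))) ->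
  forall i, iter i Ti' p = iter i Ti p.
Proof. by move=> Pp tc; apply: iter_same => i; exact: touch_inv (bwd i Pp) (tc i) (tc i.+1). Qed.

Let osculate_dss a b : osculate a -> touch b -> dss gamma' O a b = dss gamma O a b.
Proof. by move=> [_ a2] [b0 _]; rewrite /dss a2 b0. Qed.

Let touch_dd a b : touch a -> touch b -> dd gamma' a b = dd gamma a b.
Proof. by move=> [_ a1] [_ b1]; rewrite /dd a1 b1. Qed.

Lemma osculate_Dmap p w : P p -> osculate (base p) -> osculate (base (T p)) ->
  Dmap gamma' O p w = Dmap gamma O p w.
Proof.
move=> Pp op oq; have [_ e] := touch_map Pp op.1 oq.1.
rewrite /Dmap /Dbounce /Droot (next_paramT cc) (next_paramT cc') e -/(base p).
rewrite (osculate_dss op oq.1) (osculate_dss oq op.1).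
by rewrite (touch_dd op.1 oq.1) (touch_dd oq.1 op.1).
Qed.

Lemma osculate_Dinv p w : P p -> P' p -> osculate (base p) -> osculate (base (Ti p)) ->
  Dinv gamma' O p w = Dinv gamma O p w.
Proof.
move=> Pp Pp' op oq; have e := touch_inv Pp op.1 oq.1.
rewrite /Dinv /Dbounce /Droot (prev_paramT cc Pp) (prev_paramT cc' Pp') e -/(base p).
rewrite (osculate_dss op oq.1) (osculate_dss oq op.1).
by rewrite (touch_dd op.1 oq.1) (touch_dd oq.1 op.1).
Qed.

Lemma osculate_orbit p : P p -> (forall i, osculate (base (iter i T p))) ->
  forall i w, Diter T' (Dmap gamma' O) i p w = Diter T (Dmap gamma O) i p w.
Proof.
move=> Pp oc; have [_ it] := touch_orbit Pp (fun i => (oc i).1).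
by apply: (Diter_same it) => i w; exact: osculate_Dmap (fwd i Pp) (oc i) (oc i.+1).
Qed.

Lemma osculate_back_orbit p : P p -> P' p -> (forall i, osculate (base (iter i Ti p))) ->
  forall i w, Diter Ti' (Dinv gamma' O) i p w = Diter Ti (Dinv gamma O) i p w.
Proof.
move=> Pp Pp' oc; have it := touch_back_orbit Pp (fun i => (oc i).1).
apply: (Diter_same it) => i w; apply: osculate_Dinv (bwd i Pp) _ (oc i) (oc i.+1).
by rewrite -it; exact: (flow_in (flow_iter i (sys_bwd (billiard_system cc' O))) Pp').
Qed.

(** Contact of order two along a periodic orbit preserves its period and its
    multipliers. *)
Lemma osculate_hyperbolic p : hyperbolic_periodic gamma O p ->
  (forall i, osculate (base (iter i T p))) -> hyperbolic_periodic gamma' O p.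
Proof.
move=> [n [Pp n0 per least] hyp] oc; have [Pp' it] := touch_orbit Pp (fun i => (oc i).1).
exists n.
  split; [exact: Pp' | exact: n0 | by rewrite it |].
  by move=> m mn; rewrite it; exact: least.
have F := flow_iter n (sys_fwd (billiard_system cc O)).
have F' := flow_iter n (sys_fwd (billiard_system cc' O)).
suff -> : jacobian (iter n T') p = jacobian (iter n T) p by [].
have J w : w *m jacobian (iter n T') p = w *m jacobian (iter n T) p.
  have e1 := C11_jacobian w (flow_C11 F Pp); have e2 := C11_jacobian w (flow_C11 F' Pp').
  exact: etrans e2 (etrans (osculate_orbit Pp oc n w) (esym e1)).
exact: mulmx_row_inj J.
Qed.

Lemma osculate_saddle p n (j : int) (lam mu : R) vs vu :
    (forall i, osculate (base (iter i T p))) ->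
  saddle P T (Dmap gamma O) p n j lam mu vs vu -> saddle P' T' (Dmap gamma' O) p n j lam mu vs vu.
Proof.
move=> oc [Pp n0 per l01 lm fr Dvs Dvu]; have [Pp' it] := touch_orbit Pp (fun i => (oc i).1).
exact: (Saddle Pp' n0 (etrans (it n) per) l01 lm fr
  (etrans (osculate_orbit Pp oc n vs) Dvs) (etrans (osculate_orbit Pp oc n vu) Dvu)).
Qed.

End Contact.

(** * Breaking a tangency by bending the table at one bounce *)

Section BumpField.
Context {R : realType}.
Implicit Types (F N : R -> 'rV[R]_2) (m : R -> R) (s t : R).

Lemma derive1_scale m N : smooth m -> smooth N ->
  derive1 (fun t => m t *: N t) = fun t => derive1 m t *: N t + m t *: derive1 N t.
Proof.
move=> sm sN; apply/funext => t.
have dc i : is_derive t 1 (fun s => (m s *: N s) 0 i)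
    (derive1 m t * N t 0 i + m t * derive1 N t 0 i).
  have -> : (fun s => (m s *: N s) 0 i) = fun s => m s * N s 0 i.
    by apply/funext => s; rewrite mxE.
  exact: isD_mul (smooth_is t sm) (coord_is t i sN).
have dF : derivable (fun t => m t *: N t) t 1.
  by apply: derivable_coord => i; exact: (@ex_derive _ _ _ _ _ _ _ (dc i)).
have E i : derive1 (fun t => m t *: N t) t 0 i = derive1 m t * N t 0 i + m t * derive1 N t 0 i.
  by rewrite -derive1_coord // derive1E (@derive_val _ _ _ _ _ _ _ (dc i)).
move: E; move: (derive1 (fun t => m t *: N t) t) (derive1 m t) (N t) (m t) (derive1 N t).
by move=> A B C D F E; apply: vec2P; rewrite E !mxE.
Qed.

Lemma smooth_scale m N : smooth m -> smooth N -> smooth (fun t => m t *: N t).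
Proof.
move=> sm sN; apply: coord_smooth => i.
have -> : (fun s => (m s *: N s) 0 i) = fun s => m s * N s 0 i.
  by apply/funext => s; rewrite mxE.
exact: smoothM sm (@smooth_coord _ _ i sN).
Qed.

Lemma derive1_locally0 F c d : (forall s, cos (s - c) < cos d -> F s = 0) ->
  forall s, cos (s - c) < cos d -> derive1 F s = 0.
Proof.
move=> F0 s sd; have cs : {for s, continuous (fun s => cos (s - c))}.
  exact: is_derive_cont (isD_comp (is_derive_cos _) (isD_sub (isD_id s) (isD_cst c s))).
rewrite derive1E -(derive_cst (0 : 'rV[R]_2) s 1); apply: near_eq_derive.
have e0 : 0 < cos d - cos (s - c) by rewrite subr_gt0.
move/cvgrPdist_lt/(_ _ e0): cs; apply: filterS => t ht; rewrite F0 //.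
by move: ht; rewrite ltr_norml => /andP[ht _]; lra.
Qed.

Context (gamma : R -> 'rV[R]_2) (th : R -> R) (cc : convex_curve gamma th).
Context (c d : R) (d0 : 0 < d < pi).

Let nu := normal_field gamma (bump c d).

Lemma bump_field_smooth : smooth nu /\ periodic nu (2 * pi).
Proof.
have sb := @smooth_bump R c d; have pb := @periodic_bump R c d.
by have [s p] := normal_field_smooth cc sb pb.
Qed.

Lemma bump_field_away t : cos (t - c) < cos d ->
  [/\ nu t = 0, derive1 nu t = 0 & derive1 (derive1 nu) t = 0].
Proof.
have nu0 s : cos (s - c) < cos d -> nu s = 0.
  by move=> /ltW sd; rewrite /nu /normal_field (bump_eq0 sd) scale0r.
have nu1 := derive1_locally0 nu0; have nu2 := derive1_locally0 nu1.
by move=> td; split; [exact: nu0 | exact: nu1 | exact: nu2].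
Qed.

(** At its centre the field vanishes with its derivative, and its second derivative
    points into the table. *)
Lemma bump_field_center t : cos (t - c) = 1 ->
  [/\ nu t = 0, derive1 nu t = 0 & det2 (derive1 (derive1 nu) t) (derive1 gamma t) < 0].
Proof.
move=> ct; have [sn pn] := bump_field_smooth.
have p1 := derive1_periodic pn; have p2 := derive1_periodic p1.
have pg1 := derive1_periodic (cc_periodic cc).
have [|j tE] := cos_1_sin_0 ct.
  by apply/eqP; rewrite -(@sqrf_eq0 R) sin2cos2 ct expr1n subrr.
have {tE} -> : t = c + 2 * pi * j%:~R by rewrite -tE addrC subrK.
rewrite (periodicz pn) (periodicz p1) (periodicz p2) (periodicz pg1).
have [b0 b1 b2] := bump_center c d0.
have s1 : smooth (fun _ : R => 1 : R) by apply/smoothE => n; exact: Cn_cst.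
have p1' : periodic (fun _ : R => 1 : R) (2 * pi : R) by [].
have [sN _] := normal_field_smooth cc s1 p1'.
pose N := normal_field gamma (fun=> 1); rewrite -/N in sN.
have nuE : nu = fun t => bump c d t *: N t.
  by apply/funext => s; rewrite /nu /N /normal_field scale1r.
have sb := @smooth_bump R c d; have sb1 := smooth_derive1 sb; have sN1 := smooth_derive1 sN.
have d1 : derive1 nu = fun t => derive1 (bump c d) t *: N t + bump c d t *: derive1 N t.
  by rewrite nuE; exact: derive1_scale sb sN.
have d2 : derive1 (derive1 nu) c = derive1 (derive1 (bump c d)) c *: N c.
  rewrite d1; under eq_fun do rewrite -[X in _ + X]scale1r.
  rewrite (derive1_line 1 (smooth_scale sb1 sN) (smooth_scale sb sN1)).
  by rewrite (derive1_scale sb1 sN) (derive1_scale sb sN1) b0 b1 !scale0r !addr0 scaler0 addr0.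
split; first by rewrite nuE b0 scale0r.
  by rewrite d1 b0 b1 !scale0r addr0.
rewrite d2 det2Zl pmulr_rlt0 // /N /normal_field scale1r /unit_normal.
have v0 := cc_speed cc c; have g1E : derive1n 1 gamma c = derive1 gamma c by [].
rewrite g1E det2Zl pmulr_rlt0 ?invr_gt0 // det2E pair2_0 pair2_1.
have := exprn_gt0 2 v0; rewrite /speed eucl_sqr.
by move: (derive1 gamma c 0 0) (derive1 gamma c 0 1) => X Y h; rewrite !expr2 in h; lra.
Qed.

End BumpField.

Section BreakTangency.
Context {R : realType}.
Context (gamma : R -> 'rV[R]_2) (th : R -> R) (cc : convex_curve gamma th) (O : 'rV[R]_2).
Implicit Types (p w z : 'rV[R]_2) (i j n : nat) (e : R).

Notation P := (phase_space gamma O).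
Notation T := (billiard_map gamma O).
Notation Ti := (billiard_inv gamma O).
Notation DT := (Dmap gamma O).
Notation DTi := (Dinv gamma O).
Notation g1 := (derive1 gamma).
Notation g2 := (derive1 (derive1 gamma)).

Context (nu : R -> 'rV[R]_2) (snu : smooth nu).
Notation n1 := (derive1 nu).
Notation n2 := (derive1 (derive1 nu)).
Notation bent e := (fun t => gamma t + e *: nu t).

Let bent1 e t : derive1 (bent e) t = g1 t + e *: n1 t.
Proof. by rewrite (derive1_line e (cc_smooth cc) snu). Qed.

Let bent2 e t : derive1 (derive1 (bent e)) t = g2 t + e *: n2 t.
Proof.
rewrite (derive1_line e (cc_smooth cc) snu).
by rewrite (derive1_line e (smooth_derive1 (cc_smooth cc)) (smooth_derive1 snu)).
Qed.

Lemma bent_touch e t : nu t = 0 -> n1 t = 0 -> touch gamma (bent e) t.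
Proof. by move=> t0 t1; split; rewrite ?bent1 ?t0 ?t1 scaler0 addr0. Qed.

Lemma bent_osculate e t : nu t = 0 -> n1 t = 0 -> n2 t = 0 -> osculate gamma (bent e) t.
Proof. by move=> t0 t1 t2; split; [exact: bent_touch | rewrite bent2 t2 scaler0 addr0]. Qed.

Lemma parallel_momenta (W W' : 'rV[R]_2) (A B x1 y1 : R) :
  W 0 1 = B * W 0 0 - A * x1 -> W' 0 1 = B * W' 0 0 - A * y1 -> 0 < A -> det2 W W' = 0 ->
  W 0 0 * y1 - x1 * W' 0 0 = 0.
Proof.
rewrite det2E => -> -> A0 h; have : A * (W 0 0 * y1 - x1 * W' 0 0) = 0 by lra.
by move/eqP; rewrite mulf_eq0 gt_eqF //= => /eqP.
Qed.

(** A vector contracted in both directions gives a Jacobi field that is small at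
    both ends.  If bending at bounces where this field does not vanish left such a
    vector, the two Jacobi fields, equal in the far past, would also be parallel in
    the far future, against [wronskian_neq0]. *)
Lemma bending_breaks_tangency z n n' w0 K i : P z -> (0 < n)%N -> (0 < n')%N -> w0 != 0 ->
    decays T DT n z w0 -> decays Ti DTi n' z w0 ->
    (forall j t, t = base (iter j T z) \/ t = base (iter j Ti z) ->
      [/\ nu t = 0, n1 t = 0 & det2 (n2 t) (g1 t) <= 0]) ->
    (forall j t, (K <= j)%N -> t = base (iter j T z) \/ t = base (iter j Ti z) -> n2 t = 0) ->
    det2 (n2 (base (iter i T z))) (g1 (base (iter i T z))) < 0 ->
    (Diter T DT i z w0) 0 0 != 0 ->
  exists2 e0 : R, 0 < e0 & forall e th', 0 < e < e0 -> convex_curve (bent e) th' ->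
    forall u, decays (billiard_map (bent e) O) (Dmap (bent e) O) n z u ->
      decays (billiard_inv (bent e) O) (Dinv (bent e) O) n' z u -> u = 0.
Proof.
move=> Pz n0 n'0 w0n0 fw bw flat1 flat2 bi xi0.
have S := billiard_system cc O.
(* the Jacobi fields are followed from [M] bounces before [z], where the bending has
   not begun, to [K2] periods after [z], where it is over *)
have [M ME] : exists M : nat, M = (K.+1 * n')%N by eexists.
have [K2 K2E] : exists K2 : nat, K2 = (K + i)%N by eexists.
have [L LE] : exists L : nat, L = (K2 * n + M)%N by eexists.
have KM : (K < M)%N by rewrite ME leq_pmulr.
have K2n : (K2 <= K2 * n)%N by rewrite leq_pmulr.
have KK2 : (K <= K2 * n)%N by rewrite (leq_trans _ K2n) // K2E leq_addr.
pose p := iter M Ti z.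
have Pp : P p := flow_in (flow_iter M (sys_bwd S)) Pz.
have Pit j : P (iter j T p) := flow_in (flow_iter j (sys_fwd S)) Pp.
have back j : iter (j + M) T p = iter j T z.
  by rewrite iterD (iter_cancel M (flow_in (sys_bwd S)) (sys_gK S) Pz).
have pz : iter M T p = z by have := back 0%N; rewrite add0n.
have pLz : iter L T p = iter (K2 * n) T z by rewrite LE back.
have early j : (j <= M)%N -> iter j T p = iter (M - j) Ti z.
  move=> jM; rewrite /p -{1}(subnKC jM) iterD.
  have Pk : P (iter (M - j) Ti z) := flow_in (flow_iter (M - j) (sys_bwd S)) Pz.
  exact: (iter_cancel j (flow_in (sys_bwd S)) (sys_gK S) Pk).
have on_orbit j : exists k, base (iter j T p) = base (iter k T z) \/
    base (iter j T p) = base (iter k Ti z).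
  have [jM|Mj] := leqP j M; first by exists (M - j)%N; right; rewrite early.
  by exists (j - M)%N; left; rewrite -back subnK // ltnW.
pose t j := base (iter j T p).
have flat j : [/\ nu (t j) = 0, n1 (t j) = 0 & det2 (n2 (t j)) (g1 (t j)) <= 0].
  by have [k hk] := on_orbit j; exact: flat1 hk.
pose w' := Diter Ti DTi M z w0.
have w'K : Diter T DT M p w' = w0 := Diter_cancel M (system_inv S) w0 Pz.
pose x j : R := (Diter T DT j p w') 0 0.
pose a j : R := dd gamma (t j) (t j.+1).
have a0 j : 0 < a j := a_gt0 cc (Pit j).
have [c cP] : exists c : nat -> R, forall j,
    0 < c j /\ gamma (t j.+2) - gamma (t j) = c j *: g1 (t j.+1).
  have : forall j, exists k : R, 0 < k /\ gamma (t j.+2) - gamma (t j) = k *: g1 (t j.+1).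
    by move=> j; have [k k0 kE] := billiard_chord cc (Pit j); exists k.
  by case/choice => c cP; exists c.
pose b j : R := if j is k.+1 then det2 (g2 (t k.+1)) (gamma (t k.+2) - gamma (t k)) else 0.
pose beta j : R := if j is k.+1 then - (c k * det2 (n2 (t k.+1)) (g1 (t k.+1))) else 0.
have jx : jacobi a b x by exact: (jacobi_sequence w' cc Pp).
have be0 j : 0 <= beta j.
  case: j => // j; have [_ _] := flat j.+1; have [cj _] := cP j.
  by rewrite /beta oppr_ge0 (pmulr_rle0 _ cj).
have mM : (0 < i + M <= L)%N.
  rewrite addn_gt0 (leq_trans _ KM) // orbT /= LE leq_add2r.
  by apply: leq_trans K2n; rewrite K2E leq_addl.
have bm : 0 < beta (i + M)%N.
  have tE : t (i + M)%N = base (iter i T z) by rewrite /t back.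
  have := mM; rewrite -tE in bi; case: (i + M)%N bi => // k bi _.
  by rewrite /beta oppr_gt0 pmulr_rlt0 //; case: (cP k).
have xm : x (i + M)%N != 0.
  by rewrite /x DiterD w'K pz.
have [e0 e00 wr] := wronskian_neq0 a0 jx be0 mM bm xm.
exists e0 => // e th' he cc' u fu bu; apply/eqP; apply: contraT => u0.
have S' := billiard_system cc' O.
set G := bent e in cc' S' fu bu *.
have tcz k : touch gamma G (base (iter k T z)).
  by have [h0 h1 _] := flat1 k _ (or_introl erefl); exact: bent_touch.
have tcz' k : touch gamma G (base (iter k Ti z)).
  by have [h0 h1 _] := flat1 k _ (or_intror erefl); exact: bent_touch.
have tcp k : touch gamma G (t k).
  by have [h0 h1 _] := flat k; exact: bent_touch.
have [Pz' itz] := touch_orbit cc cc' Pz tcz.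
have itz' := touch_back_orbit cc cc' Pz tcz'.
have [Pp' itp] := touch_orbit cc cc' Pp tcp.
have osc k : (K <= k)%N -> osculate gamma G (base (iter k T z)).
  move=> Kk; have h2 := flat2 k _ Kk (or_introl erefl).
  by have [h0 h1 _] := flat1 k _ (or_introl erefl); exact: bent_osculate.
have osc' k : (K <= k)%N -> osculate gamma G (base (iter k Ti z)).
  move=> Kk; have h2 := flat2 k _ Kk (or_intror erefl).
  by have [h0 h1 _] := flat1 k _ (or_intror erefl); exact: bent_osculate.
(* in the far past the perturbed field is a multiple of the original one *)
pose u' := Diter (billiard_inv G O) (Dinv G O) M z u.
have u'0 : u' != 0.
  apply: contra_neq u0 => u'0.
  have := Diter_cancel M (system_inv S') u Pz'; rewrite -/u' u'0 => <-.
  have F' := flow_iter M (sys_fwd S').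
  have Pq : phase_space G O (iter M (billiard_inv G O) z).
    exact: (flow_in (flow_iter M (sys_bwd S')) Pz').
  by have [_ sc] := C11_lin (flow_C11 F' Pq); have := sc (iter M (billiard_inv G O) z) 0 0; rewrite !scale0r.
have bu' : decays Ti DTi n' p u'.
  have h := decays_iter K.+1 bu; rewrite -ME itz' -/p -/u' in h.
  apply: decays_eq h => k; apply: (osculate_back_orbit cc cc' Pp Pp') => l.
  by rewrite /p -iterD; apply: osc'; rewrite (leq_trans (ltnW KM)) // leq_addl.
have bw' : decays Ti DTi n' p w'.
  by have h := decays_iter K.+1 bw; rewrite -ME in h; exact: h.
have [k w'E] := det2_colinear (decays_det (sys_bwd S) Pp bu' bw') u'0.
pose y j : R := (Diter (billiard_map G O) (Dmap G O) j p w') 0 0.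
have yz : Diter (billiard_map G O) (Dmap G O) M p w' = k *: u.
  have Pq : phase_space G O (iter M (billiard_inv G O) z).
    exact: (flow_in (flow_iter M (sys_bwd S')) Pz').
  have F' := flow_iter M (sys_fwd S'); have [_ sc] := C11_lin (flow_C11 F' Pq).
  have h := Diter_cancel M (system_inv S') u Pz'.
  by rewrite w'E -/p /p -itz' sc h.
(* at the bounces, the perturbed curve differs from the original one only in its
   second derivative, hence only in the diagonal coefficients *)
have jy : jacobi a (fun j => b j - e * beta j) y.
  have tE : (fun j => base (iter j (billiard_map G O) p)) = t.
    by apply/funext => j; rewrite itp.
  have := jacobi_sequence w' cc' Pp'; rewrite tE; apply: jacobi_ext => j.
    by have [_ h1] := tcp j; have [_ h2] := tcp j.+1; rewrite /dd h1 h2.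
  have [h1 _] := tcp j; have [h2 _] := tcp j.+2; have [_ cE] := cP j.
  rewrite /b /beta bent2 h1 h2 cE.
  move: (g2 (t j.+1)) (g1 (t j.+1)) (n2 (t j.+1)) (c j) => A B C k0.
  by rewrite !det2E !mxE; ring.
have y0 : y 0%N = x 0%N := erefl (w' 0 0).
have y1 : y 1%N = x 1%N.
  have o0 : osculate gamma G (base p) by exact: osc' (ltnW KM).
  have o1 : osculate gamma G (base (T p)).
    have M0 : (0 < M)%N := leq_ltn_trans (leq0n K) KM.
    have Tp : T p = iter (M - 1) Ti z := early 1%N M0.
    by rewrite Tp; apply: osc'; rewrite subn1 -ltnS prednK.
  have h := osculate_Dmap cc cc' w' Pp o0 o1.
  exact: (congr1 (fun q : 'rV[R]_2 => q 0 0) h).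
have := wr e y he jy y0 y1.
(* in the far future both fields are contracted, hence parallel *)
pose q := iter L T p; have Pq : P q := Pit L.
have qz : q = iter (K2 * n) T z := pLz.
pose W := Diter T DT L p w'; pose W' := Diter (billiard_map G O) (Dmap G O) L p w'.
have dW : decays T DT n q W.
  have h := decays_iter K2 fw; rewrite qz /W LE DiterD w'K pz; exact: h.
have oq l : osculate gamma G (base (iter l T q)).
  rewrite qz -iterD; exact: osc (leq_trans KK2 (leq_addl l _)).
have dW' : decays T DT n q W'.
  have h := decays_iter K2 (decays_scale k (sys_fwd S') Pz' fu).
  have e1 : iter M (billiard_map G O) p = z := etrans (itp M) pz.
  rewrite itz -qz in h; have e2 : W' = Diter (billiard_map G O) (Dmap G O) (K2 * n) z (k *: u).
    rewrite /W' LE DiterD yz e1; exact: erefl.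
  rewrite -e2 in h; apply: decays_eq h => l; exact: (osculate_orbit cc cc' Pq oq).
have WW := decays_det (sys_fwd S) Pq dW dW'.
have m1 := Dmap_momentum cc W Pq; have m2 := Dmap_momentum cc W' Pq.
have e2 : Dmap gamma O q W' 0 0 = y L.+1.
  have h := osculate_Dmap cc cc' W' Pq (oq 0%N) (oq 1%N).
  rewrite -h; exact: (congr1 (fun v : 'rV[R]_2 => Dmap G O v W' 0 0) (esym (itp L))).
rewrite e2 in m2; have wz := parallel_momenta m1 m2 (a0 L) WW.
by move/eqP; case; exact: wz.
Qed.

End BreakTangency.

(** * Transverse heteroclinic points *)

Section Assembly.
Context {R : realType}.
Implicit Types (gamma : R -> 'rV[R]_2) (p q w x y z O : 'rV[R]_2).

Lemma cyl_eq_sym p q : cyl_eq p q -> cyl_eq q p.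
Proof. by move=> [j ->]; exists (- j); rewrite -addrA cyl_shiftD subrr cyl_shift0 addr0. Qed.

Lemma cyl_eq_trans p q w : cyl_eq p q -> cyl_eq q w -> cyl_eq p w.
Proof. by move=> [i ->] [j ->]; exists (j + i); rewrite -addrA cyl_shiftD. Qed.

Lemma stable_param_point P f Df x n (lam : R) vs phi z :
  stable_param P f Df x n lam vs phi -> stable_set P f x z -> exists u, cyl_eq z (phi u).
Proof. by move=> [[_ _ _ _ E] _ _ _]; rewrite E. Qed.

(** Over [n'] periods of [x] and [n] periods of [p], the return map multiplies the
    parameter [u] of [p] by a power of [lam] and fixes [p], so that [u = 0]. *)
Lemma stable_param_periodic P f g Df Dg x n (lam : R) vs phi (u : R) p n' (j : int) :
    system P f g Df Dg -> `|lam| < 1 -> (0 < n')%N -> stable_param P f Df x n lam vs phi ->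
    P p -> iter n' f p = p + cyl_shift j -> cyl_eq p (phi u) -> cyl_eq p x.
Proof.
move=> S l1 n'0 [[_ _ _ inj _] [phi0 _] Pphi it] Pp per pu.
have [i piE] := iter_period (sys_fwd S) Pp per n.
have [k /(_ u)[kE _]] := it n'.
suff u0 : u = 0 by rewrite -phi0 -[in X in phi X]u0.
have [j' pE] := pu; have Pu := (Pphi u).1.
have e : cyl_eq (phi u) (phi (lam ^+ n' * u)).
  apply: cyl_eq_trans (cyl_eq_sym pu) _; apply: cyl_eq_trans (_ : cyl_eq p (iter (n * n') f p)) _.
    by apply: cyl_eq_sym; rewrite piE; exists i.
  rewrite pE (flow_shift (flow_iter _ (sys_fwd S)) j' Pu) mulnC kE.
  by exists (k + j'); rewrite -addrA cyl_shiftD.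
have := inj _ _ e => uE; apply/eqP; apply: contraT => u0; exfalso.
have : `|lam ^+ n'| < 1 by rewrite normrX exprn_ilt1 // -lt0n.
have : lam ^+ n' = 1 by apply: (mulIf u0); rewrite mul1r -uE.
by move=> ->; rewrite normr1 ltxx.
Qed.

Lemma transverse_heteroclinic gamma th O x y z n n' (j j' : int) (lam mu lam' mu' : R)
    vs vu vs' vu' (cc : convex_curve gamma th) :
    saddle (phase_space gamma O) (billiard_map gamma O) (Dmap gamma O) x n j lam mu vs vu ->
    saddle (phase_space gamma O) (billiard_inv gamma O) (Dinv gamma O) y n' j' lam' mu' vs' vu' ->
    heteroclinic gamma O x y z ->
    (forall w, decays (billiard_map gamma O) (Dmap gamma O) n z w ->
      decays (billiard_inv gamma O) (Dinv gamma O) n' z w -> w = 0) ->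
  exists Vs Vu : {vspace 'rV[R]_2},
    [/\ is_tangent_space (Ws gamma O x) z Vs, is_tangent_space (Wu gamma O y) z Vu,
      directv (Vs + Vu)%VS & (Vs + Vu)%VS = fullv].
Proof.
move=> sx sy [zx zy _] no; have S := billiard_system cc O.
have [phi hphi] := saddle_stable_param S sx.
have [psi hpsi] := saddle_stable_param (system_inv S) sy.
have [u zu] := stable_param_point hphi zx; have [v zv] := stable_param_point hpsi zy.
have /andP[_ l1] := sad_lam sx; have /andP[_ l1'] := sad_lam sy.
exact: transverse_tangent_spaces S zx.1 l1 l1' hphi hpsi zu zv no.
Qed.

Lemma least_period_saddle gamma th O x (cc : convex_curve gamma th) :
    hyperbolic_periodic gamma O x -> exists n j lam mu vs vu,
  saddle (phase_space gamma O) (billiard_map gamma O) (Dmap gamma O) x n j lam mu vs vu.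
Proof.
move=> [n [Px n0 [j per] _] hyp]; exists n, j.
exact: hyperbolic_saddle (billiard_system cc O) Px n0 per hyp.
Qed.

End Assembly.

Theorem proposition7p1 (R : realType)
  (T1 : set (R -> 'rV[R]_2))
  (T1_residual : residual T1)
  (T1_no_repeat : T1 `<=` no_repeated_boundary_point)
  (gamma : R -> 'rV[R]_2) (T1gamma : T1 gamma)
  (O : 'rV[R]_2) (O_interior : (region gamma)° O)
  (x y : 'rV[R]_2)
  (x_hyp : hyperbolic_periodic gamma O x)
  (y_hyp : hyperbolic_periodic gamma O y)
  (k : nat) (k_ge2 : (2 <= k)%N) :
  heteroclinic gamma O x y !=set0 ->
  exists2 z : 'rV[R]_2, heteroclinic gamma O x y z &
    forall eta : R, 0 < eta ->
    exists (eps : R) (mu : R -> R),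
      let gamma_eps := normal_perturbation gamma eps mu in
      [/\ [/\ 0 < eps, smooth mu & periodic mu (2 * pi)],
          [/\ strongly_convex gamma_eps, (region gamma_eps)° O &
              Ck_norm k (gamma_eps \- gamma) < eta],
          hyperbolic_periodic gamma_eps O x /\
            hyperbolic_periodic gamma_eps O y,
          heteroclinic gamma_eps O x y z &
          exists Vs Vu : {vspace 'rV[R]_2},
            [/\ is_tangent_space (Ws gamma_eps O x) z Vs,
                is_tangent_space (Wu gamma_eps O y) z Vu,
                directv (Vs + Vu)%VS &
                (Vs + Vu)%VS = fullv]].
Proof.
move=> [z hz]; exists z; first exact: hz.
move=> eta eta0.
have [th cc] := strongly_convexP (T1_residual.1 _ T1gamma).1.
have S := billiard_system cc O.
have [n [j [lam [mu [vs [vu sx]]]]]] := least_period_saddle cc x_hyp.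
have [n' [j' [mu' [lam' [vu' [vs' sy]]]]]] := least_period_saddle cc y_hyp.
have sy' := saddle_inv S sy.
have [zx zy zxy] := hz; have Pz := zx.1.
have [[w0 [w00 fw bw]]|no] := pselect (exists w, [/\ w != 0,
    decays (billiard_map gamma O) (Dmap gamma O) n z w &
    decays (billiard_inv gamma O) (Dinv gamma O) n' z w]); last first.
  have s0 : smooth (fun _ : R => 0 : R) by apply/smoothE => m; exact: Cn_cst.
  have p0 : periodic (fun _ : R => 0 : R) (2 * pi) by [].
  have [e0 e00 small] := normal_perturbation_small cc s0 p0 k O_interior eta0.
  have e1 : 0 < e0 / 2 < e0 by apply/andP; split; lra.
  have [_ ie ck] := small _ e1; exists (e0 / 2), (fun=> 0) => G.
  have GE : G = gamma.
    by apply/funext => t; rewrite /G /normal_perturbation mulr0 scale0r addr0.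
  rewrite -/G in ie ck; clearbody G; subst G; split=> //.
  - by case/andP: e1.
  - by split=> //; exact: convex_curve_strongly_convex cc.
  - apply: (transverse_heteroclinic cc sx sy' hz) => w fw bw; apply/eqP; apply: contraT => w0.
    by exfalso; apply: no; exists w.
have [phi hphi] := saddle_stable_param S sx.
have [psi hpsi] := saddle_stable_param (system_inv S) sy'.
have [u zu] := stable_param_point hphi zx; have [v zv] := stable_param_point hpsi zy.
have nzx : ~ cyl_eq z x.
  move=> ezx; apply: (zxy _ ezx); have /andP[_ l1'] := sad_lam sy'.
  have sx' := saddle_inv S sx; have xv := cyl_eq_trans (cyl_eq_sym ezx) zv.
  exact: stable_param_periodic (system_inv S) l1' (sad_gt0 sx') hpsi (sad_in sx) (sad_per sx') xv.
have u0 : u != 0.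
  by apply/eqP => u0; apply: nzx; have [_ [phi0 _] _ _] := hphi; rewrite -phi0 -[in X in phi X]u0.
have vs0 : vs != 0.
  by apply: contraTneq (sad_free sx) => ->; rewrite det2E !mxE !mul0r subrr eqxx.
pose X := [seq base (iter i (billiard_map gamma O) x) | i <- iota 0 n] ++
  [seq base (iter i (billiard_map gamma O) y) | i <- iota 0 n'] ++
  [seq base (iter i (billiard_inv gamma O) y) | i <- iota 0 n'].
have [i [avoid xi0]] := generic_time X S (sad_lam sx) vs0 (Dmap_twist cc (O := O)) hphi zu u0.
pose c := base (iter i (billiard_map gamma O) z).
have apart a : a \in X -> cos (a - c) != 1.
  by move=> aX; rewrite -cosN opprB; exact: avoid.
have inX (f : 'rV[R]_2 -> 'rV[R]_2) p m l : (l < m)%N ->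
    base (iter l f p) \in [seq base (iter i f p) | i <- iota 0 m].
  by move=> lm; apply: (map_f (fun i => base (iter i f p))); rewrite mem_iota.
have apx l : (l < n)%N -> cos (base (iter l (billiard_map gamma O) x) - c) != 1.
  by move=> ln; apply: apart; rewrite mem_cat inX.
have apy l : (l < n')%N -> cos (base (iter l (billiard_map gamma O) y) - c) != 1.
  by move=> ln; apply: apart; rewrite !mem_cat (inX _ y n' l ln) orbT.
have apy' l : (l < n')%N -> cos (base (iter l (billiard_inv gamma O) y) - c) != 1.
  by move=> ln; apply: apart; rewrite !mem_cat (inX _ y n' l ln) !orbT.
have [c1 c11 h1] :=
  periodic_orbit_apart (sys_fwd S) (sad_in sx) (sad_gt0 sx) (sad_per sx) apx.
have [c2 c21 h2] :=
  periodic_orbit_apart (sys_fwd S) (sad_in sy) (sad_gt0 sy) (sad_per sy) apy.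
have [c3 c31 h3] :=
  periodic_orbit_apart (sys_bwd S) (sad_in sy') (sad_gt0 sy') (sad_per sy') apy'.
have [K1 [c4 c41 [h4 t4]]] := asymptotic_orbit_apart c11 zx.2 h1.
have [K2 [c5 c51 [h5 t5]]] := asymptotic_orbit_apart c31 zy.2 h3.
have [b [[b0 b1 b2 b3 b4] [b5 b6]]] : exists b : R, [/\ 0 <= b, b < 1, c1 <= b, c2 <= b &
    c3 <= b] /\ (c4 <= b /\ c5 <= b).
  exists (Num.max 0 (Num.max c1 (Num.max c2 (Num.max c3 (Num.max c4 c5))))).
  by rewrite !le_max !gt_max !lexx !orbT c11 c21 c31 c41 c51 ltr01.
(* a width that separates the chosen bounce from all other bounces *)
pose d := acos ((1 + b) / 2).
have cd : cos d = (1 + b) / 2 by rewrite acosK // in_itv /=; clear -b0 b1; apply/andP; split; lra.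
have d0 : 0 < d < pi.
  by clear -b0 b1; apply/andP; split; [apply: acos_gt0 | apply: acos_ltpi]; apply/andP; split; lra.
have bd : b < cos d by rewrite cd; clear -b1; lra.
have [snu pnu] := bump_field_smooth cc c d.
set nu := normal_field gamma (bump c d) in snu pnu.
have away t : cos (t - c) <= b -> [/\ nu t = 0, derive1 nu t = 0 & derive1 (derive1 nu) t = 0].
  by move=> tb; exact: bump_field_away (le_lt_trans tb bd).
have center t : cos (t - c) = 1 ->
    [/\ nu t = 0, derive1 nu t = 0 & det2 (derive1 (derive1 nu) t) (derive1 gamma t) < 0].
  by move=> tc; apply: (bump_field_center cc d0 tc).
have flat t : cos (t - c) <= b \/ cos (t - c) = 1 ->
    [/\ nu t = 0, derive1 nu t = 0 & det2 (derive1 (derive1 nu) t) (derive1 gamma t) <= 0].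
  move=> [/away[t0 t1 ->]|/center[t0 t1 t2]]; last by split=> //; exact: ltW.
  by split=> //; rewrite det2E !mxE !mul0r subrr.
have flat1 l t : t = base (iter l (billiard_map gamma O) z) \/
      t = base (iter l (billiard_inv gamma O) z) ->
    [/\ nu t = 0, derive1 nu t = 0 & det2 (derive1 (derive1 nu) t) (derive1 gamma t) <= 0].
  move=> [->|->]; apply: flat.
    by case: (h4 l) => h; [left; exact: le_trans h b5 | right].
  by case: (h5 l) => h; [left; exact: le_trans h b6 | right].
have flat2 l t : (maxn K1 K2 <= l)%N -> t = base (iter l (billiard_map gamma O) z) \/
    t = base (iter l (billiard_inv gamma O) z) -> derive1 (derive1 nu) t = 0.
  rewrite geq_max => /andP[l1 l2] [->|->].
    by have [_ _] := away _ (le_trans (t4 l l1) b5).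
  by have [_ _] := away _ (le_trans (t5 l l2) b6).
have bi : det2 (derive1 (derive1 nu) c) (derive1 gamma c) < 0.
  by have [|_ _ +] := center c; first by rewrite subrr cos0.
have [e1 e10 break] := bending_breaks_tangency cc snu Pz (sad_gt0 sx) (sad_gt0 sy') w00 fw bw
  flat1 flat2 bi (xi0 w0 w00 fw).
have [e2 e20 small] := normal_perturbation_small cc (@smooth_bump R c d) (@periodic_bump R c d)
  k O_interior eta0.
pose e := Num.min e1 e2 / 2.
have m0 : 0 < Num.min e1 e2 by rewrite lt_min e10.
have e0 : 0 < e by rewrite divr_gt0.
have em : e < Num.min e1 e2 by rewrite /e; clear -m0; lra.
have ee1 : 0 < e < e1.
  by rewrite e0 (lt_le_trans em) // ge_min lexx.
have ee2 : 0 < e < e2.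
  by rewrite e0 (lt_le_trans em) // ge_min lexx orbT.
have [[th' cc'] intG ck] := small e ee2.
exists e, (bump c d) => G.
have GE : G = fun t => gamma t + e *: nu t := normal_perturbationE gamma (bump c d) e.
rewrite -/G in cc' intG ck.
have osc t : cos (t - c) <= b -> osculate gamma G t.
  by move=> /away[t0 t1 t2]; rewrite GE; exact: (bent_osculate cc snu e t0 t1 t2).
have tch l t : t = base (iter l (billiard_map gamma O) z) \/
    t = base (iter l (billiard_inv gamma O) z) -> touch gamma G t.
  by move=> /flat1[t0 t1 _]; rewrite GE; exact: (bent_touch cc snu e t0 t1).
have ox l : osculate gamma G (base (iter l (billiard_map gamma O) x)).
  exact: osc (le_trans (h1 l) b2).
have oy l : osculate gamma G (base (iter l (billiard_map gamma O) y)).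
  exact: osc (le_trans (h2 l) b3).
have oy' l : osculate gamma G (base (iter l (billiard_inv gamma O) y)).
  exact: osc (le_trans (h3 l) b4).
have [Pz' itz] := touch_orbit cc cc' Pz (fun l => tch l _ (or_introl erefl)).
have itz' := touch_back_orbit cc cc' Pz (fun l => tch l _ (or_intror erefl)).
have [_ itx] := touch_orbit cc cc' (sad_in sx) (fun l => (ox l).1).
have ity' := touch_back_orbit cc cc' (sad_in sy) (fun l => (oy' l).1).
have hz' : heteroclinic G O x y z.
  split; last exact: zxy.
    split; first exact: Pz'.
    have -> : (fun m => cyl_dist (iter m (billiard_map G O) z) (iter m (billiard_map G O) x)) =
        fun m => cyl_dist (iter m (billiard_map gamma O) z) (iter m (billiard_map gamma O) x).
      by apply/funext => m; exact: (congr2 (@cyl_dist R) (itz m) (itx m)).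
    exact: zx.2.
  split; first exact: Pz'.
  have -> : (fun m => cyl_dist (iter m (billiard_inv G O) z) (iter m (billiard_inv G O) y)) =
      fun m => cyl_dist (iter m (billiard_inv gamma O) z) (iter m (billiard_inv gamma O) y).
    by apply/funext => m; exact: (congr2 (@cyl_dist R) (itz' m) (ity' m)).
  exact: zy.2.
split.
- split; [exact: e0 | exact: (@smooth_bump R c d) | exact: (@periodic_bump R c d)].
- split; [exact: convex_curve_strongly_convex cc' | exact: intG | exact: ck].
- have hx := osculate_hyperbolic cc cc' x_hyp ox.
  have hy := osculate_hyperbolic cc cc' y_hyp oy.
  by split; [exact: hx | exact: hy].
- exact: hz'.
- have gx := osculate_saddle cc cc' ox sx.
  have gy := saddle_inv (billiard_system cc' O) (osculate_saddle cc cc' oy sy).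
  apply: (transverse_heteroclinic cc' gx gy hz').
  by move: cc'; rewrite GE => cc'; exact: break ee1 cc'.
Qed.
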